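(* Let $r=\sqrt{4-\sqrt{15}}$ and let $Q:\mathbb{Z}^2\to\mathbb{R}$ be the $(3,3)$-periodic potential with $Q(n,m)=q_{1+n+3m}$ for $n,m\in\{0,1,2\}$, where $$(q_1,\ldots,q_9)=\Big(-r-\tfrac1r+2,\ -r,\ -r+\tfrac1r-2,\ -\tfrac1r,\ 0,\ \tfrac1r,\ r-\tfrac1r-2,\ r,\ r+\tfrac1r+2\Big),$$ and let $H_\lambda=\Delta_{\mathrm{sqn}}+\lambda Q$. Then, for all $\lambda>0$ sufficiently small, $\sigma(H_\lambda)$ consists of two connected components. Moreover, if $\mathfrak{g}_\lambda$ denotes the gap that opens at energy $-1$ (the connected component of $\mathbb{R}\setminus\sigma(H_\lambda)$ containing $-1$), one has, for all sufficiently small $\lambda>0$, $$\left(-1-\tfrac{\lambda}{10},-1+\tfrac{\lambda}{10}\right)\subseteq\mathfrak{g}_\lambda\subseteq\left(-1-\tfrac{\lambda}{4},-1+\tfrac{\lambda}{4}\right).$$ In particular, the gap opens linearly.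
   Context: EHM lattice (square lattice with next-nearest neighbor interactions): the vertex set is $\mathbb{Z}^2$, and $\bm{n}\sim\bm{n}'$ iff $\|\bm{n}-\bm{n}'\|_\infty=1$. The Laplacian $\Delta_{\mathrm{sqn}}$ is the bounded self-adjoint operator on $\ell^2(\mathbb{Z}^2)$ given by $[\Delta_{\mathrm{sqn}}\psi]_{\bm{n}}=\sum_{\bm{n}'\sim\bm{n}}\psi_{\bm{n}'}$ (the adjacency operator). $Q$ acts by multiplication. $Q$ is $(3,3)$-periodic if $Q(n+3,m)=Q(n,m+3)=Q(n,m)$ for all $(n,m)\in\mathbb{Z}^2$. $\sigma$ denotes spectrum. *)

(* Defs.v *)
From mathcomp Require Import all_boot all_order all_algebra.
From mathcomp Require Import all_classical all_reals all_analysis.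
From mathcomp Require Import complex.

Set Implicit Arguments.
Unset Strict Implicit.
Unset Printing Implicit Defensive.

Import Order.TTheory GRing.Theory Num.Theory.
Import numFieldNormedType.Exports.

Local Open Scope classical_set_scope.
Local Open Scope ring_scope.
Local Open Scope complex_scope.

Definition Z2 : Type := (int * int)%type.

Section Ell2.
Context {R : realType}.

Implicit Types (psi phi : Z2 -> R[i]) (A B : (Z2 -> R[i]) -> (Z2 -> R[i])).

Definition ell2_sqnorm psi : \bar R :=
  \esum_(n in [set: Z2]) ((ComplexField.Normc.normc (psi n) ^+ 2)%:E)%E.

Definition ell2 : set (Z2 -> R[i]) := [set psi | (ell2_sqnorm psi < +oo)%E].

Definition ell2_norm psi : R := Num.sqrt (fine (ell2_sqnorm psi)).

(* Operators are functions on all sequences, but only their values on ell2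
   matter: every condition below is restricted to ell2. *)
Definition bounded_operator B : Prop :=
  [/\ forall psi, ell2 psi -> ell2 (B psi),
      forall (a : R[i]) psi phi, ell2 psi -> ell2 phi ->
        B (fun n => a * psi n + phi n) = (fun n => a * B psi n + B phi n) &
      exists M : R, forall psi, ell2 psi ->
        ell2_norm (B psi) <= M * ell2_norm psi].

Definition shift_operator A (z : R[i]) : (Z2 -> R[i]) -> (Z2 -> R[i]) :=
  fun psi n => A psi n - z * psi n.

Definition resolvent_set A : set R[i]^o :=
  [set z | exists B, bounded_operator B /\
    forall psi, ell2 psi ->
      B (shift_operator A z psi) = psi /\ shift_operator A z (B psi) = psi].

(* R[i]^o is the complex plane with the topology of the modulus. *)
Definition spectrum A : set R[i]^o := ~` resolvent_set A.

Definition real_resolvent_set A : set R :=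
  [set E : R | ~ spectrum A (E%:C : R[i]^o)].

Definition sqn_adj (n n' : Z2) : Prop :=
  Num.max `|n.1 - n'.1| `|n.2 - n'.2| = 1 :> int.

(* The index set is finite, so this finitely supported sum is the sum over all
   eight neighbors. *)
Definition laplacian_sqn psi : Z2 -> R[i] :=
  fun n => \sum_(n' \in [set n' | sqn_adj n n']) psi n'.

Definition schrodinger_sqn (V : Z2 -> R) psi : Z2 -> R[i] :=
  fun n => laplacian_sqn psi n + (V n)%:C * psi n.

Definition periodic33 (V : Z2 -> R) : Prop :=
  forall n m : int, V (n + 3, m) = V (n, m) /\ V (n, m + 3) = V (n, m).

End Ell2.

Definition connected_components {T : topologicalType} (S : set T) :
    set (set T) :=
  [set connected_component S x | x in S].

(* q_1, ..., q_9; the sequence is indexed from 0, so q_k is its entry k - 1. *)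
Definition ehm_q (R : realType) : seq R :=
  let r : R := Num.sqrt (4 - Num.sqrt 15) in
  [:: - r - r^-1 + 2;
      - r;
      - r + r^-1 - 2;
      - r^-1;
      0;
      r^-1;
      r - r^-1 - 2;
      r;
      r + r^-1 + 2].

(* Main.v *)
(* Bloch-Floquet theory turns H + 1 into the 9x9 blocks X |-> J nu X J mu + lam Q o X, one for
   each pair of unit complex numbers nu, mu, where J nu is a twisted circulant and o the
   entrywise product. A real energy lies in the spectrum iff some block is singular there:
   truncated Bloch waves are Weyl sequences, and if no block is singular then compactness of
   the momenta and Parseval make (H - x)^2 + y^2 bounded below, so a Neumann series inverts it.

   No block is singular at distance at most lam / 10 from -1. For momenta away from the zeros
   of det J this is a norm estimate. Close to them the perturbation lam (Q - t) is compressed to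
   the almost-kernel of X |-> J nu X J mu, and this compression is invertible: by a determinant
   whose terms all have the same sign, or, when both momenta are O(lam), because the form is
   definite of opposite signs on two explicit subspaces of complementary dimensions, on which
   the terms linear in the momenta vanish.

   Outside the spectrum the number of eigenvalues below the energy does not depend on the
   momenta. Comparing the momenta (0, 0), (0, pi) and (pi, pi), where the blocks at lam = 0 have
   eigenvalues {9, 0}, {6, 0, -3} and {4, 1, -2}, excludes every gap other than the one at -1,
   and at (0, 0) the energies -1 - lam / 4 and -1 + lam / 4 are excluded from that gap. *)
Require Import Defs.
From HB Require Import structures.
From mathcomp Require Import all_boot all_order all_algebra.
From mathcomp Require Import reals complex ring lra.

Set Implicit Arguments.
Unset Strict Implicit.
Unset Printing Implicit Defensive.

Import Order.TTheory GRing.Theory Num.Theory.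
Local Open Scope ring_scope.
Local Open Scope complex_scope.
Local Notation Re := complex.Re.
Local Notation Im := complex.Im.
Local Notation nrm := ComplexField.Normc.normc.

(** * Bloch blocks *)

(** [J 1] has rank one, so X |-> J nu X J mu has a kernel of dimension 6 at a generic point of the
    curves nu^3 = 1 and mu^3 = 1, and of dimension 8 where they meet; near them its eigenvalues
    leave 0 linearly in the momenta. These linear terms compete with lam Q at momenta of order lam,
    so no single perturbation estimate covers all momenta. For nu near 1 and mu not within O(lam) of
    1 the equation is paired with p x - p' x' instead of X = p x + p' x' + ..., and self-adjointness
    of [J mu] cancels them. For mu, but not nu, within O(lam) of 1 they are kept as a bounded
    parameter tau, and a Schur complement is invertible for every tau. When both are within O(lam)
    of 1 they vanish on blocks whose three row sums, and whose three column sums, are collinear in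
    the complex plane.

    The half-width lam / 10 is close to the limit of the pairing argument, which needs 15 / r - 30 -
    26 r > 26 t, that is t < 0.1085...; hence the tight rational enclosure of r. *)

Lemma ord3P (P : 'I_3 -> Prop) : P 0 -> P 1 -> P 2 -> forall i, P i.
Proof.
move=> P0 P1 P2 [[|[|[|//]]] lti].
- by rewrite (_ : Ordinal lti = 0) //; apply: val_inj.
- by rewrite (_ : Ordinal lti = 1) //; apply: val_inj.
- by rewrite (_ : Ordinal lti = 2) //; apply: val_inj.
Qed.

Lemma sum3 (V : nmodType) (F : 'I_3 -> V) : \sum_i F i = F 0 + F 1 + F 2.
Proof.
rewrite !big_ord_recl big_ord0 addr0 addrA.
by congr (F _ + F _ + F _); apply: val_inj.
Qed.

Lemma ord3_add (i : 'I_3) :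
  [/\ (0 + 1 = 1 :> 'I_3), (1 + 1 = 2 :> 'I_3) & (2 + 1 = 0 :> 'I_3)] *
  [/\ (0 - 1 = 2 :> 'I_3), (1 - 1 = 0 :> 'I_3) & (2 - 1 = 1 :> 'I_3)].
Proof. by split; split; apply: val_inj. Qed.

(** * Real inner products and norms of complex matrices *)

Section InnerProduct.
Context {R : realType}.
Local Notation C := R[i].

(** This is the real part of z times the conjugate of w. A real-valued form keeps all comparisons in
    [R]; for complex-linear maps the imaginary part is recovered by multiplying one argument by
    ['i]. *)
Definition ipc (z w : C) : R := Re z * Re w + Im z * Im w.

Definition ip m n (A B : 'M[C]_(m, n)) : R :=
  locked (\sum_i \sum_j ipc (A i j) (B i j)).

Lemma ipE m n (A B : 'M[C]_(m, n)) : ip A B = \sum_i \sum_j ipc (A i j) (B i j).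
Proof. by rewrite /ip; unlock. Qed.

Definition nsq m n (A : 'M[C]_(m, n)) : R := ip A A.

Lemma ipcC z w : ipc z w = ipc w z.
Proof. by rewrite /ipc; ring. Qed.

Lemma ipcDl x y z : ipc (x + y) z = ipc x z + ipc y z.
Proof. by case: x y => a b [c d]; rewrite /ipc /=; ring. Qed.

Lemma ipcMl a x y : ipc (a * x) y = ipc x (a^* * y).
Proof. by case: a x y => a b [c d] [e f]; rewrite /ipc /=; ring. Qed.

Lemma ipcRl (a : R) x y : ipc (a%:C * x) y = a * ipc x y.
Proof. by case: x y => c d [e f]; rewrite /ipc /=; ring. Qed.

Lemma ipcc_ge0 z : 0 <= ipc z z.
Proof. by rewrite /ipc -!expr2 addr_ge0 ?sqr_ge0. Qed.

Lemma ipcc_eq0 z : (ipc z z == 0) = (z == 0).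
Proof.
case: z => a b; rewrite /ipc -!expr2 paddr_eq0 ?sqr_ge0 //= !sqrf_eq0.
by rewrite eq_complex.
Qed.

Lemma ipcM z w : ipc (z * w) (z * w) = ipc z z * ipc w w.
Proof. by case: z w => a b [c d]; rewrite /ipc /=; ring. Qed.

Lemma normc_sqr (z : C) : ComplexField.Normc.normc z ^+ 2 = ipc z z.
Proof.
by case: z => a b; rewrite /ipc -!expr2 sqr_sqrtr // addr_ge0 ?sqr_ge0.
Qed.

Section Matrices.
Context {m n : nat}.
Implicit Types A B D : 'M[C]_(m, n).

Lemma ipC A B : ip A B = ip B A.
Proof.
by rewrite !ipE; apply: eq_bigr => i _; apply: eq_bigr => j _; rewrite ipcC.
Qed.

Lemma ipDl A B D : ip (A + B) D = ip A D + ip B D.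
Proof.
rewrite !ipE -big_split /=; apply: eq_bigr => i _.
by rewrite -big_split /=; apply: eq_bigr => j _; rewrite mxE ipcDl.
Qed.

Lemma ipDr A B D : ip A (B + D) = ip A B + ip A D.
Proof. by rewrite ipC ipDl !(ipC A). Qed.

Lemma ipZl a A B : ip (a *: A) B = ip A (a^* *: B).
Proof.
by rewrite !ipE; apply: eq_bigr => i _; apply: eq_bigr => j _; rewrite !mxE ipcMl.
Qed.

Lemma ipRl (a : R) A B : ip (a%:C *: A) B = a * ip A B.
Proof.
rewrite !ipE mulr_sumr; apply: eq_bigr => i _.
by rewrite mulr_sumr; apply: eq_bigr => j _; rewrite !mxE ipcRl.
Qed.

Lemma ipRr (a : R) A B : ip A (a%:C *: B) = a * ip A B.
Proof. by rewrite ipC ipRl ipC. Qed.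

Lemma ipNl A B : ip (- A) B = - ip A B.
Proof. by rewrite -scaleN1r -[-1](rmorphN1 (real_complex R)) ipRl mulN1r. Qed.

Lemma ipNr A B : ip A (- B) = - ip A B.
Proof. by rewrite ipC ipNl ipC. Qed.

Lemma ip0l A : ip 0 A = 0.
Proof. by rewrite -(subrr A) ipDl ipNl subrr. Qed.

Lemma ip0r A : ip A 0 = 0.
Proof. by rewrite ipC ip0l. Qed.

Lemma nsq_ge0 A : 0 <= nsq A.
Proof.
by rewrite /nsq ipE; do 2!apply: sumr_ge0 => ? _; rewrite ipcc_ge0.
Qed.

Lemma nsq_eq0 A : (nsq A == 0) = (A == 0).
Proof.
apply/eqP/eqP => [|->]; last by rewrite /nsq ip0l.
rewrite /nsq ipE => A0.
apply/matrixP => i j; rewrite mxE; apply/eqP; rewrite -ipcc_eq0.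
have rowge0 k : 0 <= \sum_j ipc (A k j) (A k j).
  by apply: sumr_ge0 => ? _; rewrite ipcc_ge0.
have Ai : \sum_j ipc (A i j) (A i j) = 0.
  by apply: (psumr_eq0P _ A0) => [k _|]; rewrite ?rowge0.
by rewrite (psumr_eq0P _ Ai) // => k _; rewrite ipcc_ge0.
Qed.

Lemma nsq_gt0 A : (0 < nsq A) = (A != 0).
Proof. by rewrite lt_def nsq_ge0 nsq_eq0 andbT. Qed.

Lemma nsqZ a A : nsq (a *: A) = ipc a a * nsq A.
Proof.
rewrite /nsq !ipE mulr_sumr; apply: eq_bigr => i _.
by rewrite mulr_sumr; apply: eq_bigr => j _; rewrite mxE ipcM.
Qed.

Lemma nsqR (a : R) A : nsq (a%:C *: A) = a ^+ 2 * nsq A.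
Proof. by rewrite nsqZ /ipc /= mulr0 addr0 expr2. Qed.

Lemma nsqD A B : nsq (A + B) = nsq A + ip A B *+ 2 + nsq B.
Proof. by rewrite /nsq ipDl !ipDr (ipC B A); ring. Qed.

Lemma ip_young (t : R) A B : 0 < t -> `|ip A B| *+ 2 <= t * nsq A + t^-1 * nsq B.
Proof.
move=> t0; have tV : t * t^-1 = 1 by rewrite divff // gt_eqF.
have h (e : R) : e ^+ 2 = 1 -> e * ip A B *+ 2 <= t * nsq A + t^-1 * nsq B.
  move=> e1; have := nsq_ge0 (t%:C *: A - e%:C *: B).
  rewrite -[- (e%:C *: _)]scaleNr -rmorphN nsqD ipRl ipRr !nsqR sqrrN e1 mul1r.
  rewrite -(pmulr_rge0 _ (x := t^-1)) ?invr_gt0 // => h.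
  rewrite -subr_ge0; apply: le_trans h _; rewrite le_eqVlt; apply/orP; left.
  by apply/eqP; field; rewrite gt_eqF.
have hp : ip A B *+ 2 <= t * nsq A + t^-1 * nsq B.
  by have := h 1; rewrite expr1n mul1r; apply.
have hn : - ip A B *+ 2 <= t * nsq A + t^-1 * nsq B.
  by have := h (-1); rewrite sqrrN expr1n mulN1r; apply.
by case: (ler0P (ip A B)).
Qed.

Lemma nsqD_le A B : nsq (A + B) <= nsq A *+ 2 + nsq B *+ 2.
Proof.
have := ip_young A B ltr01; rewrite invr1 !mul1r nsqD => h.
have : ip A B *+ 2 <= `|ip A B| *+ 2 by rewrite lerMn2r ler_norm orbT.
by lra.
Qed.

End Matrices.

Lemma ip_adj m n p (M : 'M[C]_(m, n)) (A : 'M_(n, p)) (B : 'M_(m, p)) :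
  ip (M *m A) B = ip A ((\matrix_(i, j) (M j i)^*) *m B).
Proof.
have sumcl (I : finType) (F : I -> C) z : ipc (\sum_i F i) z = \sum_i ipc (F i) z.
  by apply: (big_morph (ipc ^~ z)) => [x y|]; rewrite ?ipcDl // /ipc !mul0r addr0.
rewrite !ipE; transitivity (\sum_i \sum_k \sum_j ipc (M i j * A j k) (B i k)).
  by apply: eq_bigr => i _; apply: eq_bigr => k _; rewrite mxE sumcl.
transitivity (\sum_j \sum_k \sum_i ipc (M i j * A j k) (B i k)).
  rewrite exchange_big /= [RHS]exchange_big /=; apply: eq_bigr => k _.
  by rewrite exchange_big.
apply: eq_bigr => j _; apply: eq_bigr => k _; rewrite ipcC mxE sumcl.
by apply: eq_bigr => i _; rewrite mxE ipcMl ipcC.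
Qed.

Lemma ip_tr m n (A B : 'M[C]_(m, n)) : ip A^T B^T = ip A B.
Proof.
rewrite !ipE exchange_big /=; apply: eq_bigr => i _.
by apply: eq_bigr => j _; rewrite !mxE.
Qed.

End InnerProduct.

(** * Twisted circulants and their distance from singularity *)

Section TwistedShift.
Context {R : realType}.
Local Notation C := R[i].

Definition unitc (z : C) : bool := ipc z z == 1.

(* Entry (i, j) of the Bloch matrix of psi(n-1) + psi(n) + psi(n+1). *)
Definition J (nu : C) : 'M[C]_3 :=
  \matrix_(i, j) if j == i then 1 else if j == i + 1 then nu else nu^*.

Lemma J_mulE nu n (A : 'M[C]_(3, n)) i j :
  (J nu *m A) i j = A i j + nu * A (i + 1) j + nu^* * A (i - 1) j.
Proof.
have [[e01 e12 e20] [d02 d10 d21]] := ord3_add 0.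
rewrite mxE sum3 !mxE; elim/ord3P: i; rewrite ?(e01, e12, e20, d02, d10, d21) /=;
  by rewrite mul1r; ring.
Qed.

Lemma J_adj nu : (\matrix_(i, j) (J nu j i)^*) = J nu.
Proof.
apply/matrixP => i j; rewrite !mxE.
by elim/ord3P: i; elim/ord3P: j; rewrite ?conjc1 ?conjcK.
Qed.

Lemma J_tr nu : (J nu)^T = J nu^*.
Proof.
apply/matrixP => i j; rewrite !mxE.
by elim/ord3P: i; elim/ord3P: j; rewrite ?conjc1 ?conjcK.
Qed.

Lemma ip_J nu n (A B : 'M[C]_(3, n)) : ip (J nu *m A) B = ip A (J nu *m B).
Proof. by rewrite ip_adj J_adj. Qed.

Lemma ip_Jr nu n (A B : 'M[C]_(n, 3)) : ip (A *m J nu) B = ip A (B *m J nu).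
Proof. by rewrite -ip_tr -[RHS]ip_tr !trmx_mul !J_tr ip_J. Qed.

(** At nu = c + i s the eigenvalues of [J nu] are 1 + 2 c and 1 - c +- sqrt 3 s, and for c >= 1/2
    each has modulus at least |s|. The inequality is this fact for one column with real parts [x]
    and imaginary parts [y], proved without diagonalising. *)
Lemma J_lower3 (c s x0 x1 x2 y0 y1 y2 : R) :
  c ^+ 2 + s ^+ 2 = 1 -> 1 / 2 <= c ->
  s ^+ 2 * (x0 ^+ 2 + y0 ^+ 2 + (x1 ^+ 2 + y1 ^+ 2) + (x2 ^+ 2 + y2 ^+ 2)) <=
  (x0 + (c * x1 - s * y1) + (c * x2 + s * y2)) ^+ 2 +
  (y0 + (c * y1 + s * x1) + (c * y2 - s * x2)) ^+ 2 +
  ((x1 + (c * x2 - s * y2) + (c * x0 + s * y0)) ^+ 2 +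
   (y1 + (c * y2 + s * x2) + (c * y0 - s * x0)) ^+ 2) +
  ((x2 + (c * x0 - s * y0) + (c * x1 + s * y1)) ^+ 2 +
   (y2 + (c * y0 + s * x0) + (c * y1 - s * x1)) ^+ 2).
Proof.
move=> cs c2; rewrite -subr_ge0.
pose a := 1 - c.
have a_le : a ^+ 2 <= s ^+ 2 / 2 by rewrite /a; nra.
have c_ge : s ^+ 2 <= (1 + 2 * c) ^+ 2 by nra.
pose b0 := x0 - (x0 + x1 + x2) / 3; pose b1 := x1 - (x0 + x1 + x2) / 3.
pose b2 := x2 - (x0 + x1 + x2) / 3.
pose d0 := y0 - (y0 + y1 + y2) / 3; pose d1 := y1 - (y0 + y1 + y2) / 3.
pose d2 := y2 - (y0 + y1 + y2) / 3.
(* Splitting the column into its mean and the mean-free parts [b], [d] turns the difference into a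
   combination of squares; the first two coefficients are nonnegative by [c_ge] and [a_le]. *)
rewrite (_ : _ - _ =
  ((1 + 2 * c) ^+ 2 - s ^+ 2) * ((x0 + x1 + x2) ^+ 2 + (y0 + y1 + y2) ^+ 2) / 3 +
  (s ^+ 2 / 2 - a ^+ 2) * (b0 ^+ 2 + b1 ^+ 2 + b2 ^+ 2 + d0 ^+ 2 + d1 ^+ 2 + d2 ^+ 2)
  + ((2 * a * b0 - s * (y1 - y2)) ^+ 2 + (2 * a * d0 + s * (x1 - x2)) ^+ 2 +
     (2 * a * b1 - s * (y2 - y0)) ^+ 2 + (2 * a * d1 + s * (x2 - x0)) ^+ 2 +
     (2 * a * b2 - s * (y0 - y1)) ^+ 2 + (2 * a * d2 + s * (x0 - x1)) ^+ 2) / 2);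
  last by rewrite /a /b0 /b1 /b2 /d0 /d1 /d2; field.
move: a_le c_ge; rewrite -subr_ge0 => a_le; rewrite -subr_ge0 => c_ge.
apply: addr_ge0; [apply: addr_ge0|].
- by rewrite divr_ge0 // mulr_ge0 // addr_ge0 ?sqr_ge0.
- by rewrite mulr_ge0 // !addr_ge0 ?sqr_ge0.
- by rewrite divr_ge0 // !addr_ge0 ?sqr_ge0.
Qed.

Lemma nsq_J_ge (nu : C) n (A : 'M[C]_(3, n)) : unitc nu -> 1 / 2 <= Re nu ->
  Im nu ^+ 2 * nsq A <= nsq (J nu *m A).
Proof.
case: nu => c s /eqP; rewrite /ipc /= -!expr2 => cs c2.
rewrite /nsq !ipE exchange_big mulr_sumr [X in _ <= X]exchange_big /=.
apply: ler_sum => j _; rewrite !sum3 !J_mulE.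
have [[e01 e12 e20] [d02 d10 d21]] := ord3_add 0.
rewrite ?(e01, e12, e20, d02, d10, d21).
case: (A 0 j) (A 1 j) (A 2 j) => x0 y0 [x1 y1] [x2 y2]; rewrite /ipc /=.
have := @J_lower3 c s x0 x1 x2 y0 y1 y2 cs c2; rewrite !expr2.
by rewrite !(mulNr, opprK).
Qed.

Lemma nsq_Jr_ge (nu : C) n (A : 'M[C]_(n, 3)) : unitc nu -> 1 / 2 <= Re nu ->
  Im nu ^+ 2 * nsq A <= nsq (A *m J nu).
Proof.
case: nu => a b u c; rewrite -[nsq (_ *m _)]ip_tr -[nsq A]ip_tr trmx_mul J_tr.
have := @nsq_J_ge (a +i* b)^* n A^T; rewrite /= sqrrN; apply => //.
by move: u; rewrite /unitc /ipc /= mulrNN.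
Qed.

End TwistedShift.

(** * The gap at -1 *)

Lemma ler_sqr_bound (R : realDomainType) (u b : R) :
  - b <= u -> u <= b -> u ^+ 2 <= b ^+ 2.
Proof.
rewrite -subr_ge0 => ub; rewrite -subr_ge0 => bu.
by rewrite -subr_ge0 subr_sqr mulr_ge0 //; move: ub; rewrite opprK addrC.
Qed.

Section Hadamard.
Context {R : realType}.
Local Notation C := R[i].

Definition had m n (w : 'I_m -> 'I_n -> R) (X : 'M[C]_(m, n)) : 'M[C]_(m, n) :=
  \matrix_(i, j) ((w i j)%:C * X i j).

Lemma hadD m n (w : 'I_m -> 'I_n -> R) X Y : had w (X + Y) = had w X + had w Y.
Proof. by apply/matrixP => i j; rewrite !mxE mulrDr. Qed.

Lemma hadZ m n (w : 'I_m -> 'I_n -> R) a X : had w (a *: X) = a *: had w X.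
Proof. by apply/matrixP => i j; rewrite !mxE mulrCA. Qed.

Lemma ip_had m n (w : 'I_m -> 'I_n -> R) X Y : ip (had w X) Y = ip X (had w Y).
Proof.
rewrite !ipE; apply: eq_bigr => i _; apply: eq_bigr => j _.
by rewrite !mxE ipcRl [RHS]ipcC ipcRl ipcC.
Qed.

Lemma ip_had_sum m n (w : 'I_m -> 'I_n -> R) X :
  ip (had w X) X = \sum_i \sum_j w i j * ipc (X i j) (X i j).
Proof.
by rewrite ipE; apply: eq_bigr => i _; apply: eq_bigr => j _; rewrite !mxE ipcRl.
Qed.

Lemma nsq_had m n (w : 'I_m -> 'I_n -> R) (b : R) X :
  (forall i j, w i j ^+ 2 <= b) -> nsq (had w X) <= b * nsq X.
Proof.
move=> wb; rewrite /nsq !ipE mulr_sumr; apply: ler_sum => i _.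
rewrite mulr_sumr; apply: ler_sum => j _; rewrite mxE ipcM.
by rewrite /ipc /= !mul0r addr0 -!expr2 ler_wpM2r ?addr_ge0 ?sqr_ge0.
Qed.

Definition rowr (a0 a1 a2 : R) : 'rV[C]_3 :=
  \row_j (if j == 0 then a0 else if j == 1 then a1 else a2)%:C.

Definition colr (a0 a1 a2 : R) : 'cV[C]_3 := (rowr a0 a1 a2)^T.

Lemma rowr_mulE a0 a1 a2 n (X : 'M[C]_(3, n)) i j :
  (rowr a0 a1 a2 *m X) i j = a0%:C * X 0 j + a1%:C * X 1 j + a2%:C * X 2 j.
Proof. by rewrite mxE sum3 !mxE. Qed.

Lemma nsq_rowr_mul a0 a1 a2 n (X : 'M[C]_(3, n)) :
  nsq (rowr a0 a1 a2 *m X) <= (a0 ^+ 2 + a1 ^+ 2 + a2 ^+ 2) * nsq X.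
Proof.
rewrite /nsq !ipE big_ord_recl big_ord0 addr0 [X in _ <= _ * X]exchange_big.
rewrite mulr_sumr; apply: ler_sum => j _; rewrite !rowr_mulE sum3.
case: (X 0 j) (X 1 j) (X 2 j) => x0 y0 [x1 y1] [x2 y2]; rewrite /ipc /=.
rewrite -subr_ge0 (_ : _ - _ = (a0 * x1 - a1 * x0) ^+ 2 + (a0 * y1 - a1 * y0) ^+ 2 +
  ((a0 * x2 - a2 * x0) ^+ 2 + (a0 * y2 - a2 * y0) ^+ 2) +
  ((a1 * x2 - a2 * x1) ^+ 2 + (a1 * y2 - a2 * y1) ^+ 2)); last by ring.
by rewrite !addr_ge0 ?sqr_ge0.
Qed.

Lemma nsq_colr_mul a0 a1 a2 n (x : 'rV[C]_n) :
  nsq (colr a0 a1 a2 *m x) = (a0 ^+ 2 + a1 ^+ 2 + a2 ^+ 2) * nsq x.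
Proof.
rewrite /nsq !ipE sum3 big_ord1 !mulrDl; congr (_ + _ + _);
  by rewrite mulr_sumr; apply: eq_bigr => j _; rewrite mxE big_ord1 !mxE ipcM;
     rewrite /ipc /= mulr0 addr0 expr2.
Qed.

Lemma nsqD3 m n (A B D : 'M[C]_(m, n)) :
  nsq (A + B + D) <= 3 * (nsq A + nsq B + nsq D).
Proof.
have yo (X Y : 'M[C]_(m, n)) : ip X Y *+ 2 <= nsq X + nsq Y.
  have := ip_young X Y ltr01; rewrite invr1 !mul1r; apply: le_trans.
  by rewrite lerMn2r ler_norm orbT.
rewrite !nsqD ipDl; move: (yo A B) (yo A D) (yo B D).
move: (ip A B) (ip A D) (ip B D) (nsq A) (nsq B) (nsq D) => a b c d e f.
by rewrite !mulr2n; lra.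
Qed.

Lemma rowr_const_J a (nu : C) :
  rowr a a a *m J nu = (1 + 2 * Re nu)%:C *: rowr a a a.
Proof.
apply/matrixP => i j; rewrite rowr_mulE !mxE.
by elim/ord3P: j => /=; case: nu => c s; apply/eqP; rewrite eq_complex /=;
  apply/andP; split; apply/eqP; ring.
Qed.

Lemma ip_i m n (A B : 'M[C]_(m, n)) : ip A ('i *: B) = - ip ('i *: A) B.
Proof.
rewrite !ipE -sumrN; apply: eq_bigr => i _; rewrite -sumrN; apply: eq_bigr => j _.
by rewrite !mxE; case: (A i j) (B i j) => a b [c d]; rewrite /ipc /=; ring.
Qed.

Lemma ip_cols n (A B : 'M[C]_(3, n)) :
  ip A B = \sum_j (ipc (A 0 j) (B 0 j) + ipc (A 1 j) (B 1 j) + ipc (A 2 j) (B 2 j)).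
Proof. by rewrite ipE exchange_big; apply: eq_bigr => j _; rewrite sum3. Qed.

End Hadamard.

(** * The potential on one cell *)

Section Potential.
Context {R : realType}.
Local Notation C := R[i].

Definition gg (i : 'I_3) : R := (nat_of_ord i)%:R - 1.

(** With centred indices g = -1, 0, 1 the nine values q become affine in each index separately, so
    the potential on a fixed column of the cell is a diagonal matrix depending on one parameter. *)
Definition pot (r : R) (i j : 'I_3) : R :=
  r * gg j + r^-1 * gg i + 2 * (gg i * gg j).

Lemma gg0 : gg 0 = -1. Proof. by rewrite /gg /= sub0r. Qed.
Lemma gg1 : gg 1 = 0. Proof. by rewrite /gg /= subrr. Qed.
Lemma gg2 : gg 2 = 1. Proof. by rewrite /gg /= mulr2n addrK. Qed.
Definition ggE := (gg0, gg1, gg2).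

(** The last bound does not follow from the others, which only give 32.64. It makes 15 / r - 30 - 26
    r - 26 t, the potential on p in the least favourable column, positive up to t = 1/10. *)
Definition r_bounds (r : R) :=
  [/\ 35 / 100 < r, r < 36 / 100, 28 / 10 < r^-1, r^-1 < 282 / 100 &
      328 / 10 < 15 * r^-1 - 26 * r].

Lemma pot_le6 r t i j : r_bounds r -> `|t| <= 1 -> (pot r i j - t) ^+ 2 <= 49.
Proof.
move=> [r1 r2 r3 r4 _]; rewrite ler_norml => /andP[t1 t2].
rewrite (_ : 49 = 7 ^+ 2); last by ring.
rewrite /pot; have r0 : 0 < r < 1 by apply/andP; split; lra.
have ri0 : 0 < r^-1 < 3 by apply/andP; split; lra.
case/andP: r0 => r0 r0'; case/andP: ri0; move: r3 r4; move: r^-1 => ri _ _ ri0 ri0'.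
clear r1 r2.
by apply: ler_sqr_bound; elim/ord3P: i; elim/ord3P: j; rewrite !ggE; lra.
Qed.

End Potential.

(** * Momenta with [nu] close to 1 and [mu] not within O(lam) of 1 *)

Section Region2.
Context {R : realType}.
Local Notation C := R[i].

Local Notation p := (colr (-1 : R) (-3) 4).
Local Notation p' := (colr (4 : R) (-3) (-1)).

(* The vectors p and p' span the sum-zero vectors and are isotropic for the
   Hermitian form i(T - T^-1), where T is the cyclic shift. *)
Lemma isotropic_form (nu : C) (x x' z z' : 'rV[C]_3) (w : 'rV[C]_3) :
  ip x z' = ip x' z -> ip x ('i *: z') = - ip x' ('i *: z) ->
  ip (p *m x - p' *m x')
     (J nu *m (colr 1 1 1 *m w + p *m z + p' *m z')) =
  26 * (1 - Re nu) * (ip x z - ip x' z').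
Proof.
move=> h1 h2.
transitivity (\sum_j (26 * (1 - Re nu) * (ipc (x 0 j) (z 0 j) - ipc (x' 0 j) (z' 0 j))
  + (1 - Re nu) * (ipc (x 0 j) (z' 0 j) - ipc (x' 0 j) (z 0 j))
  + 45 * Im nu * (ipc (x 0 j) ('i * z' 0 j) + ipc (x' 0 j) ('i * z 0 j)))).
  rewrite ip_cols; apply: eq_bigr => j _.
  rewrite !J_mulE; have [[-> -> ->] [-> -> ->]] := ord3_add 0.
  rewrite !mxE !big_ord1 !mxE /= .
  case: nu (x 0 j) (x' 0 j) (z 0 j) (z' 0 j) (w 0 j) => c s [x1 x2] [x1' x2'].
  by move=> [z1 z2] [z1' z2'] [w1 w2]; rewrite /ipc /=; ring.
transitivity (26 * (1 - Re nu) * (ip x z - ip x' z') +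
  (1 - Re nu) * (ip x z' - ip x' z) +
  45 * Im nu * (ip x ('i *: z') + ip x' ('i *: z))); last by rewrite h1 h2; ring.
rewrite !ipE !big_ord1 -!sumrB -big_split !mulr_sumr -!big_split /=.
by apply: eq_bigr => j _; rewrite !mxE.
Qed.

(** The three rows form the basis dual to (1, 1, 1), p, p'. *)
Lemma decomposition n (X : 'M[C]_(3, n)) :
  X = colr 1 1 1 *m (rowr (1 / 3) (1 / 3) (1 / 3) *m X) +
      p *m (rowr (- (2 / 45)) (- (5 / 45)) (7 / 45) *m X) +
      p' *m (rowr (7 / 45) (- (5 / 45)) (- (2 / 45)) *m X).
Proof.
have eqC (a b c d : R) : a = c -> b = d -> a +i* b = c +i* d by move=> -> ->.
apply/matrixP => i j; rewrite !mxE !big_ord1 !rowr_mulE !mxE.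
elim/ord3P: i => /=; case: (X 0 j) (X 1 j) (X 2 j) => x0 y0 [x1 y1] [x2 y2];
  by apply: eqC => /=; field.
Qed.

(** The terms pairing p with p' cancel because the potential is diagonal and real. What remains
    weighs column j by the squares (1, 9, 16) of p and (16, 9, 1) of p': the coefficients are 15
    (1/r + 2 g_j) + 26 (r g_j - t) for x and, after the sign change, 15 (1/r + 2 g_j) - 26 (r g_j -
    t) for x'. Both are at least 2/10 by [r_bounds], and half of this absorbs the coupling to y. *)
Lemma potential_form r t (x x' y : 'rV[C]_3) :
  r_bounds r -> `|t| <= 1 / 10 ->
  (nsq x + nsq x') / 10 - 12000 * nsq y <=
  ip (p *m x - p' *m x')
     (had (fun i j => pot r i j - t) (colr 1 1 1 *m y + p *m x + p' *m x')).
Proof.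
move=> [r1 r2 r3 r4 r5]; rewrite ler_norml => /andP[t1 t2].
rewrite ip_cols /nsq !ipE !big_ord1 -big_split /= mulr_suml mulr_sumr -sumrB.
apply: ler_sum => j _; rewrite !mxE !big_ord1 !mxE /= /pot.
move: r^-1 r3 r4 r5 => ri r3 r4 r5.
have scal (E F a b : R) (u v z : C) : 2 / 10 <= E -> 2 / 10 <= F ->
    a ^+ 2 <= 2304 -> b ^+ 2 <= 2304 ->
    (ipc u u + ipc v v) / 10 - 12000 * ipc z z <=
    E * ipc u u + F * ipc v v + a * ipc u z - b * ipc v z.
  case: u v z => u1 u2 [v1 v2] [z1 z2]; rewrite /ipc /= => hE hF ha hb.
  have yo (c w z : R) : c ^+ 2 <= 2304 -> - (w ^+ 2 / 10 + 5760 * z ^+ 2) <= c * (w * z).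
    rewrite -subr_ge0 => hc; rewrite -subr_ge0.
    rewrite (_ : _ - _ = (w + 5 * (c * z)) ^+ 2 / 10 +
      (2304 - c ^+ 2) * z ^+ 2 * 5 / 2); last by field.
    apply: addr_ge0; first by rewrite divr_ge0 ?sqr_ge0.
    by rewrite divr_ge0 // mulr_ge0 // mulr_ge0 ?sqr_ge0.
  have := yo a u1 z1 ha; have := yo a u2 z2 ha.
  have bN : (- b) ^+ 2 <= 2304 by rewrite sqrrN.
  have := yo (- b) v1 z1 bN; have := yo (- b) v2 z2 bN.
  have := ler_wpM2r (ipcc_ge0 (u1 +i* u2)) hE.
  have := ler_wpM2r (ipcc_ge0 (v1 +i* v2)) hF.
  have := sqr_ge0 z1; have := sqr_ge0 z2.
  rewrite /ipc /= {hE hF ha hb bN yo}; lra.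
have := scal (26 * (r * gg j - t) + 15 * (ri + 2 * gg j))
   (15 * (ri + 2 * gg j) - 26 * (r * gg j - t))
   (- (r * gg j + - ri - 2 * gg j - t) - 3 * (r * gg j - t) + 4 * (r * gg j + ri + 2 * gg j - t))
   (4 * (r * gg j + - ri - 2 * gg j - t) - 3 * (r * gg j - t) - (r * gg j + ri + 2 * gg j - t))
   (x 0 j) (x' 0 j) (y 0 j).
case: (x 0 j) (x' 0 j) (y 0 j) => u1 u2 [v1 v2] [z1 z2].
move=> h; apply: (le_trans (h _ _ _ _)) => {h scal}.
- by elim/ord3P: j; rewrite !ggE; lra.
- by elim/ord3P: j; rewrite !ggE; lra.
- rewrite (_ : 2304 = 48 ^+ 2); last by ring.
  by elim/ord3P: j; rewrite !ggE; apply: ler_sqr_bound; lra.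
- rewrite (_ : 2304 = 48 ^+ 2); last by ring.
  by elim/ord3P: j; rewrite !ggE; apply: ler_sqr_bound; lra.
- by rewrite !ggE /ipc /= le_eqVlt; apply/orP; left; apply/eqP; ring.
Qed.

(** Coordinates are taken by left multiplication, so those of X J mu are z = x J mu, z' = x' J mu
    and w = y J mu. Self-adjointness of [J mu] then yields the two relations that free
    [isotropic_form] of the term linear in Im nu. *)
Lemma split_rows (nu mu : C) (X : 'M[C]_3) : unitc mu -> 1 / 2 <= Re mu ->
  exists y x x' w z z' : 'rV[C]_3,
  [/\ X = colr 1 1 1 *m y + p *m x + p' *m x',
      X *m J mu = colr 1 1 1 *m w + p *m z + p' *m z',
      ip x z' = ip x' z /\ ip x ('i *: z') = - ip x' ('i *: z),
      nsq x <= 1 / 25 * nsq X /\ nsq x' <= 1 / 25 * nsq X &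
   [/\ nsq z <= 1 / 25 * nsq (X *m J mu), nsq z' <= 1 / 25 * nsq (X *m J mu),
      Im mu ^+ 2 * nsq y <= nsq w &
      (1 + 2 * Re nu) ^+ 2 * nsq w <= 1 / 3 * nsq (J nu *m (X *m J mu))]].
Proof.
move=> umu cmu.
exists (rowr (1 / 3) (1 / 3) (1 / 3) *m X).
exists (rowr (- (2 / 45)) (- (5 / 45)) (7 / 45) *m X).
exists (rowr (7 / 45) (- (5 / 45)) (- (2 / 45)) *m X).
exists (rowr (1 / 3) (1 / 3) (1 / 3) *m (X *m J mu)).
exists (rowr (- (2 / 45)) (- (5 / 45)) (7 / 45) *m (X *m J mu)).
exists (rowr (7 / 45) (- (5 / 45)) (- (2 / 45)) *m (X *m J mu)).
have row_le (a b c : R) n (A : 'M[C]_(3, n)) : a ^+ 2 + b ^+ 2 + c ^+ 2 <= 1 / 25 ->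
    nsq (rowr a b c *m A) <= 1 / 25 * nsq A.
  by move=> h; apply: le_trans (nsq_rowr_mul _ _ _ _) _; rewrite ler_wpM2r ?nsq_ge0.
have sm : (- (2 / 45)) ^+ 2 + (- (5 / 45)) ^+ 2 + (7 / 45) ^+ 2 <= 1 / 25 :> R.
  by lra.
have sm' : (7 / 45) ^+ 2 + (- (5 / 45)) ^+ 2 + (- (2 / 45)) ^+ 2 <= 1 / 25 :> R.
  by lra.
split; [exact: decomposition|exact: decomposition| | |]; last split.
- rewrite !mulmxA; split; first by rewrite -ip_Jr ipC.
  by rewrite ip_i -ip_Jr -scalemxAl ipC.
- by split; apply: row_le.
- exact: row_le.
- exact: row_le.
- by rewrite mulmxA nsq_Jr_ge.
- rewrite -nsqR scalemxAl -rowr_const_J -!mulmxA.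
  apply: le_trans (nsq_rowr_mul _ _ _ _) _.
  by rewrite ler_wpM2r ?nsq_ge0 //; lra.
Qed.

(** In the application [s] is the square of Im nu, [c] is 1 - Re nu, and [nv] is the squared norm of
    z, which may be as large as a multiple of (lam / Im nu)^2. Since c is quadratic in Im nu, c |x|
    |z| is still of order e lam; the weight lam / e in Young's inequality balances the two
    factors. *)
Lemma perturbation_le (e lam s c a nu nv N : R) :
  0 < e -> 0 < lam -> 0 <= nu -> 0 <= a -> 0 <= c <= s -> s <= e ^+ 2 ->
  a *+ 2 <= lam / e * nu + (lam / e)^-1 * nv ->
  nu <= 1 / 25 * N -> s * nv <= 2 * lam ^+ 2 * N ->
  c * a <= lam * (2 * (e * N)).
Proof.
move=> e0 l0 nu0 a0 /andP[c0 cs] se h hu hv.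
have le0 : 0 < lam / e by rewrite divr_gt0.
have el0 : 0 < e / lam by rewrite divr_gt0.
have h2 : s * (lam / e * nu) <= e * lam * N.
  apply: (@le_trans _ _ (e ^+ 2 * (lam / e * nu))).
    by rewrite ler_wpM2r // mulr_ge0 // ltW.
  rewrite (_ : _ * _ = e * lam * nu); last by field; rewrite gt_eqF.
  by rewrite ler_pM2l ?mulr_gt0 //; lra.
have h3 : s * (e / lam * nv) <= 2 * (e * lam * N).
  rewrite (_ : _ * _ = e / lam * (s * nv)); last by ring.
  apply: (@le_trans _ _ (e / lam * (2 * lam ^+ 2 * N))); first by rewrite ler_pM2l.
  by rewrite le_eqVlt; apply/orP; left; apply/eqP; field; rewrite gt_eqF.
have h4 : s * (a *+ 2) <= s * (lam / e * nu + e / lam * nv).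
  by rewrite ler_wpM2l ?(le_trans c0) // -[e / lam]invf_div.
have h5 : c * a <= s * a by rewrite ler_wpM2r.
have N0 : 0 <= N by lra.
have := mulr_ge0 (mulr_ge0 (ltW e0) (ltW l0)) N0.
rewrite (_ : lam * (2 * (e * N)) = 2 * (e * lam * N)); last by ring.
rewrite mulr2n !mulrDr in h4.
move: h2 h3 h4 h5; clear.
move: (s * (lam / e * nu)) (s * (e / lam * nv)) (s * a) (c * a) (e * lam * N) => *.
lra.
Qed.

(** The constants record squared norms: 9 and 78 are three times those of (1, 1, 1) and p, and 104
    is 26 times two pairings of size 2. For e and 1 / k this small, the upper bound on q contradicts
    its lower bound unless N = 0. *)
Lemma region2_arith (lam e k nx ny N q : R) :
  0 < lam -> 2000 * (104 * e) <= 1 -> 100 <= k ->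
  0 <= nx -> 0 <= ny -> 0 <= N ->
  lam * q <= lam * (104 * (e * N)) -> nx / 10 - 12000 * ny <= q ->
  N <= 9 * ny + 78 * nx -> k ^+ 2 * (k ^+ 2 * ny) <= 5 * N -> N <= 0.
Proof.
move=> l0 e1 k1 nx0 ny0 N0; rewrite ler_pM2l // => h1 h2 h3 h4.
have eN : 2000 * (104 * (e * N)) <= N.
  by rewrite !mulrA -[leRHS]mul1r ler_wpM2r // -!mulrA.
have kk : 100 * 100 <= k ^+ 2 by rewrite expr2 ler_pM.
have w1 : 100 * (100 * ny) <= k ^+ 2 * ny by rewrite mulrA ler_wpM2r.
have w2 : 100 * (100 * (k ^+ 2 * ny)) <= k ^+ 2 * (k ^+ 2 * ny).
  by rewrite mulrA ler_wpM2r // mulr_ge0 ?sqr_ge0.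
move: eN w1 w2 h1 h2 h3 h4 nx0 ny0 N0; clear.
move: (e * N) (k ^+ 2 * (k ^+ 2 * ny)) (k ^+ 2 * ny) => a b c *.
lra.
Qed.

(** The equation is paired with p x - p' x' instead of X. The sign makes the potential term definite
    and cancels the term linear in Im nu, so that the unperturbed part contributes only O(e lam).
    The component y along (1, 1, 1) is small because neither factor degenerates on it: [J nu]
    multiplies it by 1 + 2 Re nu >= 2 and [J mu] is bounded below by |Im mu|. *)
Lemma region2 (r lam t e k : R) (nu mu : C) (X : 'M[C]_3) :
  r_bounds r -> `|t| <= 1 / 10 -> 0 < lam ->
  unitc nu -> 1 / 2 <= Re nu -> unitc mu -> 1 / 2 <= Re mu ->
  0 < e -> 2000 * (104 * e) <= 1 -> Im nu ^+ 2 <= e ^+ 2 ->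
  100 <= k -> (k ^+ 2) ^+ 2 * lam ^+ 2 <= Im mu ^+ 2 ->
  J nu *m X *m J mu + lam%:C *: had (fun i j => pot r i j - t) X = 0 -> X = 0.
Proof.
move=> rb t1 lam0 unu cnu umu cmu e0 e1 nue k1 muk.
set H := had _ X => eq0; apply/eqP; rewrite -nsq_eq0 eq_le nsq_ge0 andbT.
have HN : nsq H <= 49 * nsq X.
  apply: nsq_had => i j; apply: pot_le6 => //.
  by move: t1; clear => ?; lra.
have eqZ : J nu *m (X *m J mu) = - (lam%:C *: H).
  by apply/eqP; rewrite -subr_eq0 opprK mulmxA eq0.
have nsqJZ : nsq (J nu *m (X *m J mu)) <= lam ^+ 2 * (49 * nsq X).
  by rewrite eqZ -scaleN1r -[-1](rmorphN1 (real_complex R)) !nsqR sqrrN expr1n mul1r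
    ler_wpM2l ?sqr_ge0.
have nsqZ_le := le_trans (nsq_J_ge (X *m J mu) unu cnu) nsqJZ.
have [y [x [x' [w [z [z' [Xe Ze [s1 s2] [nx nx'] [nz nz' hy hw]]]]]]]] :=
  split_rows nu X umu cmu.
have c_le : 0 <= 1 - Re nu <= Im nu ^+ 2.
  move: unu => /eqP; rewrite /ipc -!expr2; move: cnu; clear.
  by move: (Re nu) (Im nu) => c s ? ?; apply/andP; split; nra.
have le0 : 0 < lam / e by rewrite divr_gt0.
have zs (v : 'rV[C]_3) : nsq v <= 1 / 25 * nsq (X *m J mu) ->
    Im nu ^+ 2 * nsq v <= 2 * lam ^+ 2 * nsq X.
  move=> h; have h' := ler_wpM2l (sqr_ge0 (Im nu)) h.
  rewrite (_ : 2 * lam ^+ 2 * nsq X = 2 * (lam ^+ 2 * nsq X)); last by ring.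
  rewrite [leRHS](_ : _ = 1 / 25 * (Im nu ^+ 2 * nsq (X *m J mu))) in h'; last by ring.
  rewrite [leRHS](_ : _ = 49 * (lam ^+ 2 * nsq X)) in nsqZ_le; last by ring.
  move: (mulr_ge0 (sqr_ge0 lam) (nsq_ge0 X)) h' nsqZ_le; clear.
  move: (lam ^+ 2 * nsq X) (Im nu ^+ 2 * nsq v) (Im nu ^+ 2 * nsq (X *m J mu)) => *.
  lra.
have dx := perturbation_le e0 lam0 (nsq_ge0 _) (normr_ge0 _) c_le nue
  (ip_young x z le0) nx (zs _ nz).
have dx' := perturbation_le e0 lam0 (nsq_ge0 _) (normr_ge0 _) c_le nue
  (ip_young x' z' le0) nx' (zs _ nz').
have test : 26 * (1 - Re nu) * (ip x z - ip x' z') + lam * ip (p *m x - p' *m x') H = 0.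
  by rewrite -(isotropic_form nu w s1 s2) -Ze -ipRr -ipDr eqZ addNr ip0r.
have N_le : nsq X <= 9 * nsq y + 78 * (nsq x + nsq x').
  rewrite Xe; apply: le_trans (nsqD3 _ _ _) _; rewrite !nsq_colr_mul; clear.
  move: (nsq y) (nsq x) (nsq x') => a b c.
  by rewrite le_eqVlt; apply/orP; left; apply/eqP; ring.
have pos : (nsq x + nsq x') / 10 - 12000 * nsq y <= ip (p *m x - p' *m x') H.
  by rewrite /H Xe; apply: potential_form.
have c0 : 0 <= 1 - Re nu by case/andP: c_le.
have hu : - ((1 - Re nu) * `|ip x z|) <= (1 - Re nu) * ip x z.
  by rewrite -mulrN ler_wpM2l // lerNl ler_normr lexx orbT.
have hv : (1 - Re nu) * ip x' z' <= (1 - Re nu) * `|ip x' z'|.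
  by rewrite ler_wpM2l // ler_norm.
apply: (region2_arith (e := e) lam0 e1 k1 _ (nsq_ge0 y) (nsq_ge0 X) _ pos N_le).
- by rewrite addr_ge0 ?nsq_ge0.
- move: test hu hv dx dx'.
  rewrite (_ : lam * (2 * (e * nsq X)) = 2 * (lam * (e * nsq X))); last by ring.
  rewrite (_ : lam * (104 * (e * nsq X)) = 104 * (lam * (e * nsq X))); last by ring.
  rewrite (_ : 26 * (1 - Re nu) * (ip x z - ip x' z') =
    26 * ((1 - Re nu) * ip x z - (1 - Re nu) * ip x' z')); last by ring.
  move: (lam * (e * nsq X)) (lam * ip _ H) ((1 - Re nu) * `|ip x z|) => a b c.
  move: ((1 - Re nu) * `|ip x' z'|) ((1 - Re nu) * ip x z) => d f.
  by move: ((1 - Re nu) * ip x' z'); clear => *; lra.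
- move: hw hy nsqJZ muk; clear -lam0 cnu => hw hy hJ muk.
  rewrite -(ler_pM2l (x := lam ^+ 2)) ?exprn_gt0 //.
  have h3 : (k ^+ 2) ^+ 2 * lam ^+ 2 * nsq y <= nsq w.
    by apply: le_trans hy; rewrite ler_wpM2r ?nsq_ge0.
  have h4 : 4 * nsq w <= (1 + 2 * Re nu) ^+ 2 * nsq w.
    rewrite ler_wpM2r ?nsq_ge0 //; move: cnu; clear; move: (Re nu) => c ?; nra.
  move: (mulr_ge0 (sqr_ge0 lam) (nsq_ge0 X)) hw hJ h3 h4.
  rewrite [_ * _ * nsq y](_ : _ = lam ^+ 2 * (k ^+ 2 * (k ^+ 2 * nsq y))); last by ring.
  rewrite !(mulrCA (lam ^+ 2) _ (nsq X)).
  move: (lam ^+ 2 * (k ^+ 2 * (k ^+ 2 * nsq y))) (lam ^+ 2 * nsq X).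
  move: ((1 + 2 * Re nu) ^+ 2 * nsq w) (nsq w) (nsq (J nu *m (X *m J mu))).
  by clear => *; lra.
Qed.

End Region2.

(** * The reduced linear system for [mu] within O(lam) of 1 *)

Definition det3 (F : comPzRingType) (b : 'I_3 -> 'I_3 -> F) : F :=
  b 0 0 * (b 1 1 * b 2 2 - b 1 2 * b 2 1) - b 0 1 * (b 1 0 * b 2 2 - b 1 2 * b 2 0)
  + b 0 2 * (b 1 0 * b 2 1 - b 1 1 * b 2 0).

(* Expansion of the determinant of diag(d) - t J diag(e)^-1 J, where J is the
   twisted circulant with twist n = m^-1; its principal 2x2 minors vanish. *)
Lemma schur_det (F : fieldType) (n m t e0 e1 e2 d0 d1 d2 : F)
    (j : 'I_3 -> 'I_3 -> F) (b : 'I_3 -> 'I_3 -> F) :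
  n * m = 1 -> e0 != 0 -> e1 != 0 -> e2 != 0 ->
  (forall i, j i i = 1) -> (forall i, j i (i + 1) = n) -> (forall i, j i (i - 1) = m) ->
  (forall i k, b i k = (if i == k then if i == 0 then d0 else if i == 1 then d1 else d2
                        else 0) -
    t * (j i 0 * j 0 k / e0 + j i 1 * j 1 k / e1 + j i 2 * j 2 k / e2)) ->
  det3 b = (e0 * e1 * e2 * (d0 * d1 * d2)
    - t * (e0 * e1 + e0 * e2 + e1 * e2) * (d0 * d1 + d0 * d2 + d1 * d2)
    + (2 - n ^+ 3 - m ^+ 3) * t ^+ 2 *
        (e0 * (d1 + d2) + e1 * (d0 + d2) + e2 * (d0 + d1))
    - (2 - n ^+ 3 - m ^+ 3) ^+ 2 * t ^+ 3) / (e0 * e1 * e2).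
Proof.
move=> nm e0N e1N e2N jd jn jm bE.
have nN : n != 0 by apply: contra_eqN nm => /eqP ->; rewrite mul0r eq_sym oner_eq0.
have -> : m = n^-1 by rewrite -[n^-1]mulr1 -nm mulKf.
have [[e01 e12 e20] [d02 d10 d21]] := ord3_add 0.
have j01 := jn 0; have j12 := jn 1; have j20 := jn 2.
have j02 := jm 0; have j10 := jm 1; have j21 := jm 2.
rewrite e01 in j01; rewrite e12 in j12; rewrite e20 in j20.
rewrite d02 in j02; rewrite d10 in j10; rewrite d21 in j21.
have mE : m = n^-1 by rewrite -[n^-1]mulr1 -nm mulKf.
rewrite /det3 !bE /= !jd j01 j12 j20 j02 j10 j21 mE.
by field; rewrite nN e0N e1N e2N.
Qed.

Section Cramer.
Context {R : realType}.
Local Notation C := R[i].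
Implicit Types (b : 'I_3 -> 'I_3 -> C) (x y : 'I_3 -> C).

Lemma nrm_ge0 (z : C) : 0 <= nrm z.
Proof. by case: z => a b; apply: sqrtr_ge0. Qed.

Lemma nrmM (z w : C) : nrm (z * w) = nrm z * nrm w.
Proof. exact: ComplexField.Normc.normcM. Qed.

Lemma nrmD (z w : C) : nrm (z + w) <= nrm z + nrm w.
Proof. exact: le_normcD. Qed.

Lemma nrmN (z : C) : nrm (- z) = nrm z.
Proof. exact: normcN. Qed.

Lemma nrmB (z w : C) : nrm (z - w) <= nrm z + nrm w.
Proof. by rewrite -(nrmN w) nrmD. Qed.

Lemma nrmR (a : R) : nrm a%:C = `|a|.
Proof. by rewrite /= expr0n addr0 sqrtr_sqr. Qed.

Lemma nrm_unit (z : C) : unitc z -> nrm z = 1.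
Proof.
move=> /eqP; rewrite -normc_sqr => /eqP; rewrite sqrf_eq1 => /orP[/eqP //|/eqP h].
by have := nrm_ge0 z; rewrite h lerNr oppr0 ler10.
Qed.

Lemma cramer b x y : (forall i, b i 0 * x 0 + b i 1 * x 1 + b i 2 * x 2 = y i) ->
  [/\ det3 b * x 0 = (b 1 1 * b 2 2 - b 1 2 * b 2 1) * y 0 +
        (b 0 2 * b 2 1 - b 0 1 * b 2 2) * y 1 + (b 0 1 * b 1 2 - b 0 2 * b 1 1) * y 2,
      det3 b * x 1 = (b 1 2 * b 2 0 - b 1 0 * b 2 2) * y 0 +
        (b 0 0 * b 2 2 - b 0 2 * b 2 0) * y 1 + (b 0 2 * b 1 0 - b 0 0 * b 1 2) * y 2 &
      det3 b * x 2 = (b 1 0 * b 2 1 - b 1 1 * b 2 0) * y 0 +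
        (b 0 1 * b 2 0 - b 0 0 * b 2 1) * y 1 + (b 0 0 * b 1 1 - b 0 1 * b 1 0) * y 2].
Proof. by move=> yE; rewrite -!yE /det3; split; ring. Qed.

Lemma cramer_bound (beta delta : R) b x y :
  (forall i k, nrm (b i k) <= beta) -> 0 < delta -> delta <= nrm (det3 b) ->
  (forall i, b i 0 * x 0 + b i 1 * x 1 + b i 2 * x 2 = y i) ->
  forall i, delta * nrm (x i) <= 2 * beta ^+ 2 * (nrm (y 0) + nrm (y 1) + nrm (y 2)).
Proof.
move=> hb d0 hd /cramer[h0 h1 h2] i.
have cof (p q r s z : C) : nrm p <= beta -> nrm q <= beta -> nrm r <= beta ->
    nrm s <= beta -> nrm ((p * q - r * s) * z) <= 2 * beta ^+ 2 * nrm z.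
  move=> hp hq hr hs; rewrite nrmM ler_wpM2r ?nrm_ge0 //.
  apply: le_trans (nrmB _ _) _; rewrite !nrmM mulr_natl mulr2n expr2.
  by rewrite lerD // ler_pM ?nrm_ge0.
have sum3_le (p q r : C) (u v w : R) : nrm p <= u -> nrm q <= v -> nrm r <= w ->
    nrm (p + q + r) <= u + v + w.
  move=> hp hq hr; apply: le_trans (nrmD _ _) _; rewrite lerD //.
  by apply: le_trans (nrmD _ _) _; rewrite lerD.
apply: (@le_trans _ _ (nrm (det3 b * x i))).
  by rewrite nrmM ler_wpM2r ?nrm_ge0.
by elim/ord3P: i; rewrite ?(h0, h1, h2) !mulrDr; apply: sum3_le; apply: cof.
Qed.

Lemma nsq_col (x : 'cV[C]_3) :
  nsq x = nrm (x 0 0) ^+ 2 + nrm (x 1 0) ^+ 2 + nrm (x 2 0) ^+ 2.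
Proof. by rewrite /nsq ipE sum3 !big_ord1 !normc_sqr. Qed.

Lemma nsq_J_le (nu : C) n (A : 'M[C]_(3, n)) :
  unitc nu -> nsq (J nu *m A) <= 9 * nsq A.
Proof.
move=> u; have u' : unitc nu^*.
  by move: u; rewrite /unitc; case: nu => a b; rewrite /ipc /= mulrNN.
rewrite /nsq !ip_cols mulr_sumr; apply: ler_sum => j _.
have tri (a b c : C) : ipc (a + nu * b + nu^* * c) (a + nu * b + nu^* * c) <=
    3 * (ipc a a + ipc b b + ipc c c).
  have -> : ipc b b = ipc (nu * b) (nu * b) by rewrite ipcM (eqP u) mul1r.
  have -> : ipc c c = ipc (nu^* * c) (nu^* * c) by rewrite ipcM (eqP u') mul1r.
  move: (nu * b) (nu^* * c) => {}b {}c.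
  case: a b c => a1 a2 [b1 b2] [c1 c2]; rewrite /ipc /= -subr_ge0.
  rewrite (_ : _ - _ = (a1 - b1) ^+ 2 + (a1 - c1) ^+ 2 + (b1 - c1) ^+ 2 +
    ((a2 - b2) ^+ 2 + (a2 - c2) ^+ 2 + (b2 - c2) ^+ 2)); last by ring.
  by rewrite !addr_ge0 ?sqr_ge0.
rewrite !J_mulE; have [[-> -> ->] [-> -> ->]] := ord3_add 0.
have := tri (A 0 j) (A 1 j) (A 2 j); have := tri (A 1 j) (A 2 j) (A 0 j).
have := tri (A 2 j) (A 0 j) (A 1 j).
move: (ipc (A 0 j) _) (ipc (A 1 j) _) (ipc (A 2 j) _) => a b c.
by move: (ipc _ _) (ipc _ _) (ipc _ _); clear => *; lra.
Qed.

End Cramer.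

Section Core.
Context {R : realType}.
Local Notation C := R[i].

(** [e] and [d] are meant to be the potential compressed to two orthogonal sum-zero vectors. What
    matters is the sign pattern (-, +, +) against (-, -, +), with a margin; [d 0 + d 2 <= 0] serves
    the coefficient of the term quadratic in t in [core_det]. *)
Definition core_bounds (e d : 'I_3 -> R) :=
  [/\ - 5 <= e 0 <= - 1, 1 / 20 <= e 1 <= 1, 1 <= e 2 <= 6 &
   [/\ - 5 <= d 0 <= - 1, - 1 <= d 1 <= - (1 / 20), 1 <= d 2 <= 6 & d 0 + d 2 <= 0]].

(** All four terms are nonpositive for every t >= 0, so no resonance occurs whatever the ratio of
    momentum to lam. The first term, free of t, alone gives the bound -(1/20)^2. *)
Lemma core_det (e d : 'I_3 -> R) (t X : R) : core_bounds e d -> 0 <= t -> 0 <= X ->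
  e 0 * e 1 * e 2 * (d 0 * d 1 * d 2)
    - t * (e 0 * e 1 + e 0 * e 2 + e 1 * e 2) * (d 0 * d 1 + d 0 * d 2 + d 1 * d 2)
    + X * t ^+ 2 * (e 0 * (d 1 + d 2) + e 1 * (d 0 + d 2) + e 2 * (d 0 + d 1))
    - X ^+ 2 * t ^+ 3 <= - (1 / 400).
Proof.
move=> [/andP[e0l e0u] /andP[e1l e1u] /andP[e2l e2u]].
move=> [/andP[d0l d0u] /andP[d1l d1u] /andP[d2l d2u] d02] t0 X0.
move: (e 0) (e 1) (e 2) (d 0) (d 1) (d 2) e0l e0u e1l e1u e2l e2u d0l d0u d1l d1u
  d2l d2u d02 => {e d} e0 e1 e2 d0 d1 d2 e0l e0u e1l e1u e2l e2u d0l d0u d1l d1u d2l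
  d2u d02.
have h1 : e0 * e1 * e2 * (d0 * d1 * d2) <= - (1 / 400).
  have a : 1 <= e0 * d0 by rewrite -mulrNN; rewrite -[leLHS]mulr1 ler_pM //; lra.
  have b : 1 / 400 <= e1 * (- d1).
    by rewrite (_ : 1 / 400 = 1 / 20 * (1 / 20)) ?ler_pM //; lra.
  have c : 1 <= e2 * d2 by rewrite -[leLHS]mulr1 ler_pM //; lra.
  have ab : 1 * (1 / 400) <= e0 * d0 * (e1 * (- d1)) by rewrite ler_pM //; lra.
  have abc : 1 * (1 / 400) * 1 <= e0 * d0 * (e1 * (- d1)) * (e2 * d2).
    by rewrite ler_pM //; lra.
  by move: abc; clear; lra.
have h2 : e0 * e1 + e0 * e2 + e1 * e2 <= 0 by nra.
have h3 : d0 * d1 + d0 * d2 + d1 * d2 <= 0 by nra.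
have h4 : e0 * (d1 + d2) + e1 * (d0 + d2) + e2 * (d0 + d1) <= 0 by nra.
have h5 : 0 <= t * (e0 * e1 + e0 * e2 + e1 * e2) * (d0 * d1 + d0 * d2 + d1 * d2).
  by rewrite -mulrA mulr_ge0 // -mulrNN mulr_ge0 ?oppr_ge0.
have h6 : X * t ^+ 2 * (e0 * (d1 + d2) + e1 * (d0 + d2) + e2 * (d0 + d1)) <= 0.
  by rewrite mulr_ge0_le0 // mulr_ge0 // sqr_ge0.
have h7 : 0 <= X ^+ 2 * t ^+ 3 by rewrite mulr_ge0 ?exprn_ge0.
have comb (a b c d : R) : a <= - (1 / 400) -> 0 <= b -> c <= 0 -> 0 <= d ->
    a - b + c - d <= - (1 / 400) by clear => *; lra.
exact: comb h1 h5 h6 h7.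
Qed.

(** The Schur complement left after eliminating the unknowns multiplied by [e]; t stands for
    tau^2. *)
Definition schur (nu : C) (e d : 'I_3 -> R) (t : R) (i k : 'I_3) : C :=
  (if i == k then if i == 0 then (d 0)%:C else if i == 1 then (d 1)%:C else (d 2)%:C
   else 0) -
  t%:C * (J nu i 0 * J nu 0 k / (e 0)%:C + J nu i 1 * J nu 1 k / (e 1)%:C +
          J nu i 2 * J nu 2 k / (e 2)%:C).

Lemma nrm_J (nu : C) i k : unitc nu -> nrm (J nu i k) = 1.
Proof.
move=> u; rewrite mxE; case: ifP => _; first by rewrite nrmR normr1.
case: ifP => _; first exact: nrm_unit.
by apply: nrm_unit; move: u; rewrite /unitc; case: nu => a b; rewrite /ipc /= mulrNN.
Qed.

Lemma nrm_inv_le (a : R) : 1 / 20 <= `|a| -> nrm (a%:C)^-1 <= 20.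
Proof.
move=> h; have a0 : 0 < `|a| by lra.
rewrite ComplexField.Normc.normcV nrmR -[leRHS]invrK lef_pV2 ?posrE ?invr_gt0 //.
by rewrite -div1r.
Qed.

Lemma core_e_ge e d i : core_bounds e d -> 1 / 20 <= `|e i|.
Proof.
move=> [/andP[e0l e0u] /andP[e1l e1u] /andP[e2l e2u] _].
by elim/ord3P: i; rewrite ler_normr; apply/orP;
  [right; lra|left; lra|left; lra].
Qed.

Lemma core_e_neq0 e d i : core_bounds e d -> (e i)%:C != 0 :> C.
Proof.
move=> eb; apply/eqP => /(congr1 (@complex.Re R)) /= ei0.
by have := core_e_ge i eb; rewrite ei0 normr0; clear; lra.
Qed.

Lemma schur_le nu e d t i k : unitc nu -> core_bounds e d -> 0 <= t ->
  nrm (schur nu e d t i k) <= 6 + 60 * t.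
Proof.
move=> u eb t0; apply: le_trans (nrmB _ _) _; apply: lerD.
  have db j : `|d j| <= 6.
    case: eb => _ _ _ [/andP[d0l d0u] /andP[d1l d1u] /andP[d2l d2u] _].
    by rewrite ler_norml; elim/ord3P: j; apply/andP; split; lra.
  case: ifP => _; last by rewrite nrmR normr0.
  by case: ifP => _; last case: ifP => _; rewrite nrmR.
rewrite nrmM nrmR ger0_norm // mulrC ler_wpM2r //.
have h j : nrm (J nu i j * J nu j k / (e j)%:C) <= 20.
  rewrite !nrmM !nrm_J // !mul1r; apply: nrm_inv_le; exact: core_e_ge eb.
apply: le_trans (nrmD _ _) _; rewrite (_ : 60 = 20 + 20 + 20) ?lerD //; last by ring.
by apply: le_trans (nrmD _ _) _; rewrite lerD.
Qed.

(** Here X = 2 - 2 Re (nu^3) is - det (J nu), and 30 = 5 * 1 * 6 bounds |e 0 e 1 e 2|, the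
    denominator of the expansion. *)
Lemma schur_det_ge nu e d t : unitc nu -> core_bounds e d -> 0 <= t ->
  1 / 400 <= 30 * nrm (det3 (schur nu e d t)).
Proof.
move=> u eb t0; pose X : R := 2 - 2 * Re (nu ^+ 3).
have u3 : unitc (nu ^+ 3) by rewrite /unitc 2!exprS expr1 !ipcM (eqP u) !mulr1.
have X0 : 0 <= X.
  move/eqP: u3; rewrite /X /ipc; move: (Re _) (Im _) => a b ?; nra.
have eN i := core_e_neq0 i eb.
have nm : nu * nu^* = 1.
  move: (eqP u); case: nu {u u3 X X0} => a b; rewrite /ipc /= => h.
  by apply/eqP; rewrite eq_complex /=; apply/andP; split; apply/eqP; rewrite -?h; ring.
have Xe : 2 - nu ^+ 3 - (nu^*) ^+ 3 = X%:C.
  rewrite -rmorphXn /= /X; case: (nu ^+ 3) => a b; apply/eqP.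
  by rewrite eq_complex /=; apply/andP; split; apply/eqP; ring.
have [[e01 e12 e20] [d02 d10 d21]] := ord3_add 0.
rewrite (@schur_det _ nu nu^* t%:C (e 0)%:C (e 1)%:C (e 2)%:C (d 0)%:C (d 1)%:C (d 2)%:C
  (J nu)) //; first last.
- by elim/ord3P; rewrite ?(d02, d10, d21) mxE.
- by elim/ord3P; rewrite ?(e01, e12, e20) mxE.
- by elim/ord3P; rewrite mxE.
rewrite Xe -!rmorphXn -!(rmorphD, rmorphB, rmorphN, rmorphM).
have := core_det eb t0 X0; set v := (X in X <= _) => hv.
rewrite nrmM ComplexField.Normc.normcV !nrmR.
have w0 : 0 < `|e 0 * e 1 * e 2|.
  have en i : e i != 0 by apply: contraNneq (eN i) => ->.
  by rewrite normr_gt0 !mulf_neq0.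
have w30 : `|e 0 * e 1 * e 2| <= 30.
  have [/andP[a1 a2] /andP[b1 b2] /andP[c1 c2] _] := eb.
  rewrite !normrM (_ : 30 = 5 * 1 * 6); last by ring.
  have p0 : `|e 0| <= 5 by rewrite ler_norml; apply/andP; split; lra.
  have p1 : `|e 1| <= 1 by rewrite ler_norml; apply/andP; split; lra.
  have p2 : `|e 2| <= 6 by rewrite ler_norml; apply/andP; split; lra.
  by rewrite !ler_pM ?mulr_ge0.
rewrite mulrA ler_pdivlMr //.
have v1 : 1 / 400 <= `|v| by rewrite lerNr in hv; rewrite ler_normr hv orbT.
by move: w0 w30 v1; move: `|v| `|_ * _| => p q; clear; lra.
Qed.

Lemma nsq_scale_inv (w : 'I_3 -> R) (x y : 'cV[C]_3) : (forall i, 1 / 20 <= `|w i|) ->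
  (forall i, (w i)%:C * x i 0 = y i 0) -> nsq x <= 400 * nsq y.
Proof.
move=> hw h; rewrite /nsq !ip_cols !big_ord1.
have sc i : ipc (x i 0) (x i 0) <= 400 * ipc (y i 0) (y i 0).
  rewrite -h ipcM {2}/ipc /= mulr0 addr0 mulrA -[leLHS]mul1r ler_wpM2r ?ipcc_ge0 //.
  have := hw i; rewrite -expr2 -real_normK ?num_real // => ?.
  have : 1 * 1 <= (20 * `|w i|) * (20 * `|w i|) by rewrite ler_pM //; lra.
  by move: `|w i|; clear => a ?; lra.
by rewrite 2!mulrDr; apply: lerD; [apply: lerD|]; exact: sc.
Qed.

Lemma had_entry (w : 'I_3 -> R) (A B D : 'cV[C]_3) (z : C) i :
  had (fun i _ => w i) A + z *: B = D -> D i 0 = (w i)%:C * A i 0 + z * B i 0.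
Proof. by move=> <-; rewrite !mxE. Qed.

Lemma mul3E (A : 'M[C]_3) (x : 'cV[C]_3) i :
  (A *m x) i 0 = A i 0 * x 0 0 + A i 1 * x 1 0 + A i 2 * x 2 0.
Proof. by rewrite mxE sum3. Qed.

Lemma schur_system nu e d tau (x y u v xe : 'cV[C]_3) (z : C) :
  (forall i, (e i)%:C != 0 :> C) -> z * z = - (tau ^+ 2)%:C ->
  had (fun i _ => e i) x + (- z) *: (J nu *m y) = u ->
  had (fun i _ => d i) y + z *: (J nu *m x) = v ->
  had (fun i _ => e i) xe = u ->
  forall i, schur nu e d (tau ^+ 2) i 0 * y 0 0 + schur nu e d (tau ^+ 2) i 1 * y 1 0 +
    schur nu e d (tau ^+ 2) i 2 * y 2 0 = (v - z *: (J nu *m xe)) i 0.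
Proof.
move=> eN zz hu hv hxe i.
have xE j : x j 0 = xe j 0 + z * (J nu *m y) j 0 / (e j)%:C.
  have := had_entry j hu; rewrite -hxe mxE => h.
  by apply: (mulfI (eN j)); rewrite mulrDr h mulNr mulrCA divff // mulr1 subrK.
have Jx : (J nu *m x) i 0 = (J nu *m xe) i 0 + z *
   (J nu i 0 * (J nu *m y) 0 0 / (e 0)%:C + J nu i 1 * (J nu *m y) 1 0 / (e 1)%:C +
    J nu i 2 * (J nu *m y) 2 0 / (e 2)%:C).
  by rewrite mul3E [(J nu *m xe) i 0]mul3E !xE; ring.
have -> : (v - z *: (J nu *m xe)) i 0 = (d i)%:C * y i 0 + z * z *
   (J nu i 0 * (J nu *m y) 0 0 / (e 0)%:C + J nu i 1 * (J nu *m y) 1 0 / (e 1)%:C +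
    J nu i 2 * (J nu *m y) 2 0 / (e 2)%:C).
  transitivity (v i 0 - z * (J nu *m xe) i 0); last first.
    by rewrite (had_entry i hv) Jx; ring.
  by move: (J nu *m xe) => A; rewrite !mxE.
rewrite zz !mul3E /schur; move: (J nu) (tau ^+ 2)%:C ((e 0)%:C)^-1 ((e 1)%:C)^-1.
move=> j t a b; move: ((e 2)%:C)^-1 => c.
by clear Jx; elim/ord3P: i => /=; ring.
Qed.

(* The 6x6 system left over when the second quasi-momentum is O(lam). *)
Lemma core_solve (T : R) : 0 <= T -> exists2 K : R, 0 < K &
  forall (nu : C) (e d : 'I_3 -> R) (tau : R) (x y u v : 'cV[C]_3),
  unitc nu -> core_bounds e d -> tau ^+ 2 <= T ->
  had (fun i _ => e i) x - ('i * tau%:C) *: (J nu *m y) = u ->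
  had (fun i _ => d i) y + ('i * tau%:C) *: (J nu *m x) = v ->
  nsq x + nsq y <= K * (nsq u + nsq v).
Proof.
(* [beta] bounds the entries of the Schur complement, [delta] its determinant from below and [L] the
   right-hand side of the reduced system; Cramer's rule then yields [M]. *)
move=> T0; pose beta := 6 + 60 * T; pose delta : R := 1 / 400 / 30.
pose M := (2 * beta ^+ 2 / delta) ^+ 2 * 9; pose L := 2 * (1 + 3600 * T).
have d0 : 0 < delta by rewrite /delta !divr_gt0.
have M0 : 0 <= M by rewrite mulr_ge0 ?sqr_ge0.
have L0 : 0 <= L by do ?[apply: mulr_ge0 => //|apply: addr_ge0 => //].
exists (800 + (7200 * T + 1) * (M * L)).
  apply: ltr_wpDr => //; apply: mulr_ge0; last exact: mulr_ge0.
  by apply: addr_ge0 => //; apply: mulr_ge0.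
move=> nu e d tau x y u v unu eb tT.
have eN i := core_e_neq0 i eb; have eG i := core_e_ge i eb.
have zz : ('i * tau%:C) * ('i * tau%:C) = - (tau ^+ 2)%:C :> C.
  by apply/eqP; rewrite eq_complex /=; apply/andP; split; apply/eqP; ring.
have z2 : ipc ('i * tau%:C) ('i * tau%:C) = tau ^+ 2 by rewrite /ipc /=; ring.
rewrite -scaleNr; move: ('i * tau%:C) zz z2 => z zz z2 hu hv.
pose xe : 'cV[C]_3 := \matrix_(i, j) (((e i)%:C)^-1 * u i j).
have hxe : had (fun i _ => e i) xe = u.
  by apply/matrixP => i j; rewrite !mxE mulVKf.
have hxe_le : nsq xe <= 400 * nsq u.
  by apply: (nsq_scale_inv eG) => i; rewrite -[in RHS]hxe [in RHS]mxE.
have sys := schur_system eN zz hu hv hxe.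
have hw : nsq (v - z *: (J nu *m xe)) <= L * (nsq u + nsq v).
  apply: le_trans (nsqD_le _ _) _; rewrite -scaleNr nsqZ.
  have -> : ipc (- z) (- z) = tau ^+ 2 by rewrite -z2 /ipc; case: (z) => a b /=; ring.
  have h1 : tau ^+ 2 * nsq (J nu *m xe) <= T * (9 * (400 * nsq u)).
    rewrite ler_pM ?sqr_ge0 ?nsq_ge0 //; apply: le_trans (nsq_J_le _ unu) _.
    by rewrite ler_pM2l.
  have := mulr_ge0 T0 (nsq_ge0 v); have := nsq_ge0 u; move: h1; rewrite /L !mulr2n.
  rewrite (_ : T * (9 * (400 * nsq u)) = 3600 * (T * nsq u)); last by ring.
  rewrite (_ : 2 * (1 + 3600 * T) * (nsq u + nsq v) = 2 * (nsq u + nsq v) +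
    7200 * (T * nsq u + T * nsq v)); last by ring.
  move: (T * nsq u) (T * nsq v) (nsq u) (nsq v) (_ * nsq (J nu *m xe)).
  by clear => *; lra.
have hy : nsq y <= M * nsq (v - z *: (J nu *m xe)).
  have t0 := sqr_ge0 tau.
  have dd : delta <= nrm (det3 (schur nu e d (tau ^+ 2))).
    by rewrite /delta ler_pdivrMr // [leRHS]mulrC schur_det_ge.
  have bb i k : nrm (schur nu e d (tau ^+ 2) i k) <= beta.
    by apply: le_trans (schur_le _ _ unu eb t0) _; rewrite /beta lerD2l ler_pM2l.
  have := @cramer_bound _ beta delta _ (y ^~ 0) ((v - z *: (J nu *m xe)) ^~ 0) bb d0 dd sys.
  move: (v - _) => w h.
  rewrite !nsq_col.
  have sq3 (a b c g : R) : 0 <= g -> g <= a + b + c ->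
      g ^+ 2 <= 3 * (a ^+ 2 + b ^+ 2 + c ^+ 2).
    move=> g0 h'; apply: (@le_trans _ _ ((a + b + c) ^+ 2)).
      by rewrite ler_sqr ?nnegrE // (le_trans g0).
    by clear; have := sqr_ge0 (a - b); have := sqr_ge0 (a - c); have := sqr_ge0 (b - c); lra.
  have hi i : nrm (y i 0) ^+ 2 <= (2 * beta ^+ 2 / delta) ^+ 2 *
      (3 * (nrm (w 0 0) ^+ 2 + nrm (w 1 0) ^+ 2 + nrm (w 2 0) ^+ 2)).
    have b0 : 0 <= 2 * beta ^+ 2 / delta by apply: divr_ge0; [apply: mulr_ge0 => //; apply: sqr_ge0|apply: ltW].
    apply: (@le_trans _ _ (((2 * beta ^+ 2 / delta) *
        (nrm (w 0 0) + nrm (w 1 0) + nrm (w 2 0))) ^+ 2)).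
      have S0 : 0 <= nrm (w 0 0) + nrm (w 1 0) + nrm (w 2 0).
        by rewrite !addr_ge0 ?nrm_ge0.
      rewrite ler_sqr ?nnegrE; [|exact: nrm_ge0|exact: mulr_ge0 b0 S0].
      by rewrite mulrAC ler_pdivlMr // mulrC; apply: h.
    by rewrite exprMn ler_wpM2l ?sqr_ge0 // sq3 // !addr_ge0 ?nrm_ge0.
  have := hi 0; have := hi 1; have := hi 2; rewrite /M; move: (_ / delta) => {hi}.
  move=> q; move: (nrm (w 0 0) ^+ 2 + _ + _) => W.
  rewrite (_ : q ^+ 2 * (3 * W) = 3 * (q ^+ 2 * W)); last by ring.
  rewrite (_ : q ^+ 2 * 9 * W = 9 * (q ^+ 2 * W)); last by ring.
  move: (q ^+ 2 * W) (nrm (y 0 0) ^+ 2) (nrm (y 1 0) ^+ 2) (nrm (y 2 0) ^+ 2).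
  by clear => *; lra.
have hx : nsq x <= 400 * nsq (u + z *: (J nu *m y)).
  apply: (nsq_scale_inv eG) => i; have := had_entry i hu.
  move: (J nu *m y) => A h; rewrite [RHS]mxE [X in _ = _ + X]mxE h; ring.
have hx2 : nsq x <= 800 * nsq u + 7200 * T * nsq y.
  apply: le_trans hx _; have := nsqD_le u (z *: (J nu *m y)); rewrite nsqZ z2.
  have : tau ^+ 2 * nsq (J nu *m y) <= T * (9 * nsq y).
    by rewrite ler_pM ?sqr_ge0 ?nsq_ge0 // nsq_J_le.
  rewrite (_ : T * (9 * nsq y) = 9 * (T * nsq y)); last by ring.
  rewrite -[7200 * T * _]mulrA !mulr2n.
  move: (T * nsq y) (nsq u) (tau ^+ 2 * _) (nsq (_ + _)); clear => *; lra.
have hy2 : nsq y <= M * L * (nsq u + nsq v).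
  by apply: le_trans hy _; rewrite -mulrA ler_wpM2l.
have Ty : (7200 * T + 1) * nsq y <= (7200 * T + 1) * (M * L * (nsq u + nsq v)).
  by rewrite ler_wpM2l // addr_ge0 // mulr_ge0.
apply: (@le_trans _ _ (800 * nsq u + (7200 * T + 1) * nsq y)).
  by rewrite [(_ + 1) * _]mulrDl mul1r addrA lerD2r.
rewrite [leRHS]mulrDl; apply: lerD; last by rewrite -[leRHS]mulrA.
by rewrite ler_pM2l // lerDl nsq_ge0.
Qed.

End Core.

Lemma zmod_move (V : zmodType) (A B D E : V) :
  A - B + (D + E) = 0 -> D - B = - E - A.
Proof.
move=> h; apply/eqP; rewrite -subr_eq0 opprD !opprK -h; apply/eqP.
by rewrite addrACA addrC [- B + A]addrC.
Qed.

(** * Momenta with [mu] within O(lam) of 1 and [nu] not *)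

Section Region3b.
Context {R : realType}.
Local Notation C := R[i].

Lemma nsq_tr m n (A : 'M[C]_(m, n)) : nsq A^T = nsq A.
Proof. exact: ip_tr. Qed.

Lemma nsq_mul_colr a0 a1 a2 n (X : 'M[C]_(n, 3)) :
  nsq (X *m colr a0 a1 a2) <= (a0 ^+ 2 + a1 ^+ 2 + a2 ^+ 2) * nsq X.
Proof.
by rewrite -nsq_tr -[nsq X]nsq_tr trmx_mul trmxK nsq_rowr_mul.
Qed.

Lemma nsq_col_row a0 a1 a2 n (x : 'cV[C]_n) :
  nsq (x *m rowr a0 a1 a2) = (a0 ^+ 2 + a1 ^+ 2 + a2 ^+ 2) * nsq x.
Proof.
by rewrite -nsq_tr -[nsq x]nsq_tr trmx_mul -/(colr _ _ _) nsq_colr_mul.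
Qed.

Lemma mul_colrE a0 a1 a2 n (X : 'M[C]_(n, 3)) i j :
  (X *m colr a0 a1 a2) i j = a0%:C * X i 0 + a1%:C * X i 1 + a2%:C * X i 2.
Proof. by rewrite mxE sum3 !mxE !(mulrC (X i _)). Qed.

Lemma hadE m n (w : 'I_m -> 'I_n -> R) X i j : had w X i j = (w i j)%:C * X i j.
Proof. by rewrite mxE. Qed.

Lemma addE m n (A B : 'M[C]_(m, n)) i j : (A + B) i j = A i j + B i j.
Proof. by rewrite mxE. Qed.

Lemma oppE m n (A : 'M[C]_(m, n)) i j : (- A) i j = - A i j.
Proof. by rewrite mxE. Qed.

Lemma scaleE m n a (A : 'M[C]_(m, n)) i j : (a *: A) i j = a * A i j.
Proof. by rewrite mxE. Qed.

Lemma eqC (a b c d : R) : a = c -> b = d -> a +i* b = c +i* d.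
Proof. by move=> -> ->. Qed.

Section Chi.
Variables (k : R) (k2 : k ^+ 2 = 3).

Local Notation one := (colr (1 / 3 : R) (1 / 3) (1 / 3)).
Local Notation chi := (colr ((1 - k) / 12 : R) (- (2 / 12)) ((1 + k) / 12)).
Local Notation chi' := (colr ((1 + k) / 12 : R) (- (2 / 12)) ((1 - k) / 12)).

(** Identities involving k = sqrt 3 hold modulo k^2 - 3; [q] is the cofactor to be supplied, after
    which [field] can treat k as an indeterminate. *)
Lemma mod_k2 (a b q : R) : a = b + (k ^+ 2 - 3) * q -> a = b.
Proof. by rewrite k2 subrr mul0r addr0. Qed.

(** (1 - k, -2, 1 + k) and (1 + k, -2, 1 - k) are orthogonal, of squared norm 6 + 2 k^2 = 12, and
    span the sum-zero vectors. They diagonalise the compression of diag(-1, 0, 1) to that plane,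
    with eigenvalues k / 3 and - k / 3. *)
Lemma chi_decomposition n (X : 'M[C]_(n, 3)) :
  X = X *m one *m rowr 1 1 1 + X *m chi *m rowr (1 - k) (- 2) (1 + k) +
      X *m chi' *m rowr (1 + k) (- 2) (1 - k).
Proof.
apply/matrixP => i j; rewrite !mxE !big_ord1 !mul_colrE !mxE.
elim/ord3P: j => /=; case: (X i 0) (X i 1) (X i 2) => x0 y0 [x1 y1] [x2 y2]; apply: eqC.
- by apply: (@mod_k2 _ _ ((x2 - x0) / 6)) => /=; field.
- by apply: (@mod_k2 _ _ ((y2 - y0) / 6)) => /=; field.
- by apply: (@mod_k2 _ _ 0) => /=; field.
- by apply: (@mod_k2 _ _ 0) => /=; field.
- by apply: (@mod_k2 _ _ ((x0 - x2) / 6)) => /=; field.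
- by apply: (@mod_k2 _ _ ((y0 - y2) / 6)) => /=; field.
Qed.

(** The part linear in Im mu is purely off-diagonal in chi, chi', while [had_chi] makes the
    potential diagonal there up to a coupling with [one]. This is the block shape solved by
    [core_solve]. *)
Lemma J_chi (mu : C) :
  J mu *m chi = (1 - Re mu)%:C *: chi - ('i * (Im mu * k)%:C) *: chi'.
Proof.
apply/matrixP => i j; have [[e01 e12 e20] [d02 d10 d21]] := ord3_add 0.
rewrite J_mulE !mxE; case: mu => c s.
elim/ord3P: i; rewrite ?(e01, e12, e20, d02, d10, d21) /=; apply: eqC.
- by apply: (@mod_k2 _ _ 0); field.
- by apply: (@mod_k2 _ _ (s / 12)); field.
- by apply: (@mod_k2 _ _ 0); field.
- by apply: (@mod_k2 _ _ 0); field.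
- by apply: (@mod_k2 _ _ 0); field.
- by apply: (@mod_k2 _ _ (- s / 12)); field.
Qed.

Lemma J_chi' (mu : C) :
  J mu *m chi' = (1 - Re mu)%:C *: chi' + ('i * (Im mu * k)%:C) *: chi.
Proof.
apply/matrixP => i j; have [[e01 e12 e20] [d02 d10 d21]] := ord3_add 0.
rewrite J_mulE !mxE; case: mu => c s.
elim/ord3P: i; rewrite ?(e01, e12, e20, d02, d10, d21) /=; apply: eqC.
- by apply: (@mod_k2 _ _ 0); field.
- by apply: (@mod_k2 _ _ (s / 12)); field.
- by apply: (@mod_k2 _ _ 0); field.
- by apply: (@mod_k2 _ _ 0); field.
- by apply: (@mod_k2 _ _ 0); field.
- by apply: (@mod_k2 _ _ (- s / 12)); field.
Qed.

Lemma J_one (mu : C) a : J mu *m colr a a a = (1 + 2 * Re mu)%:C *: colr a a a.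
Proof.
apply: trmx_inj; rewrite trmx_mul J_tr trmxK rowr_const_J linearZ /= trmxK.
by case: mu.
Qed.

Section Potential.
Variables (a b : 'I_3 -> R).
Let w (i j : 'I_3) := a i + b i * gg j.

Lemma had_chi (X : 'M[C]_3) : had w X *m chi =
  had (fun i _ => a i + b i * k / 3) (X *m chi) +
  (k / 6)%:C *: had (fun i _ => b i) (X *m one).
Proof.
apply/matrixP => i j; rewrite addE scaleE !hadE !mul_colrE !hadE /w !ggE.
case: (X i 0) (X i 1) (X i 2) => x0 y0 [x1 y1] [x2 y2]; apply: eqC => /=.
- by apply: (@mod_k2 _ _ (b i * (x0 - x2) / 36)); field.
- by apply: (@mod_k2 _ _ (b i * (y0 - y2) / 36)); field.
Qed.

Lemma had_chi' (X : 'M[C]_3) : had w X *m chi' =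
  had (fun i _ => a i - b i * k / 3) (X *m chi') -
  (k / 6)%:C *: had (fun i _ => b i) (X *m one).
Proof.
apply/matrixP => i j; rewrite addE oppE scaleE.
rewrite !hadE !mul_colrE !hadE /w !ggE.
case: (X i 0) (X i 1) (X i 2) => x0 y0 [x1 y1] [x2 y2]; apply: eqC => /=.
- by apply: (@mod_k2 _ _ (b i * (x0 - x2) / 36)); field.
- by apply: (@mod_k2 _ _ (b i * (y0 - y2) / 36)); field.
Qed.

End Potential.
End Chi.

(** The delicate entries are the middle ones, +- r k / 3 - t: since 2/10 < r k / 3 < 21/100 they
    keep their sign, with a margin, for |t| <= 1/10. Moreover d 0 + d 2 = 2 d 1, whence its sign. *)
Lemma pot_core (k r t : R) : k ^+ 2 = 3 -> 0 < k -> r_bounds r -> `|t| <= 1 / 10 ->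
  let a i := gg i / r - t in let b i := r + 2 * gg i in
  core_bounds (fun i => a i + b i * k / 3) (fun i => a i - b i * k / 3).
Proof.
move=> k2 k0 [r1 r2 r3 r4 _]; rewrite ler_norml => /andP[t1 t2] /=.
have k1 : 173 / 100 < k by nra.
have k3 : k < 174 / 100 by nra.
have rk1 : 2 / 10 < r * k / 3 by nra.
have rk2 : r * k / 3 < 21 / 100 by nra.
rewrite /core_bounds !ggE; move: (r^-1) r3 r4 => s r3 r4.
rewrite !mulrDl; move: (r * k / 3) rk1 rk2 => q rk1 rk2.
clear r1 r2 k2 r.
by do ![split]; try (apply/andP; split); lra.
Qed.

Lemma young_error (A B D E : R) : A <= 9 * B -> D <= E ->
  (1 / 12 * A) *+ 2 + D *+ 2 <= 3 / 2 * B + 2 * E.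
Proof. by move=> h1 h2; lra. Qed.

(** [S] is the squared norm of the chi, chi' components. Its feedback on itself, through (1 - Re mu)
    / lam = O(lam), is absorbed in S / 2 for small lam, so that y controls X; the equation along
    [one] then forces y to vanish. *)
Lemma region3b_arith (Kc K lam ny N S s2 c K2 : R) :
  0 < Kc -> 0 < lam -> lam <= 1 -> lam * (36 * Kc * K ^+ 4) <= 1 ->
  0 <= ny -> 0 <= S -> 0 <= c -> c <= K ^+ 2 * lam ^+ 2 ->
  S <= Kc * (3 * ny + 18 * (c / lam) ^+ 2 * S) ->
  N <= 9 * ny + 36 * S ->
  4 * (s2 * ny) <= lam ^+ 2 * (17 * N) ->
  K2 ^+ 2 * lam ^+ 2 <= s2 -> 17 * (9 + 216 * Kc) < 4 * K2 ^+ 2 ->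
  N <= 0.
Proof.
move=> Kc0 l0 l1 lK ny0 S0 c0 cK hS hN hy hs hK2.
have cl : (c / lam) ^+ 2 <= K ^+ 4 * lam.
  apply: (@le_trans _ _ ((K ^+ 2 * lam) ^+ 2)).
    have h0 : 0 <= c / lam by apply: divr_ge0 => //; apply: ltW.
    have h1 : c / lam <= K ^+ 2 * lam by rewrite ler_pdivrMr // -mulrA -expr2.
    by rewrite ler_sqr ?nnegrE // (le_trans h0).
  rewrite exprMn -exprM ler_wpM2l ?exprn_even_ge0 // expr2.
  by rewrite -[leRHS]mulr1 ler_pM2l.
have hS2 : S <= 6 * Kc * ny.
  have h : Kc * (18 * (c / lam) ^+ 2 * S) <= S / 2.
    apply: (@le_trans _ _ (Kc * (18 * (K ^+ 4 * lam) * S))).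
      by rewrite ler_pM2l // ler_wpM2r // ler_pM2l.
    rewrite (_ : _ * (_ * S) = lam * (36 * Kc * K ^+ 4) / 2 * S); last by field.
    rewrite [leRHS]mulrC ler_wpM2r //; move: (lam * _) lK; clear => *; lra.
  move: hS h; rewrite mulrDr (_ : Kc * (3 * ny) = 3 * (Kc * ny)); last by ring.
  rewrite (_ : 6 * Kc * ny = 6 * (Kc * ny)); last by ring.
  by move: (Kc * ny) (Kc * _); clear => *; lra.
have hN2 : N <= (9 + 216 * Kc) * ny.
  move: hN hS2; rewrite (_ : 6 * Kc * ny = 6 * (Kc * ny)); last by ring.
  rewrite (_ : (9 + 216 * Kc) * ny = 9 * ny + 216 * (Kc * ny)); last by ring.
  by move: (Kc * ny); clear => *; lra.
have h : lam ^+ 2 * (4 * K2 ^+ 2 * ny) <= lam ^+ 2 * (17 * (9 + 216 * Kc) * ny).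
  apply: (@le_trans _ _ (4 * (s2 * ny))).
    rewrite (_ : _ * _ = 4 * (K2 ^+ 2 * lam ^+ 2 * ny)); last by ring.
    by rewrite ler_pM2l // ler_wpM2r.
  by apply: le_trans hy _; rewrite ler_pM2l ?exprn_gt0 // -[leRHS]mulrA ler_pM2l.
rewrite ler_pM2l ?exprn_gt0 // in h.
have ny1 : ny <= 0.
  rewrite leNgt; apply/negP => nyp; move: h; rewrite ler_pM2r // leNgt.
  by rewrite hK2.
have ny00 : ny = 0 by apply/eqP; rewrite eq_le ny1.
by move: hN2; rewrite ny00 mulr0.
Qed.

(** Multiplying the equation by chi and chi' on the right and dividing by lam gives the system of
    [core_solve] with tau = Im mu * k / lam, bounded in terms of K. Its solution is controlled by y
    uniformly in nu. Multiplying by [one] gives |Im nu| |y| = O(lam |X|), which forces X = 0 once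
    |Im nu| exceeds K2 lam. *)
Lemma region3b (K : R) : 0 < K -> exists K2 lam1 : R, [/\ 0 < K2, 0 < lam1 &
  forall (r t lam : R) (nu mu : C) (X : 'M[C]_3),
  r_bounds r -> `|t| <= 1 / 10 -> 0 < lam -> lam <= lam1 ->
  unitc nu -> 1 / 2 <= Re nu -> unitc mu -> 1 / 2 <= Re mu ->
  Im mu ^+ 2 <= K ^+ 2 * lam ^+ 2 -> K2 ^+ 2 * lam ^+ 2 <= Im nu ^+ 2 ->
  J nu *m X *m J mu + lam%:C *: had (fun i j => pot r i j - t) X = 0 -> X = 0].
Proof.
move=> K0; pose k : R := Num.sqrt 3.
have k2 : k ^+ 2 = 3 by rewrite sqr_sqrtr.
have k0 : 0 < k by rewrite sqrtr_gt0.
have T0 : 0 <= 3 * K ^+ 2 by rewrite mulr_ge0 ?sqr_ge0.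
have [Kc Kc0 core] := @core_solve R _ T0.
have D0 : 0 <= 36 * Kc * K ^+ 4.
  by apply: mulr_ge0; [apply: mulr_ge0 => //; apply: ltW|rewrite exprn_even_ge0].
have E0 : 1 <= 17 * (9 + 216 * Kc) by move: Kc0; clear => ?; lra.
(* [K2] has to satisfy 17 (9 + 216 Kc) < 4 K2^2; the left side is at least 1, so K2 may be that
   number itself. The second witness makes lam <= 1 and lam * 36 Kc K^4 <= 1. *)
exists (17 * (9 + 216 * Kc)); exists (1 + 36 * Kc * K ^+ 4)^-1; split.
- by move: E0; clear => ?; lra.
- by rewrite invr_gt0; move: D0; clear => ?; lra.
move=> r t lam nu mu X rb t1 lam0 lam1 unu cnu umu cmu muK nuK eqX.
have lD : lam * (1 + 36 * Kc * K ^+ 4) <= 1.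
  by rewrite -ler_pdivlMr ?mul1r //; move: D0; clear => ?; lra.
have lD0 : 0 <= lam * (36 * Kc * K ^+ 4) by rewrite mulr_ge0 // ltW.
rewrite mulrDr mulr1 in lD.
pose a i : R := gg i / r - t; pose b i : R := r + 2 * gg i.
have eb := pot_core k2 k0 rb t1; rewrite -/a -/b in eb.
pose one : 'cV[C]_3 := colr (1 / 3) (1 / 3) (1 / 3).
pose chi : 'cV[C]_3 := colr ((1 - k) / 12) (- (2 / 12)) ((1 + k) / 12).
pose chi' : 'cV[C]_3 := colr ((1 + k) / 12) (- (2 / 12)) ((1 - k) / 12).
have wE : had (fun i j => pot r i j - t) X = had (fun i j => a i + b i * gg j) X.
  by apply/matrixP => i j; rewrite !hadE /a /b /pot; congr (_%:C * _); ring.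
have lN : lam%:C != 0 :> C.
  by apply/eqP => /(congr1 (@complex.Re R)) /= l0; rewrite l0 ltxx in lam0.
pose c := 1 - Re mu; pose tau := Im mu * k / lam.
have ztau : 'i * (Im mu * k)%:C = lam%:C * ('i * tau%:C) :> C.
  rewrite mulrCA -rmorphM /tau mulrCA divff ?mulr1 //.
  by rewrite gt_eqF.
have clam : c%:C = lam%:C * (c / lam)%:C :> C.
  by rewrite -rmorphM mulrCA divff ?mulr1 // gt_eqF.
have eq_chi (v : 'cV[C]_3) : J nu *m (X *m (J mu *m v)) +
    lam%:C *: (had (fun i j => a i + b i * gg j) X *m v) = 0.
  by rewrite !mulmxA scalemxAl -mulmxDl -wE eqX mul0mx.
set y := X *m one; set x := X *m chi; set z := X *m chi'.
have eq1 := eq_chi chi; rewrite J_chi // had_chi // -/chi -/chi' -/x -/y in eq1.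
have eq2 := eq_chi chi'; rewrite J_chi' // had_chi' // -/chi -/chi' -/z -/y in eq2.
have eq3 := eq_chi one; rewrite J_one -scalemxAr -/y -scalemxAr -wE in eq3.
have XE := chi_decomposition k2 X; rewrite -/one -/chi -/chi' -/x -/y -/z in XE.
rewrite mulmxBr -!scalemxAr mulmxBr -!scalemxAr -/x -/z scalerDr scalerA in eq1.
rewrite mulmxDr -!scalemxAr mulmxDr -!scalemxAr -/x -/z scalerBr scalerA in eq2.
have N_le : nsq X <= 9 * nsq y + 36 * (nsq x + nsq z).
  rewrite XE; apply: le_trans (nsqD3 _ _ _) _; rewrite !nsq_col_row; clear -k2.
  move: (nsq x) (nsq y) (nsq z) => nx ny nz.
  rewrite (_ : (1 - k) ^+ 2 + _ + _ = 2 * k ^+ 2 + 6); last by ring.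
  rewrite (_ : (1 + k) ^+ 2 + _ + _ = 2 * k ^+ 2 + 6); last by ring.
  by rewrite k2; lra.
clear eq_chi; clearbody x y z; clear XE.
set Jx := J nu *m x in eq1 eq2; set Jz := J nu *m z in eq1 eq2.
have tau2 : tau ^+ 2 <= 3 * K ^+ 2.
  rewrite /tau expr_div_n exprMn k2 ler_pdivrMr ?exprn_gt0 // mulrC -mulrA.
  by rewrite ler_pM2l.
have nsq_b (v : 'cV[C]_3) : nsq (had (fun i _ => b i) v) <= 9 * nsq v.
  apply: nsq_had => i _; rewrite (_ : 9 = 3 ^+ 2); last by ring.
  case: rb => r1 r2 _ _ _; rewrite /b.
  by apply: ler_sqr_bound; elim/ord3P: i; rewrite !ggE; move: r1 r2; clear => ? ?; lra.
have nsq_err (q q' : R) (v : 'cV[C]_3) : q ^+ 2 = 1 / 12 ->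
    nsq (q%:C *: had (fun i _ => b i) y + q'%:C *: (J nu *m v)) <=
    3 / 2 * nsq y + 18 * (q' ^+ 2 * nsq v).
  move=> q2; apply: le_trans (nsqD_le _ _) _; rewrite !nsqR q2.
  rewrite (_ : 18 * _ = 2 * (q' ^+ 2 * (9 * nsq v))); last by ring.
  by apply: young_error; [exact: nsq_b|rewrite ler_wpM2l ?sqr_ge0 ?nsq_J_le].
have sys1 : had (fun i _ => a i + b i * k / 3) x - ('i * tau%:C) *: Jz =
    (- (k / 6))%:C *: had (fun i _ => b i) y + (- (c / lam))%:C *: Jx.
  apply: (scalerI lN); rewrite scalerBr scalerDr !scalerA -ztau.
  by rewrite !rmorphN !mulrN -clam !scaleNr; apply: zmod_move.
have sys2 : had (fun i _ => a i - b i * k / 3) z + ('i * tau%:C) *: Jx =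
    (k / 6)%:C *: had (fun i _ => b i) y + (- (c / lam))%:C *: Jz.
  move: eq2; move: (had _ z) (had _ y) => hz hy eq2.
  apply: (scalerI lN); rewrite scalerDr [RHS]scalerDr 3!scalerA -ztau.
  rewrite [in RHS]rmorphN mulrN -clam scaleNr -[_ *: Jx]opprK -[_ *: hy]opprK.
  by apply: zmod_move; rewrite opprK.
have k6 : (k / 6) ^+ 2 = 1 / 12 by rewrite expr_div_n k2; field.
have k6' : (- (k / 6)) ^+ 2 = 1 / 12 by rewrite sqrrN.
have hS := core nu _ _ tau x z _ _ unu eb tau2 sys1 sys2.
have H1 := nsq_err _ (- (c / lam)) x k6'; have H2 := nsq_err _ (- (c / lam)) z k6.
rewrite sqrrN in H1; rewrite sqrrN in H2.
apply/eqP; rewrite -nsq_eq0 eq_le nsq_ge0 andbT.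
have c_le : 0 <= c <= Im mu ^+ 2.
  rewrite /c; move: umu cmu => /eqP; rewrite /ipc -!expr2; clear.
  by move: (Re mu) (Im mu) => p q ? ?; apply/andP; split; nra.
have [c0 c1] := andP c_le.
have S0 : 0 <= nsq x + nsq z by rewrite addr_ge0 ?nsq_ge0.
have hS' : nsq x + nsq z <= Kc * (3 * nsq y + 18 * (c / lam) ^+ 2 * (nsq x + nsq z)).
  apply: le_trans hS _; rewrite (ler_pM2l Kc0); move: H1 H2; clear.
  move: (c / lam) (nsq (_ + _)) (nsq (_ + _)) (nsq x) (nsq y) (nsq z) => q p p' nx ny nz.
  move=> H1 H2; apply: le_trans (lerD H1 H2) _.
  by rewrite le_eqVlt; apply/orP; left; apply/eqP; field.
have hy : 4 * (Im nu ^+ 2 * nsq y) <= lam ^+ 2 * (17 * nsq X).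
  set H := had _ X in eq3; have HN : nsq H <= 49 * nsq X.
    have t1' : `|t| <= 1 by move: t1; clear => ?; lra.
    by apply: nsq_had => i j; exact: pot_le6 rb t1'.
  have eqn : nsq ((1 + 2 * Re mu)%:C *: (J nu *m y)) = nsq (lam%:C *: (H *m one)).
    rewrite -[nsq (lam%:C *: _)]mul1r -[in RHS](_ : ipc (-1) (-1 : C) = 1); last first.
      by rewrite /ipc /= oppr0 mulr0 addr0 mulrNN mulr1.
    rewrite -nsqZ scaleN1r; congr nsq; apply/eqP; rewrite -subr_eq0 opprK.
    by apply/eqP; exact: eq3.
  rewrite !nsqR in eqn.
  have h1 : lam ^+ 2 * nsq (H *m one) <= lam ^+ 2 * (17 * nsq X).
    apply: (ler_wpM2l (sqr_ge0 lam)); apply: le_trans (nsq_mul_colr _ _ _ _) _.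
    rewrite (_ : _ + _ + _ = 1 / 3); last by clear; field.
    by move: HN (nsq_ge0 X); clear; move: (nsq H) (nsq X) => *; lra.
  apply: le_trans h1; rewrite -eqn.
  apply: ler_pM; [exact: ler0n|apply: mulr_ge0; [exact: sqr_ge0|exact: nsq_ge0]| |].
    by move: cmu; clear; move: (Re mu) => q ?; nra.
  exact: nsq_J_ge unu cnu.
have l1 : lam <= 1 by move: lD lD0; move: (lam * _); clear => *; lra.
have lK : lam * (36 * Kc * K ^+ 4) <= 1.
  by move: lD lam0; move: (lam * _); clear => *; lra.
have K2 : 17 * (9 + 216 * Kc) < 4 * (17 * (9 + 216 * Kc)) ^+ 2.
  move: E0; move: (17 * _) => q; clear => ?; nra.
exact: (region3b_arith Kc0 lam0 l1 lK (nsq_ge0 y) S0 c0 (le_trans c1 muK) hS' N_le hy nuK).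
Qed.

End Region3b.

(** * Subspaces of blocks on which a form is definite *)

Section Subspaces.
Context {R : realType}.
Local Notation C := R[i].
Local Notation V := 'M[C]_3.

Lemma dim_M3 : \dim {:V} = 9%N.
Proof. by rewrite dimvf. Qed.

Lemma cap_nontrivial (U W : {vspace V}) : (9 < \dim U + \dim W)%N ->
  exists X, [/\ X != 0, X \in U & X \in W].
Proof.
move=> h; have : (0 < \dim (U :&: W))%N.
  have := dimv_sum_cap U W; have := dimvS (subvf (U + W)%VS); rewrite dim_M3 => h1 h2.
  by rewrite -(ltn_add2l (\dim (U + W))) addn0 h2 (leq_ltn_trans h1).
rewrite lt0n dimv_eq0 -vpick0 => X0.
exists (vpick (U :&: W)); split => //; have := memv_pick (U :&: W).
  by rewrite memv_cap => /andP[].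
by rewrite memv_cap => /andP[].
Qed.

Lemma ker_dim m (phi : {linear V -> 'rV[C]_m}) :
  (9 - m <= \dim (lker (linfun phi)))%N.
Proof.
have := limg_ker_dim (linfun phi) fullv; rewrite capfv dim_M3 => h.
have : (\dim (limg (linfun phi)) <= m)%N.
  by apply: leq_trans (dimvS (subvf _)) _; rewrite dimvf /dim /= mul1n.
move=> hm; rewrite leq_subLR; have {1}<- := h; rewrite addnC; exact: leq_add.
Qed.

(** Linear forms on blocks, with real coefficients listed row by row. *)
Definition lin9 (c : seq R) (X : V) : C :=
  \sum_(i < 3) \sum_(j < 3) (nth 0 c (3 * i + j))%:C * X i j.

Lemma lin9E c X : lin9 c X =
  (nth 0 c 0)%:C * X 0 0 + (nth 0 c 1)%:C * X 0 1 + (nth 0 c 2)%:C * X 0 2 +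
  ((nth 0 c 3)%:C * X 1 0 + (nth 0 c 4)%:C * X 1 1 + (nth 0 c 5)%:C * X 1 2) +
  ((nth 0 c 6)%:C * X 2 0 + (nth 0 c 7)%:C * X 2 1 + (nth 0 c 8)%:C * X 2 2).
Proof. by rewrite /lin9 !sum3. Qed.

(** Rank-nullity: each listed equation costs at most one dimension, whether or not the equations are
    independent. *)
Lemma lin_space (cs : seq (seq R)) : exists W : {vspace V},
  (9 - size cs <= \dim W)%N /\ forall X, X \in W ->
  forall k, (k < size cs)%N -> lin9 (nth [::] cs k) X = 0.
Proof.
pose phi (X : V) : 'rV[C]_(size cs) := \row_k lin9 (nth [::] cs k) X.
have phi_lin : linear phi.
  move=> a X Y; apply/rowP => k; rewrite !mxE /lin9 mulr_sumr -big_split /=.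
  apply: eq_bigr => i _; rewrite mulr_sumr -big_split /=.
  by apply: eq_bigr => j _; rewrite !mxE mulrDr mulrCA.
pose P := GRing.isLinear.Build _ _ _ _ phi phi_lin.
pose Phi : {linear V -> 'rV[C]_(size cs)} := HB.pack phi P.
exists (lker (linfun Phi)); split; first exact: ker_dim.
move=> X; rewrite memv_ker lfunE /= => /eqP /rowP h k kc.
by have := h (Ordinal kc); rewrite !mxE.
Qed.

Definition selfadj (f : V -> V) := forall X Y, ip (f X) Y = ip X (f Y).
Definition clinear (f : V -> V) := forall a X Y, f (a *: X + Y) = a *: f X + f Y.

Lemma clinearZ f a X : clinear f -> f (a *: X) = a *: f X.
Proof.
move=> fl; have f0 : f 0 = 0 by have := fl (-1) 0 0; rewrite scaler0 add0r scaleN1r addNr.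
by have := fl a X 0; rewrite f0 !addr0.
Qed.

(** A nonzero kernel vector X could be added to U without making the form positive anywhere, and U +
    <X>, one dimension larger, would meet W. *)
Lemma kernel_trivial (f : V -> V) (U W : {vspace V}) X :
  selfadj f -> clinear f -> (9 <= \dim U + \dim W)%N ->
  (forall Y, Y \in U -> Y != 0 -> ip (f Y) Y < 0) ->
  (forall Y, Y \in W -> Y != 0 -> 0 < ip (f Y) Y) ->
  f X = 0 -> X = 0.
Proof.
move=> fs fl UW fU fW fX; apply/eqP; apply: contraT => X0.
have XU : X \notin U.
  by apply/negP => /fU /(_ X0); rewrite fX ip0l ltxx.
have dX : \dim (U + <[X]>) = (\dim U).+1.
  rewrite dimv_disjoint_sum ?dim_vline ?X0 ?addn1 //.
  apply/eqP; rewrite -subv0; apply/subvP => Y; rewrite memv_cap => /andP[YU /vlineP[a Ya]].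
  rewrite memv0; apply: contraT => Y0; case/negP: XU.
  have a0 : a != 0 by apply: contraNneq Y0 => a0; rewrite Ya a0 scale0r.
  by rewrite -[X](scalerK a0) -Ya memvZ.
have [Y [Y0 + YW]] : exists Y, [/\ Y != 0, Y \in (U + <[X]>)%VS & Y \in W].
  by apply: cap_nontrivial; rewrite dX addSn.
move=> /memv_addP[Z ZU [_ /vlineP[a ->] Ye]].
have fY : f Y = f Z.
  by rewrite Ye addrC fl fX scaler0 add0r.
have := fW Y YW Y0; rewrite fY Ye ipDr fs [X in _ + X]fs.
rewrite (clinearZ a X fl) fX scaler0 ip0r addr0 -fs; have [->|Zn0] := eqVneq Z 0; first by rewrite ip0r ltxx.
by rewrite ltNge (ltW (fU Z ZU Zn0)).
Qed.

Definition op (nu mu : C) (w : 'I_3 -> 'I_3 -> R) (X : V) : V :=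
  J nu *m X *m J mu + had w X.

Lemma op_linear nu mu w : clinear (op nu mu w).
Proof.
move=> a X Y; rewrite /op hadD hadZ mulmxDr mulmxDl -scalemxAr -scalemxAl scalerDr.
by rewrite addrACA.
Qed.

Lemma op_selfadj nu mu w : selfadj (op nu mu w).
Proof. by move=> X Y; rewrite /op ipDl ipDr ip_Jr ip_J ip_had !mulmxA. Qed.

End Subspaces.

(** * Both momenta within O(lam) of 0: expansion of the unperturbed form *)

Section SmallMomentum.
Context {R : realType}.
Local Notation C := R[i].
Local Notation V := 'M[C]_3.
Implicit Types X : V.

(** The derivative of [J] at momentum 0, i (T - T^-1) for the cyclic shift T. *)
Definition D : V :=
  \matrix_(i, j) if j == i then 0 else if j == i + 1 then 'i else - 'i.

Lemma J_decomp (nu : C) :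
  J nu = (1 - Re nu)%:C%:M + (Re nu)%:C *: const_mx 1 + (Im nu)%:C *: D.
Proof.
apply/matrixP => i j; rewrite !mxE; case: nu => c s.
by elim/ord3P: i; elim/ord3P: j; rewrite /= ?mulr1n ?mulr0n; apply/eqP;
  rewrite eq_complex /=; apply/andP; split; apply/eqP; ring.
Qed.

Definition csum X j := X 0 j + X 1 j + X 2 j.
Definition rsum X i := X i 0 + X i 1 + X i 2.
Definition total X := csum X 0 + csum X 1 + csum X 2.
Definition cross (a b : C) : R := Im a * Re b - Re a * Im b.
(** Up to sign, twice the area of the triangle with vertices a, b, d: it vanishes as soon as the
    three numbers satisfy a nontrivial real affine relation. *)
Definition twist (a b d : C) : R := cross a b + cross b d + cross d a.

Lemma D_mulE n (X : 'M[C]_(3, n)) i j : (D *m X) i j = 'i * (X (i + 1) j - X (i - 1) j).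
Proof.
have [[e01 e12 e20] [d02 d10 d21]] := ord3_add 0.
rewrite mxE sum3 !mxE; elim/ord3P: i; rewrite ?(e01, e12, e20, d02, d10, d21);
  by case: (X 0 j) (X 1 j) (X 2 j) => x0 y0 [x1 y1] [x2 y2];
     apply/eqP; rewrite eq_complex /=; apply/andP; split; apply/eqP; ring.
Qed.

Lemma mul_DE n (X : 'M[C]_(n, 3)) i j : (X *m D) i j = 'i * (X i (j - 1) - X i (j + 1)).
Proof.
have [[e01 e12 e20] [d02 d10 d21]] := ord3_add 0.
rewrite mxE sum3 !mxE; elim/ord3P: j; rewrite ?(e01, e12, e20, d02, d10, d21);
  by case: (X i 0) (X i 1) (X i 2) => x0 y0 [x1 y1] [x2 y2];
     apply/eqP; rewrite eq_complex /=; apply/andP; split; apply/eqP; ring.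
Qed.

Lemma E_mulE n (X : 'M[C]_(3, n)) i j : (const_mx 1 *m X : 'M_(3, n)) i j =
  X 0 j + X 1 j + X 2 j.
Proof. by rewrite mxE sum3 !mxE !mul1r. Qed.

Lemma mul_EE n (X : 'M[C]_(n, 3)) i j : (X *m const_mx 1 : 'M_(n, 3)) i j =
  X i 0 + X i 1 + X i 2.
Proof. by rewrite mxE sum3 !mxE !mulr1. Qed.

Lemma nsq_D_le n (X : 'M[C]_(3, n)) : nsq (D *m X) <= 4 * nsq X.
Proof.
rewrite /nsq !ip_cols mulr_sumr; apply: ler_sum => j _; rewrite !D_mulE.
have [[-> -> ->] [-> -> ->]] := ord3_add 0.
case: (X 0 j) (X 1 j) (X 2 j) => x0 y0 [x1 y1] [x2 y2]; rewrite /ipc /= -subr_ge0.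
rewrite (_ : _ - _ = (x0 + x1) ^+ 2 + (x0 + x2) ^+ 2 + (x1 + x2) ^+ 2 +
  ((y0 + y1) ^+ 2 + (y0 + y2) ^+ 2 + (y1 + y2) ^+ 2)); last by ring.
by rewrite !addr_ge0 ?sqr_ge0.
Qed.

Lemma nsq_mul_D_le n (X : 'M[C]_(n, 3)) : nsq (X *m D) <= 4 * nsq X.
Proof.
rewrite -nsq_tr -[nsq X]nsq_tr trmx_mul (_ : D^T = - D).
  by rewrite mulNmx /nsq ipNl ipNr opprK nsq_D_le.
apply/matrixP => i j; rewrite !mxE.
by elim/ord3P: i; elim/ord3P: j; rewrite /= ?oppr0 ?opprK.
Qed.

Lemma ip_le a b m n (A B : 'M[C]_(m, n)) :
  nsq A <= a -> nsq B <= b -> `|ip A B| <= (a + b) / 2.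
Proof.
have := ip_young A B ltr01; rewrite invr1 !mul1r mulr2n => h hA hB.
by move: h hA hB; move: `|_|; clear => q; lra.
Qed.

Definition JJ_main (nu mu : C) X : R :=
  Re nu * Re mu * ipc (total X) (total X) +
  Re nu * (1 - Re mu) *
    (ipc (csum X 0) (csum X 0) + ipc (csum X 1) (csum X 1) + ipc (csum X 2) (csum X 2)) +
  (1 - Re nu) * Re mu *
    (ipc (rsum X 0) (rsum X 0) + ipc (rsum X 1) (rsum X 1) + ipc (rsum X 2) (rsum X 2)).

Lemma ipcDr (a b d : C) : ipc a (b + d) = ipc a b + ipc a d.
Proof. by rewrite ipcC ipcDl !(ipcC a). Qed.

Lemma ip_rows n (A B : 'M[C]_(n, 3)) :
  ip A B = \sum_i (ipc (A i 0) (B i 0) + ipc (A i 1) (B i 1) + ipc (A i 2) (B i 2)).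
Proof. by rewrite ipE; apply: eq_bigr => i _; rewrite sum3. Qed.

Lemma ip_Jmul n (nu : C) (Y Z : 'M[C]_(3, n)) : ip (J nu *m Y) Z =
  (1 - Re nu) * ip Y Z + Re nu * ip (const_mx 1 *m Y) Z + Im nu * ip (D *m Y) Z.
Proof. by rewrite J_decomp !mulmxDl mul_scalar_mx -!scalemxAl !ipDl !ipRl. Qed.

Lemma ip_mulJ n (mu : C) (Y Z : 'M[C]_(n, 3)) : ip (Y *m J mu) Z =
  (1 - Re mu) * ip Y Z + Re mu * ip (Y *m const_mx 1) Z + Im mu * ip (Y *m D) Z.
Proof. by rewrite J_decomp !mulmxDr mul_mx_scalar -!scalemxAr !ipDl !ipRl. Qed.

(** With J nu = (1 - Re nu) + Re nu E + Im nu D, E the all-ones matrix, the terms of first order in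
    the momenta are those with E on one side and D on the other. They are multiples of the twists of
    the column and row sums; everything beside [JJ_main] is then of second order or higher. *)
Lemma JJ_expand (nu mu : C) X :
  twist (csum X 0) (csum X 1) (csum X 2) = 0 ->
  twist (rsum X 0) (rsum X 1) (rsum X 2) = 0 ->
  ip (J nu *m X *m J mu) X = JJ_main nu mu X + (1 - Re nu) * (1 - Re mu) * nsq X +
   (1 - Re nu) * Im mu * ip (X *m D) X + Im nu * (1 - Re mu) * ip (D *m X) X +
   Im nu * Im mu * ip (D *m X *m D) X.
Proof.
move=> tc tr.
have [[e01 e12 e20] [d02 d10 d21]] := ord3_add 0.
have eE : ip (const_mx 1 *m X) X =
  ipc (csum X 0) (csum X 0) + ipc (csum X 1) (csum X 1) + ipc (csum X 2) (csum X 2).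
  by rewrite ip_cols sum3 !E_mulE /csum -!ipcDr.
have Ee : ip (X *m const_mx 1) X =
  ipc (rsum X 0) (rsum X 0) + ipc (rsum X 1) (rsum X 1) + ipc (rsum X 2) (rsum X 2).
  by rewrite ip_rows sum3 !mul_EE /rsum -!ipcDr.
have EE : ip (const_mx 1 *m X *m const_mx 1) X = ipc (total X) (total X).
  by rewrite ip_cols sum3 !mul_EE !E_mulE /total /csum -!ipcDr.
have ED : ip (const_mx 1 *m X *m D) X = 0.
  rewrite ip_cols sum3 !mul_DE !E_mulE -!ipcDr ?(e01, e12, e20, d02, d10, d21).
  rewrite -/(csum X 0) -/(csum X 1) -/(csum X 2).
  transitivity (-2 * twist (csum X 0) (csum X 1) (csum X 2)); last by rewrite tc mulr0.
  rewrite /twist /cross.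
  by case: (csum X 0) (csum X 1) (csum X 2) => x0 y0 [x1 y1] [x2 y2]; rewrite /ipc /=; ring.
have DE : ip (D *m X *m const_mx 1) X = 0.
  rewrite -mulmxA ip_rows sum3 !D_mulE !mul_EE -!ipcDr ?(e01, e12, e20, d02, d10, d21).
  rewrite -/(rsum X 0) -/(rsum X 1) -/(rsum X 2).
  transitivity (2 * twist (rsum X 0) (rsum X 1) (rsum X 2)); last by rewrite tr mulr0.
  rewrite /twist /cross.
  by case: (rsum X 0) (rsum X 1) (rsum X 2) => x0 y0 [x1 y1] [x2 y2]; rewrite /ipc /=; ring.
rewrite ip_mulJ -!mulmxA !ip_Jmul !mulmxA eE Ee EE ED DE /JJ_main -/(nsq X).
by move: (ip _ X) (ip _ X) (ip _ X) => p q t; ring.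
Qed.

Lemma JJ_bound (nu mu : C) X (kappa : R) :
  unitc nu -> unitc mu -> 1 / 2 <= Re nu -> 1 / 2 <= Re mu ->
  0 <= kappa <= 1 -> Im nu ^+ 2 <= kappa ^+ 2 -> Im mu ^+ 2 <= kappa ^+ 2 ->
  twist (csum X 0) (csum X 1) (csum X 2) = 0 ->
  twist (rsum X 0) (rsum X 1) (rsum X 2) = 0 ->
  `|ip (J nu *m X *m J mu) X - JJ_main nu mu X| <= 20 * kappa ^+ 2 * nsq X.
Proof.
move=> unu umu cnu cmu /andP[k0 k1] knu kmu tc tr.
have small (z : C) : unitc z -> 1 / 2 <= Re z -> Im z ^+ 2 <= kappa ^+ 2 ->
    [/\ 0 <= 1 - Re z, 1 - Re z <= kappa ^+ 2 & `|Im z| <= kappa].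
  move=> /eqP; rewrite /ipc -!expr2; clear -k0; move: (Re z) (Im z) => c s h1 h2 h3.
  split; [nra|nra|]; rewrite -(ler_sqr (x := `|s|)) ?nnegrE //.
  by rewrite real_normK ?num_real.
have [a0 a1 a2] := small nu unu cnu knu; have [b0 b1 b2] := small mu umu cmu kmu.
have N0 := nsq_ge0 X.
have i1 := ip_le (nsq_mul_D_le X) (lexx (nsq X)).
have i2 := ip_le (nsq_D_le X) (lexx (nsq X)).
have i3 : `|ip (D *m X *m D) X| <= (4 * (4 * nsq X) + nsq X) / 2.
  by apply: ip_le => //; apply: le_trans (nsq_mul_D_le _) _; rewrite ler_pM2l ?nsq_D_le.
rewrite JJ_expand //.
have kk : kappa ^+ 2 <= kappa by rewrite expr2 ler_piMl.
set p := (1 - Re nu) * (1 - Re mu) * nsq X.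
set q := (1 - Re nu) * Im mu * _; set r := Im nu * (1 - Re mu) * _.
set s := Im nu * Im mu * _.
have -> : JJ_main nu mu X + p + q + r + s - JJ_main nu mu X = p + q + r + s by ring.
have M (x y z u v w : R) : `|x| <= u -> `|y| <= v -> `|z| <= w -> `|x * y * z| <= u * v * w.
  by move=> *; rewrite !normrM !ler_pM ?mulr_ge0.
have hk : 0 <= kappa ^+ 2 by exact: sqr_ge0.
have na : `|1 - Re nu| <= kappa ^+ 2 by rewrite ger0_norm.
have nb : `|1 - Re mu| <= kappa ^+ 2 by rewrite ger0_norm.
have hp : `|p| <= kappa ^+ 2 * 1 * nsq X.
  by apply: M; rewrite ?(ger0_norm N0) //; apply: le_trans nb _; apply: le_trans kk _.
have hq : `|q| <= kappa ^+ 2 * 1 * ((4 * nsq X + nsq X) / 2).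
  by apply: M => //; apply: le_trans b2 _.
have hr : `|r| <= 1 * kappa ^+ 2 * ((4 * nsq X + nsq X) / 2).
  by apply: M => //; apply: le_trans a2 _.
have hs : `|s| <= kappa * kappa * ((4 * (4 * nsq X) + nsq X) / 2) by apply: M.
apply: le_trans (ler_normD _ _) _; have := ler_normD (p + q) r; have := ler_normD p q.
move: hp hq hr hs (mulr_ge0 hk N0); rewrite -expr2 !mulr1 !mul1r -[20 * _ * _]mulrA.
rewrite (_ : _ ^+ 2 * ((4 * nsq X + _) / 2) = 5 / 2 * (kappa ^+ 2 * nsq X)); last by field.
rewrite (_ : _ ^+ 2 * ((4 * (4 * nsq X) + _) / 2) = 17 / 2 * (kappa ^+ 2 * nsq X)); last by field.
move: (kappa ^+ 2 * nsq X) (`|p + q + r|) (`|p + q|) `|p| `|q| `|r| `|s|; clear => *; lra.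
Qed.

End SmallMomentum.

(** * Subspaces of opposite sign for the potential *)

Section QuadraticForms.
Context {R : realType}.

Lemma ler_coef (a b x : R) : a <= b -> a * x ^+ 2 <= b * x ^+ 2.
Proof. by move=> ab; rewrite ler_wpM2r ?sqr_ge0. Qed.

(** Weighted Cauchy-Schwarz: (u + v + w)^2 <= (1 + 1/2 + 4) (u^2 + 2 v^2 + w^2 / 4), and 5.5 / 10 <
    1. The three squares of differences in the proof are those of Lagrange's identity for these
    weights. *)
Lemma negative_form (A B C D E u v w a : R) :
  A <= -1 -> B <= -2 -> C <= - (1 / 4) -> D <= 1 / 10 -> E <= -3 ->
  A * u ^+ 2 + B * v ^+ 2 + C * w ^+ 2 + D * (u + v + w) ^+ 2 + E * a ^+ 2 <=
  - (1 / 100) * (u ^+ 2 + v ^+ 2 + w ^+ 2 + (u + v + w) ^+ 2 + 2 * a ^+ 2).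
Proof.
move=> hA hB hC hD hE.
have := ler_coef u hA; have := ler_coef v hB; have := ler_coef w hC.
have := ler_coef (u + v + w) hD; have := ler_coef a hE.
have := sqr_ge0 (u - 2 * v); have := sqr_ge0 (4 * u - w); have := sqr_ge0 (8 * v - w).
have := sqr_ge0 u; have := sqr_ge0 v; have := sqr_ge0 w; have := sqr_ge0 a.
by move: (A * _) (B * _) (C * _) (D * _) (E * _); clear => *; lra.
Qed.

(* In the coordinates z, rho, A, B, y of the positive subspace. *)
Lemma positive_form (r s z rho A B y w : R) : w = z - A - B ->
  35 / 100 < r -> r < 36 / 100 -> 28 / 10 < s -> s < 282 / 100 ->
  328 / 10 < 15 * s - 26 * r ->
  (rho ^+ 2 + A ^+ 2 + B ^+ 2 + y ^+ 2) / 1000 - 1000 * z ^+ 2 <=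
  (- r - s + 2 - 1 / 10) * (z + rho) ^+ 2 + (- r - 1 / 10) * (3 * rho - w) ^+ 2 +
  (- r + s - 2 - 1 / 10) * (w - 4 * rho) ^+ 2 - 1 / 10 * y ^+ 2 +
  (s - 1 / 10) * A ^+ 2 + (r + s + 2 - 1 / 10) * B ^+ 2 +
  (r - 1 / 10) * (z + w - y) ^+ 2.
Proof.
move=> wE r1 r2 s1 s2 e5.
(* The coefficient of rho^2 weighs column 0 by 1, 9, 16, since rho enters it as (1, 3, -4) = - p; it
   is the borderline number of [potential_form] at t = 1/10. *)
have k1 : 2 / 10 * rho ^+ 2 <= (15 * s - 26 * r - 326 / 10) * rho ^+ 2.
  by apply: ler_coef; lra.
have k2 : 0 <= (14 * r - 8 * s + 174 / 10) * (rho * w) + rho ^+ 2 / 20 + 45 / 100 * w ^+ 2.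
  have : (14 * r - 8 * s + 174 / 10) ^+ 2 <= (3 / 10) ^+ 2 by apply: ler_sqr_bound; lra.
  move: (_ - _ + _) => K K2; have := sqr_ge0 (rho + 10 * (K * w)).
  have := ler_coef w K2; clear; rewrite -exprMn => h1 h2.
  have -> : K * (rho * w) = K * w * rho by ring.
  by move: h1 h2; move: (K * w) => Kw; lra.
have k3 : - (12 / 100) * w ^+ 2 <= (- 2 * r + s - 22 / 10) * w ^+ 2.
  by apply: ler_coef; lra.
have k4 : 0 <= (- r - s + 19 / 10) * (2 * (z * rho)) + rho ^+ 2 / 20 + 338 / 10 * z ^+ 2.
  have : (- r - s + 19 / 10) ^+ 2 <= (13 / 10) ^+ 2 by apply: ler_sqr_bound; lra.
  move: (_ - _ + _) => K K2; have := sqr_ge0 (rho + 20 * (K * z)).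
  have := ler_coef z K2; clear; rewrite -exprMn => h1 h2.
  have -> : K * (2 * (z * rho)) = 2 * (K * z * rho) by ring.
  by move: h1 h2; move: (K * z) => Kw; lra.
have k5 : - (13 / 10) * z ^+ 2 <= (- r - s + 19 / 10) * z ^+ 2 by apply: ler_coef; lra.
have k6 : 27 / 10 * A ^+ 2 <= (s - 1 / 10) * A ^+ 2 by apply: ler_coef; lra.
have k7 : 5 * B ^+ 2 <= (r + s + 2 - 1 / 10) * B ^+ 2 by apply: ler_coef; lra.
have k8 : 1 / 4 * (z + w - y) ^+ 2 <= (r - 1 / 10) * (z + w - y) ^+ 2.
  by apply: ler_coef; lra.
have num : (rho ^+ 2 + A ^+ 2 + B ^+ 2 + y ^+ 2) / 1000 - 1000 * z ^+ 2 <=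
   rho ^+ 2 / 10 - 57 / 100 * w ^+ 2 - 351 / 10 * z ^+ 2 + 27 / 10 * A ^+ 2 + 5 * B ^+ 2
   - 1 / 10 * y ^+ 2 + 1 / 4 * (z + w - y) ^+ 2.
  rewrite wE; clear.
  have := sqr_ge0 (298 * y + 500 * (A + B) - 1000 * z).
  have := sqr_ge0 (11 * (A + B) + 100 * z); have := sqr_ge0 (A - 2 * B).
  have := sqr_ge0 A; have := sqr_ge0 B; have := sqr_ge0 z; have := sqr_ge0 rho.
  have := sqr_ge0 y; lra.
apply: le_trans num _; move: k1 k2 k3 k4 k5 k6 k7 k8; clear => *.
lra.
Qed.

Local Notation C := R[i].
Local Notation V := 'M[C]_3.

Definition isotropic_space (W : {vspace V}) :=
  forall X, X \in W -> twist (csum X 0) (csum X 1) (csum X 2) = 0 /\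
    twist (rsum X 0) (rsum X 1) (rsum X 2) = 0.

Lemma Re_add (x y : C) : Re (x + y) = Re x + Re y.
Proof. by case: x y => a b []. Qed.

Lemma Im_add (x y : C) : Im (x + y) = Im x + Im y.
Proof. by case: x y => a b []. Qed.

Lemma Re_scale (a : R) (x : C) : Re (a%:C * x) = a * Re x.
Proof. by case: x => b d /=; ring. Qed.

Lemma Im_scale (a : R) (x : C) : Im (a%:C * x) = a * Im x.
Proof. by case: x => b d /=; ring. Qed.

Lemma had_form (w : 'I_3 -> 'I_3 -> R) (X : V) : ip (had w X) X =
  let q (f : C -> R) :=
    w 0 0 * f (X 0 0) ^+ 2 + w 0 1 * f (X 0 1) ^+ 2 + w 0 2 * f (X 0 2) ^+ 2 +
    (w 1 0 * f (X 1 0) ^+ 2 + w 1 1 * f (X 1 1) ^+ 2 + w 1 2 * f (X 1 2) ^+ 2) +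
    (w 2 0 * f (X 2 0) ^+ 2 + w 2 1 * f (X 2 1) ^+ 2 + w 2 2 * f (X 2 2) ^+ 2) in
  q (@complex.Re R) + q (@complex.Im R).
Proof. by rewrite ip_had_sum !sum3 /ipc /=; ring. Qed.

Lemma nsq_form (X : V) : nsq X =
  let q (f : C -> R) := f (X 0 0) ^+ 2 + f (X 0 1) ^+ 2 + f (X 0 2) ^+ 2 +
    (f (X 1 0) ^+ 2 + f (X 1 1) ^+ 2 + f (X 1 2) ^+ 2) +
    (f (X 2 0) ^+ 2 + f (X 2 1) ^+ 2 + f (X 2 2) ^+ 2) in
  q (@complex.Re R) + q (@complex.Im R).
Proof. by rewrite /nsq ipE !sum3 /ipc /=; ring. Qed.

(** The equations force column sums (c, -c, 0) and row sums (d, -d, 0), which are collinear and have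
    total 0. The positive value r at (1, 2) is outweighed by the one at (0, 2), as these two entries
    are opposite; the value 0 - t at (1, 1) is handled by [negative_form]. *)
Lemma negative_space : exists W : {vspace V}, [/\ (4 <= \dim W)%N, isotropic_space W &
  forall X, X \in W -> total X = 0 /\
    forall r t, r_bounds r -> `|t| <= 1 / 10 ->
    ip (had (fun i j => pot r i j - t) X) X <= - (1 / 100) * nsq X].
Proof.
have [W [dW WX]] := lin_space [:: [:: 0; 0; 0; 0; 0; 0; 1; 0; 0];
  [:: 0; 0; 0; 0; 0; 0; 0; 1; 0]; [:: 0; 0; 0; 0; 0; 0; 0; 0; 1];
  [:: 0; 0; 1; 0; 0; 1; 0; 0; 0]; [:: 1; 1; 0; 1; 1; 0; 0; 0; 0]] (R := R).
have ext X : X \in W -> [/\ X 2 0 = 0, X 2 1 = 0, X 2 2 = 0, X 1 2 = - X 0 2 &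
    X 1 1 = - (X 0 0 + X 0 1 + X 1 0)].
  move=> /WX h.
  have := h 0%N isT; have := h 1%N isT; have := h 2%N isT; have := h 3%N isT.
  have := h 4%N isT.
  rewrite !lin9E /= !(rmorph0, rmorph1, mul0r, mul1r, add0r, addr0).
  move=> h4 h3 h2 h1 h0; split => //.
    by apply/eqP; rewrite -addr_eq0 addrC h3.
  by apply/eqP; rewrite -addr_eq0 addrC -h4 addrA.
exists W; split => //.
- move=> X /ext[x20 x21 x22 x12 x11].
  rewrite /csum /rsum x20 x21 x22 x12 x11 /twist /cross.
  case: (X 0 0) (X 0 1) (X 0 2) (X 1 0) => a b [c d] [e f] [g h] /=; split; ring.
- move=> X /ext[x20 x21 x22 x12 x11]; split.
    by rewrite /total /csum x20 x21 x22 x12 x11; ring.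
  move=> r t [r1 r2 r3 r4 _]; rewrite ler_norml => /andP[t1 t2].
  have r0 : 0 < r - 35 / 100 by lra.
  have nf := @negative_form (- r - r^-1 + 2 - t) (- r^-1 - t) (- r - t) (- t)
    (r - r^-1 - 2 + r - 2 * t).
  have nf1 u v w a : _ := nf u v w a _ _ _ _ _.
  rewrite had_form nsq_form /= x20 x21 x22 x12 x11 /pot !ggE.
  move: (X 0 0) (X 0 1) (X 0 2) (X 1 0) => [a b] [c d] [e f] [g h] /=.
  have := nf a c g e; have := nf b d h f; clear nf.
  move: r^-1 r3 r4 => s r3 r4 => h2 h1.
  rewrite !expr0n /= !mulr0 !addr0.
  have c1 : - r - s + 2 - t <= -1 by lra.
  have c2 : - s - t <= -2 by lra.
  have c3 : - r - t <= - (1 / 4) by lra.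
  have c4 : - t <= 1 / 10 by lra.
  have c5 : r - s - 2 + r - 2 * t <= -3 by lra.
  by move: (h1 c1 c2 c3 c4 c5) (h2 c1 c2 c3 c4 c5); clear; lra.
Qed.

Lemma positive_norm (z rho A B y w : R) : w = z - A - B ->
  (z + rho) ^+ 2 + (3 * rho - w) ^+ 2 + (w - 4 * rho) ^+ 2 + y ^+ 2 + A ^+ 2 + B ^+ 2 +
  (z + w - y) ^+ 2 <= 100 * (rho ^+ 2 + A ^+ 2 + B ^+ 2 + y ^+ 2 + z ^+ 2).
Proof.
have two (a b : R) : (a + b) ^+ 2 <= 2 * a ^+ 2 + 2 * b ^+ 2.
  by have := sqr_ge0 (a - b); lra.
have three (a b d : R) : (a + b + d) ^+ 2 <= 3 * a ^+ 2 + 3 * b ^+ 2 + 3 * d ^+ 2.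
  by have := sqr_ge0 (a - b); have := sqr_ge0 (a - d); have := sqr_ge0 (b - d); lra.
move=> wE; have w2 : w ^+ 2 <= 3 * z ^+ 2 + 3 * A ^+ 2 + 3 * B ^+ 2.
  by have := three z (- A) (- B); rewrite !sqrrN -wE.
have := two z rho; have := two (3 * rho) (- w); have := two w (- (4 * rho)).
have := three z w (- y); rewrite !sqrrN !exprMn.
have := sqr_ge0 rho; have := sqr_ge0 z; have := sqr_ge0 A; have := sqr_ge0 B.
by have := sqr_ge0 y; move: w2; clear; lra.
Qed.

Lemma positive_real (r s t a b c d e f g : R) :
  35 / 100 < r -> r < 36 / 100 -> 28 / 10 < s -> s < 282 / 100 ->
  328 / 10 < 15 * s - 26 * r -> t <= 1 / 10 ->
  7 * a = 5 * (b + c + d) + 2 * (e + f + g) -> 2 * (a + b + e) = c + f + (d + g) ->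
  (a ^+ 2 + b ^+ 2 + c ^+ 2 + d ^+ 2 + e ^+ 2 + f ^+ 2 + g ^+ 2) / 100 / 1000 -
    200 * (a + b + c + d + e + f + g) ^+ 2 <=
  (- r - s + 2 - t) * a ^+ 2 + (- r - t) * b ^+ 2 + (- t) * c ^+ 2 + (r - t) * d ^+ 2 +
  (- r + s - 2 - t) * e ^+ 2 + (s - t) * f ^+ 2 + (r + s + 2 - t) * g ^+ 2.
Proof.
move=> r1 r2 s1 s2 e5 t2 h1 h2.
(* Here z is the first column sum and a third of the total, and the row sums are z + rho, z + 3 rho,
   z - 4 rho; this encodes both linear relations. *)
have [z [rho [w [-> -> -> -> wE]]]] : exists z rho w, [/\ a = z + rho, b = 3 * rho - w,
    d = z + w - c, e = w - 4 * rho & w = z - f - g].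
  pose z := (a + b + c + d + e + f + g) / 3.
  by exists z, (a - z), (z - f - g); rewrite /z; split; lra.
have -> : z + rho + (3 * rho - w) + c + (z + w - c) + (w - 4 * rho) + f + g = 3 * z.
  by rewrite wE; ring.
move: {h1 h2} (positive_form rho c wE r1 r2 s1 s2 e5) (positive_norm rho c wE).
have tN : 0 <= (1 / 10 - t) * ((z + rho) ^+ 2 + (3 * rho - w) ^+ 2 + c ^+ 2 +
    (z + w - c) ^+ 2 + (w - 4 * rho) ^+ 2 + f ^+ 2 + g ^+ 2).
  by rewrite mulr_ge0 ?subr_ge0 // !addr_ge0 ?sqr_ge0.
rewrite exprMn; move: (sqr_ge0 z) tN; clear.
move: ((z + rho) ^+ 2) ((3 * rho - w) ^+ 2) ((z + w - c) ^+ 2) ((w - 4 * rho) ^+ 2).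
move: (rho ^+ 2) (c ^+ 2) (f ^+ 2) (g ^+ 2) (z ^+ 2) => *; lra.
Qed.

(** Both relations have real coefficients of sum 0, by 7 = 5 + 2 and 2 = 1 + 1, which makes row sums
    and column sums collinear. The weights (7, -5, -2) are 45 times the coordinate row of p' in
    [decomposition], so the row sums lie in the span of (1, 1, 1) and p, the direction in which the
    potential is positive. *)
Lemma positive_space : exists W : {vspace V}, [/\ (5 <= \dim W)%N, isotropic_space W &
  forall X, X \in W -> forall r t, r_bounds r -> `|t| <= 1 / 10 ->
    nsq X / 100 / 1000 - 200 * ipc (total X) (total X) <=
    ip (had (fun i j => pot r i j - t) X) X].
Proof.
have [W [dW WX]] := lin_space [:: [:: 0; 1; 0; 0; 0; 0; 0; 0; 0];
  [:: 0; 0; 1; 0; 0; 0; 0; 0; 0]; [:: 7; 7; 7; -5; -5; -5; -2; -2; -2];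
  [:: -2; 1; 1; -2; 1; 1; -2; 1; 1]] (R := R).
have ext X : X \in W -> [/\ X 0 1 = 0, X 0 2 = 0,
    (7%:R : R)%:C * rsum X 0 = (5%:R : R)%:C * rsum X 1 + (2%:R : R)%:C * rsum X 2 &
    (2%:R : R)%:C * csum X 0 = csum X 1 + csum X 2].
  move=> /WX h.
  have := h 0%N isT; have := h 1%N isT; have := h 2%N isT; have := h 3%N isT.
  rewrite !lin9E /= !(rmorph0, rmorph1, mul0r, mul1r, add0r, addr0) !rmorphN /rsum /csum.
  move=> h4 h3 h2 h1; split => //; apply/eqP; rewrite -subr_eq0; apply/eqP.
    by rewrite -h3; ring.
  by rewrite -[RHS]oppr0 -h4; ring.
exists W; split => //.
- move=> X /ext[_ _]; move: (rsum X 0) (rsum X 1) (rsum X 2) (csum X 0) (csum X 1).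
  move=> a b d e f; move: (csum X 2) => g.
  case: a b d e f g => a a' [b b'] [d d'] [e e'] [f f'] [g g'] [p p'] [q q'].
  rewrite /twist /cross /= in p p' q q' *; split.
    have -> : g = 2 * e - f by move: q; clear; lra.
    have -> : g' = 2 * e' - f' by move: q'; clear; lra.
    by ring.
  have -> : a = (5 * b + 2 * d) / 7 by move: p; clear; lra.
  have -> : a' = (5 * b' + 2 * d') / 7 by move: p'; clear; lra.
  by field.
- move=> X /ext[x01 x02 hr hc] r t [r1 r2 r3 r4 r5]; rewrite ler_norml => /andP[t1 t2].
  have key (f : C -> R) : (forall x y, f (x + y) = f x + f y) ->
      (forall (a : R) x, f (a%:C * x) = a * f x) -> _ :=
    fun fD fZ => @positive_real r r^-1 t (f (X 0 0)) (f (X 1 0)) (f (X 1 1)) (f (X 1 2))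
      (f (X 2 0)) (f (X 2 1)) (f (X 2 2)) r1 r2 r3 r4 r5 t2.
  have lin f : (forall x y, f (x + y) = f x + f y) ->
      (forall (a : R) x, f (a%:C * x) = a * f x) ->
      7 * f (X 0 0) = 5 * (f (X 1 0) + f (X 1 1) + f (X 1 2)) +
        2 * (f (X 2 0) + f (X 2 1) + f (X 2 2)) /\
      2 * (f (X 0 0) + f (X 1 0) + f (X 2 0)) =
        f (X 1 1) + f (X 2 1) + (f (X 1 2) + f (X 2 2)).
    move=> fD fZ; have f0 : f 0 = 0 by have := fD 0 0; rewrite addr0; lra.
    have := congr1 f hr; have := congr1 f hc.
    by rewrite /rsum /csum x01 x02 !(fZ, fD) f0 !addr0 !add0r => -> ->.
  have [l1 l2] := lin _ Re_add Re_scale; have [l3 l4] := lin _ Im_add Im_scale.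
  have := key _ Re_add Re_scale l1 l2; have := key _ Im_add Im_scale l3 l4.
  rewrite had_form nsq_form /= x01 x02 /pot !ggE /total /csum x01 x02 /ipc !(Re_add, Im_add).
  move: (X 0 0) (X 1 0) (X 1 1) (X 1 2) (X 2 0) (X 2 1) (X 2 2) r^-1 => [a a'] [b b'].
  move=> [c c'] [d d'] [e e'] [f f'] [g g'] s /=; clear; rewrite !expr0n /=.
  lra.
Qed.

End QuadraticForms.

(** * Triviality of the kernels near energy -1 *)

Section Gap.
Context {R : realType}.
Local Notation C := R[i].
Local Notation V := 'M[C]_3.

Lemma had_scale m n (a : R) (w : 'I_m -> 'I_n -> R) X :
  had (fun i j => a * w i j) X = a%:C *: had w X.
Proof. by apply/matrixP => i j; rewrite !mxE rmorphM mulrA. Qed.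

Lemma ipc_sum3 (a b c : C) :
  ipc (a + b + c) (a + b + c) <= 3 * (ipc a a + ipc b b + ipc c c).
Proof.
case: a b c => a1 a2 [b1 b2] [c1 c2]; rewrite /ipc /= -subr_ge0.
rewrite (_ : _ - _ = (a1 - b1) ^+ 2 + (a1 - c1) ^+ 2 + (b1 - c1) ^+ 2 +
  ((a2 - b2) ^+ 2 + (a2 - c2) ^+ 2 + (b2 - c2) ^+ 2)); last by ring.
by rewrite !addr_ge0 ?sqr_ge0.
Qed.

Lemma ipc3_ge0 (a b c : C) : 0 <= ipc a a + ipc b b + ipc c c.
Proof. by apply: addr_ge0; [apply: addr_ge0|]; exact: ipcc_ge0. Qed.

Lemma csum_le (X : V) :
  ipc (csum X 0) (csum X 0) + ipc (csum X 1) (csum X 1) + ipc (csum X 2) (csum X 2)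
  <= 3 * nsq X.
Proof.
rewrite /nsq ip_cols sum3 2!mulrDr.
by apply: lerD; [apply: lerD|]; exact: ipc_sum3.
Qed.

Lemma rsum_le (X : V) :
  ipc (rsum X 0) (rsum X 0) + ipc (rsum X 1) (rsum X 1) + ipc (rsum X 2) (rsum X 2)
  <= 3 * nsq X.
Proof.
rewrite /nsq ip_rows sum3 2!mulrDr.
by apply: lerD; [apply: lerD|]; exact: ipc_sum3.
Qed.

Lemma JJ_main_le (nu mu : C) (X : V) (k : R) : 0 <= 1 - Re nu -> 1 - Re nu <= k ->
  0 <= 1 - Re mu -> 1 - Re mu <= k -> 0 <= Re nu <= 1 -> 0 <= Re mu <= 1 ->
  total X = 0 -> JJ_main nu mu X <= 6 * k * nsq X.
Proof.
move=> n0 n1 m0 m1 /andP[n2 n3] /andP[m2 m3] tot.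
rewrite /JJ_main tot [ipc 0 0](_ : _ = 0) ?mulr0 ?add0r; last by rewrite /ipc /= !mulr0 addr0.
have c0 : 0 <= ipc (csum X 0) (csum X 0) + ipc (csum X 1) (csum X 1) +
  ipc (csum X 2) (csum X 2) by exact: ipc3_ge0.
have r0 : 0 <= ipc (rsum X 0) (rsum X 0) + ipc (rsum X 1) (rsum X 1) +
  ipc (rsum X 2) (rsum X 2) by exact: ipc3_ge0.
have k0 : 0 <= k by apply: le_trans n1.
apply: (@le_trans _ _ (1 * k * (3 * nsq X) + k * 1 * (3 * nsq X))).
  apply: lerD; apply: ler_pM => //.
  - exact: mulr_ge0.
  - by apply: ler_pM.
  - exact: csum_le.
  - exact: mulr_ge0.
  - by apply: ler_pM.
  - exact: rsum_le.
by rewrite le_eqVlt; apply/orP; left; apply/eqP; ring.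
Qed.

Lemma JJ_main_ge (nu mu : C) (X : V) : 0 <= 1 - Re nu -> 0 <= 1 - Re mu ->
  1 / 2 <= Re nu -> 1 / 2 <= Re mu ->
  1 / 4 * ipc (total X) (total X) <= JJ_main nu mu X.
Proof.
move=> n0 m0 n1 m1; have n2 : 0 <= Re nu by move: n1; lra.
have m2 : 0 <= Re mu by move: m1; lra.
rewrite /JJ_main -addrA; apply: (@le_trans _ _ (Re nu * Re mu * ipc (total X) (total X))).
  apply: ler_wpM2r; first exact: ipcc_ge0.
  by move: n1 m1; clear; move: (Re nu) (Re mu) => x y; nra.
rewrite -[leLHS]addr0; apply: lerD => //; apply: addr_ge0.
  by apply: mulr_ge0 (mulr_ge0 _ _) (ipc3_ge0 _ _ _).
by apply: mulr_ge0 (mulr_ge0 _ _) (ipc3_ge0 _ _ _).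
Qed.

(** On either subspace the unperturbed form is [JJ_main] up to O(K^2 lam^2) |X|^2, against a
    potential term of order lam. On the negative one [JJ_main] is itself of that small size because
    the total vanishes; on the positive one the loss 200 lam |total|^2 is covered by the quarter of
    |total|^2 contained in [JJ_main]. *)
Lemma region3a (K : R) : 0 < K -> exists2 lam1 : R, 0 < lam1 &
  forall (r t lam : R) (nu mu : C) (X : V),
  r_bounds r -> `|t| <= 1 / 10 -> 0 < lam -> lam <= lam1 ->
  unitc nu -> 1 / 2 <= Re nu -> unitc mu -> 1 / 2 <= Re mu ->
  Im nu ^+ 2 <= K ^+ 2 * lam ^+ 2 -> Im mu ^+ 2 <= K ^+ 2 * lam ^+ 2 ->
  op nu mu (fun i j => lam * (pot r i j - t)) X = 0 -> X = 0.
Proof.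
move=> K0; have [W1 [d1 i1 h1]] := @negative_space R.
have [W2 [d2 i2 h2]] := @positive_space R.
(* This makes lam * 1000 <= 1, lam * K <= 1 and 30 K^2 lam <= 10^-5, where 30 exceeds the sum of the
   error constants 20 and 6. *)
pose d := 1000 + K + 100 * (1000 * (30 * K ^+ 2)).
have K2 : 0 <= K ^+ 2 by exact: sqr_ge0.
have d0 : 0 < d by rewrite /d; move: (K ^+ 2) K0 K2; clear => *; lra.
exists d^-1; first by rewrite invr_gt0.
move=> r t lam nu mu X rb t1 l0 l1 unu cnu umu cmu nuK muK.
have ld : lam * d <= 1 by rewrite -ler_pdivlMr ?div1r.
have KK : 0 <= lam * K ^+ 2 by rewrite mulr_ge0 // ltW.
have lK : 0 <= lam * K by rewrite mulr_ge0 // ltW.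
have [a1 a2 a3] : [/\ lam * 1000 <= 1, lam * K <= 1 & 100 * (1000 * (30 * (lam * K ^+ 2))) <= 1].
  have : lam * d = lam * 1000 + lam * K + 100 * (1000 * (30 * (lam * K ^+ 2))).
    by rewrite /d; move: (K ^+ 2); clear => *; ring.
  move: (lam * d) ld => ?.
  by move: (lam * K ^+ 2) (lam * K) KK lK l0; clear; split; lra.
have kap : 0 <= lam * K <= 1 by rewrite lK.
have nuK' : Im nu ^+ 2 <= (lam * K) ^+ 2 by rewrite exprMn mulrC.
have muK' : Im mu ^+ 2 <= (lam * K) ^+ 2 by rewrite exprMn mulrC.
have small (z : C) : unitc z -> 1 / 2 <= Re z -> Im z ^+ 2 <= (lam * K) ^+ 2 ->
    [/\ 0 <= 1 - Re z, 1 - Re z <= (lam * K) ^+ 2 & 0 <= Re z <= 1].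
  move=> /eqP; rewrite /ipc -!expr2; clear; move: (Re z) (Im z) ((lam * K) ^+ 2).
  by move=> c s q e1 e2 e3; split; last (apply/andP; split); nra.
have [n0 n1 /andP[n2 n3]] := small nu unu cnu nuK'.
have [m0 m1 /andP[m2 m3]] := small mu umu cmu muK'.
have form Y : ip (op nu mu (fun i j => lam * (pot r i j - t)) Y) Y =
    ip (J nu *m Y *m J mu) Y + lam * ip (had (fun i j => pot r i j - t) Y) Y.
  by rewrite /op had_scale ipDl ipRl.
have kk : (lam * K) ^+ 2 = lam * (lam * K ^+ 2) by rewrite exprMn; ring.
have aux Y : 0 < nsq Y ->
    100 * (1000 * (30 * (lam * K ^+ 2 * (lam * nsq Y)))) <= lam * nsq Y.
  move=> /(mulr_gt0 l0)/ltW; move: (lam * nsq Y) (lam * K ^+ 2) a3; clear=> y x h1 h2.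
  rewrite (_ : 100 * (1000 * (30 * (x * y))) = 100 * (1000 * (30 * x)) * y); last by ring.
  by rewrite -[leRHS]mul1r; apply: ler_wpM2r.
apply: (kernel_trivial (@op_selfadj _ _ _ _) (@op_linear _ _ _ _) (leq_add d1 d2)).
- move=> Y YW; rewrite -nsq_gt0 form => Y0.
  have [tc tr] := i1 Y YW; have [tot hq] := h1 Y YW.
  have := JJ_bound unu umu cnu cmu kap nuK' muK' tc tr; rewrite ler_norml => /andP[_ hJ].
  have hM : JJ_main nu mu Y <= 6 * (lam * K) ^+ 2 * nsq Y.
    by apply: JJ_main_le => //; apply/andP.
  have := hq r t rb t1; rewrite -(ler_pM2l l0).
  have aN : 100 * (1000 * (30 * (lam * K ^+ 2 * (lam * nsq Y)))) <= lam * nsq Y.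
    exact: aux.
  have := mulr_gt0 l0 Y0; move: aN hJ hM; rewrite kk.
  rewrite (_ : 6 * _ * nsq Y = 6 * (lam * K ^+ 2 * (lam * nsq Y))); last by ring.
  rewrite (_ : 20 * _ * nsq Y = 20 * (lam * K ^+ 2 * (lam * nsq Y))); last by ring.
  rewrite (_ : lam * (- (1 / 100) * nsq Y) = - (1 / 100) * (lam * nsq Y)); last by ring.
  move: (lam * K ^+ 2 * (lam * nsq Y)) (lam * nsq Y) (lam * ip _ Y) (ip _ Y) (JJ_main _ _ _).
  by clear => *; lra.
- move=> Y YW; rewrite -nsq_gt0 form => Y0.
  have [tc tr] := i2 Y YW; have hq := h2 Y YW r t rb t1.
  have := JJ_bound unu umu cnu cmu kap nuK' muK' tc tr; rewrite ler_norml => /andP[hJ _].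
  have hM : 1 / 4 * ipc (total Y) (total Y) <= JJ_main nu mu Y.
    exact: JJ_main_ge.
  rewrite -(ler_pM2l l0) in hq.
  have aN : 100 * (1000 * (30 * (lam * K ^+ 2 * (lam * nsq Y)))) <= lam * nsq Y.
    exact: aux.
  have tS : lam * 1000 * ipc (total Y) (total Y) <= 1 * ipc (total Y) (total Y).
    by rewrite ler_wpM2r ?ipcc_ge0.
  have := mulr_gt0 l0 Y0; move: aN hJ hM hq tS (ipcc_ge0 (total Y)); rewrite kk.
  rewrite (_ : 20 * _ * nsq Y = 20 * (lam * K ^+ 2 * (lam * nsq Y))); last by ring.
  rewrite (_ : lam * (_ - _) = lam * nsq Y / 100 / 1000 -
    200 * (lam * ipc (total Y) (total Y))); last by field.
  rewrite (_ : lam * 1000 * _ = 1000 * (lam * ipc (total Y) (total Y))); last by ring.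
  move: (lam * K ^+ 2 * (lam * nsq Y)) (lam * nsq Y) (lam * ip _ Y) (ip _ Y) (JJ_main _ _ _).
  move: (lam * ipc (total Y) (total Y)); move: (ipc (total Y) (total Y)).
  by clear => *; lra.
Qed.

(* Four regimes of the quasi-momenta, by the sizes of [Im nu] and [Im mu] relative to
   [lam]; when both are of order one, [J nu *m _ *m J mu] alone dominates. *)
Lemma gap_kernel : exists2 lam0 : R, 0 < lam0 &
  forall (r t lam : R) (nu mu : C) (X : V),
  r_bounds r -> `|t| <= 1 / 10 -> 0 < lam -> lam <= lam0 ->
  unitc nu -> 1 / 2 <= Re nu -> unitc mu -> 1 / 2 <= Re mu ->
  op nu mu (fun i j => lam * (pot r i j - t)) X = 0 -> X = 0.
Proof.
pose e : R := (2000 * 104)^-1; have e0 : 0 < e by rewrite invr_gt0 mulr_gt0.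
have e1 : 2000 * (104 * e) <= 1 by rewrite mulrA divff // gt_eqF // mulr_gt0.
(* Then k e >= 8, hence k^4 e^2 >= 64 > 49, which settles the regime where both momenta exceed their
   thresholds, 7 being a bound for |Q - t|. *)
pose k : R := 100 + 8 / e.
have e8 : 0 < 8 / e by rewrite divr_gt0.
have k100 : 100 <= k by rewrite /k lerDl ltW.
have k0 : 0 < k by apply: lt_le_trans k100.
have ke : 8 <= k * e by rewrite /k mulrDl divfK ?gt_eqF // lerDr mulr_ge0 // ltW.
have kk0 : 0 < k ^+ 2 by rewrite exprn_gt0.
have [K2 [lam1 [K20 lam10 reg3b]]] := region3b kk0.
have [lam2 lam20 reg3a] := region3a (addr_gt0 kk0 K20).
exists (Num.min lam1 lam2); first by rewrite lt_min lam10 lam20.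
move=> r t lam nu mu X rb t1 l0; rewrite le_min => /andP[l1 l2] unu cnu umu cmu eqX.
have eqX' : J nu *m X *m J mu + lam%:C *: had (fun i j => pot r i j - t) X = 0.
  by rewrite -had_scale.
case: (lerP ((k ^+ 2) ^+ 2 * lam ^+ 2) (Im mu ^+ 2)) => muK; last first.
  case: (lerP (K2 ^+ 2 * lam ^+ 2) (Im nu ^+ 2)) => nuK.
    by apply: (reg3b r t lam nu mu X) => //; apply: ltW.
  have big a : 0 < a -> a <= k ^+ 2 + K2 -> a ^+ 2 * lam ^+ 2 <= (k ^+ 2 + K2) ^+ 2 * lam ^+ 2.
    move=> a0 ak; rewrite ler_pM2r ?exprn_gt0 // ler_sqr ?nnegrE ?(ltW a0) //.
    by apply: le_trans ak; apply: ltW.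
  apply: (reg3a r t lam nu mu X) => //.
    by apply: le_trans (ltW nuK) _; apply: big => //; rewrite lerDr ltW.
  by apply: le_trans (ltW muK) _; apply: big => //; rewrite lerDl ltW.
case: (lerP (Im nu ^+ 2) (e ^+ 2)) => nue.
  exact: (region2 rb t1 l0 unu cnu umu cmu e0 e1 nue k100 muK eqX').
apply/eqP; rewrite -nsq_eq0 eq_le nsq_ge0 andbT.
have t1' : `|t| <= 1 by move: t1; clear => ?; lra.
have HN : nsq (had (fun i j => pot r i j - t) X) <= 49 * nsq X.
  by apply: nsq_had => i j; exact: pot_le6 rb t1'.
have JX : nsq (J nu *m X *m J mu) <= lam ^+ 2 * (49 * nsq X).
  have -> : J nu *m X *m J mu = (- lam)%:C *: had (fun i j => pot r i j - t) X.
    by apply/eqP; rewrite rmorphN scaleNr -subr_eq0 opprK eqX'.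
  by rewrite nsqR sqrrN ler_wpM2l ?sqr_ge0.
have h1 := nsq_Jr_ge (J nu *m X) umu cmu; have h2 := nsq_J_ge X unu cnu.
have h3 : (k ^+ 2) ^+ 2 * lam ^+ 2 * (e ^+ 2 * nsq X) <= lam ^+ 2 * (49 * nsq X).
  apply: le_trans JX; apply: le_trans h1; apply: ler_pM => //.
  - by rewrite mulr_ge0 ?sqr_ge0.
  - by rewrite mulr_ge0 ?sqr_ge0 ?nsq_ge0.
  - by apply: le_trans h2; rewrite ler_wpM2r ?nsq_ge0 // ltW.
have h4 : 64 * nsq X <= 49 * nsq X.
  rewrite -(ler_pM2l (exprn_gt0 2 l0)); apply: le_trans h3.
  rewrite (_ : _ * _ * (_ * nsq X) = lam ^+ 2 * (k ^+ 2 * (k * e) ^+ 2 * nsq X)); last by ring.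
  rewrite ler_pM2l ?exprn_gt0 // ler_wpM2r ?nsq_ge0 //.
  rewrite (_ : 64 = 1 * (8 ^+ 2)); last by ring.
  have k1 : 1 <= k by move: k100; clear; lra.
  have ke8 : 8 ^+ 2 <= (k * e) ^+ 2.
    by apply: lerXn2r => //; rewrite nnegrE // (le_trans _ ke).
  apply: ler_pM => //; first exact: sqr_ge0.
  by apply: exprn_ege1.
by move: h4; move: (nsq X); clear => *; lra.
Qed.

End Gap.

(** * Inertia *)

From mathcomp Require Import spectral sesquilinear zify.

Section Spectral.
Context {R : realType}.
Local Notation C := R[i].
Local Notation V := 'M[C]_3.

Lemma ip_mxvec m n (A B : 'M[C]_(m, n)) : ip (mxvec A) (mxvec B) = ip A B.
Proof.
rewrite !ipE big_ord1 pair_bigA /= (reindex _ (curry_mxvec_bij m n)) /=.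
by apply: eq_bigr => -[i j] _; rewrite !mxvecE.
Qed.

Lemma ip_row_adj n p (u : 'rV[C]_n) (P : 'M[C]_(n, p)) (v : 'rV[C]_p) :
  ip (u *m P) v = ip u (v *m (map_mx (@Num.conj C) P^T)).
Proof.
rewrite -ip_tr -[RHS]ip_tr !trmx_mul ip_adj; congr (ip _ (_ *m _)).
by apply/matrixP => i j; rewrite !mxE.
Qed.

Lemma ip_delta m n (A : 'M[C]_(m, n)) i j :
  (ip A (delta_mx i j) = Re (A i j)) * (ip A ('i *: delta_mx i j) = Im (A i j)).
Proof.
split; rewrite ipE (bigD1 i) //= (bigD1 j) //= big1 ?big1 ?addr0.
- by rewrite mxE !eqxx /ipc /= mulr1 mulr0 addr0.
- by move=> k ki; rewrite big1 // => l _; rewrite mxE (negPf ki) /ipc /= !mulr0 addr0.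
- by move=> l lj; rewrite mxE (negPf lj) andbF /ipc /= !mulr0 addr0.
- rewrite !mxE !eqxx /ipc /=; ring.
- move=> k ki; rewrite big1 // => l _; rewrite !mxE (negPf ki) /ipc /=; ring.
- move=> l lj; rewrite !mxE (negPf lj) andbF /ipc /=; ring.
Qed.

(** Testing on basis vectors gives the real parts of the entries; multiplying one of the two by ['i]
    gives the imaginary parts. *)
Lemma selfadj_hermitian n (A : 'M[C]_n) :
  (forall u v : 'rV[C]_n, ip (u *m A) v = ip u (v *m A)) -> A \is hermsymmx.
Proof.
move=> As; apply/is_hermitianmxP; rewrite expr0 scale1r; apply/matrixP => k l.
apply/eqP; rewrite eq_complex !mxE /=; apply/andP; split; apply/eqP.
  have := As (delta_mx 0 k) (delta_mx 0 l); rewrite -!rowE [RHS]ipC !ip_delta !mxE => ->.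
  by case: (A l k).
have := As (delta_mx 0 k) ('i *: delta_mx 0 l).
rewrite -scalemxAl -!rowE ip_delta ipC ipZl conjCi.
by rewrite scaleNr ipNr ip_delta !mxE => ->; case: (A l k).
Qed.

(** Blocks are flattened to row vectors of length 9, where the spectral theorem for Hermitian
    matrices gives a unitary change of coordinates. *)
Lemma spectral_coords (f : V -> V) : selfadj f -> clinear f ->
  (forall X, f X = 0 -> X = 0) ->
  exists (d : 'I_(3 * 3) -> R) (phi : {linear V -> 'rV[C]_(3 * 3)}),
  [/\ forall k, d k != 0, forall X k, phi (f X) 0 k = (d k)%:C * phi X 0 k,
      forall X, nsq X = \sum_k ipc (phi X 0 k) (phi X 0 k) &
      forall X, ip (f X) X = \sum_k d k * ipc (phi X 0 k) (phi X 0 k)].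
Proof.
move=> fs fl fker.
pose Phi0 := GRing.isLinear.Build _ _ _ _ f fl.
pose F : {linear V -> V} := HB.pack f Phi0.
pose A := lin_mx F.
have As (u v : 'rV_(3 * 3)) : ip (u *m A) v = ip u (v *m A).
  rewrite -[v in LHS](@vec_mxK _ 3 3) -[u in RHS](@vec_mxK _ 3 3) !mul_rV_lin !ip_mxvec.
  exact: fs.
have Aherm := selfadj_hermitian As.
have /orthomx_spectralP Aeq := hermitian_normalmx Aherm.
set P := spectralmx A in Aeq; set d := spectral_diag A in Aeq.
have Pu : P \is unitarymx := spectral_unitarymx A.
have Punit := unitarymx_unit Pu.
have dreal k : d 0 k = (Re (d 0 k))%:C.
  have /mxOverP /(_ 0 k) := hermitian_spectral_diag_real Aherm.
  by case/complex_realP => x ->.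
pose psi (X : V) : 'rV[C]_(3 * 3) := mxvec X *m invmx P.
have psil : linear psi.
  by move=> a X Y; rewrite /psi linearP mulmxDl -scalemxAl.
pose Psi0 := GRing.isLinear.Build _ _ _ _ psi psil.
pose Psi : {linear V -> 'rV[C]_(3 * 3)} := HB.pack psi Psi0.
have vecE X : mxvec X = psi X *m P by rewrite /psi mulmxKV.
exists (fun k => Re (d 0 k)), Psi; split.
- move=> k; apply/negP => /eqP dk.
  have : vec_mx (delta_mx 0 k *m P) = 0 :> V.
    apply: fker; rewrite -[f _](mx_rV_lin F) -/A Aeq !mulmxA mulmxK //.
    rewrite -rowE row_diag_mx dreal dk scale0r mul0mx; exact: linear0.
  move/(congr1 mxvec); rewrite vec_mxK linear0 => /(congr1 (mulmx^~ (invmx P))).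
  rewrite mulmxK // mul0mx => /matrixP /(_ 0 k) /eqP; rewrite !mxE !eqxx.
  by rewrite oner_eq0.
- move=> X k; rewrite /= {1}/psi -[mxvec (f X)](mul_vec_lin F) -/A Aeq !mulmxA mulmxK //.
  by rewrite -/(psi X) mul_mx_diag mxE dreal mulrC.
- move=> X; rewrite /nsq -ip_mxvec vecE ip_row_adj -mulmxA (unitarymxP Pu) mulmx1.
  by rewrite ipE big_ord1.
move=> X; rewrite -ip_mxvec -[mxvec (f X)](mul_vec_lin F) -/A Aeq !mulmxA -/(psi X).
rewrite vecE ip_row_adj -mulmxA (unitarymxP Pu) mulmx1 ipE big_ord1.
by apply: eq_bigr => k _; rewrite mul_mx_diag mxE dreal mulrC ipcRl.
Qed.

Lemma coord_space (phi : {linear V -> 'rV[C]_(3 * 3)}) (K : {pred 'I_(3 * 3)}) :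
  exists W : {vspace V}, (#|K| <= \dim W)%N /\
    forall X, X \in W -> forall k, k \notin K -> phi X 0 k = 0.
Proof.
pose psi (X : V) : 'rV[C]_(#|[predC K]|) := \row_j phi X 0 (enum_val j).
have psil : linear psi by move=> a X Y; apply/rowP => j; rewrite !mxE linearP !mxE.
pose Psi0 := GRing.isLinear.Build _ _ _ _ psi psil.
pose Psi : {linear V -> 'rV[C]_(#|[predC K]|)} := HB.pack psi Psi0.
exists (lker (linfun Psi)); split.
  by apply: leq_trans (ker_dim Psi); rewrite -(_ : #|K| + #|[predC K]| = 9)%N ?addnK // cardC card_ord.
move=> X; rewrite memv_ker lfunE /= => /eqP /rowP h k kK.
have kK' : k \in [predC K] by [].
by have := h (enum_rank_in kK' k); rewrite !mxE enum_rankK_in.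
Qed.

(** The inverse of 1 plus the sum of the 1 / |d k| replaces a minimum and makes sense for n = 0 as
    well. *)
Lemma uniform_gap n (d : 'I_n -> R) : (forall k, d k != 0) ->
  exists2 c, 0 < c & forall k, c <= `|d k|.
Proof.
move=> d0; have s0 : 0 <= \sum_k `|d k|^-1 by apply: sumr_ge0 => k _; rewrite invr_ge0.
exists (1 + \sum_k `|d k|^-1)^-1; first by rewrite invr_gt0 ltr_pwDl.
move=> k; rewrite -[leRHS]invrK lef_pV2 ?posrE ?invr_gt0 ?normr_gt0 ?ltr_pwDl //.
rewrite (bigD1 k) //= addrCA lerDl addr_ge0 // sumr_ge0 // => j _.
by rewrite invr_ge0.
Qed.

(* The margin [c] makes the notion stable under small perturbations of [f]. *)
Definition inertia (k : nat) (f : V -> V) := exists U W : {vspace V}, exists c : R,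
  [/\ (k <= \dim U)%N, (9 - k <= \dim W)%N, 0 < c,
      forall X, X \in U -> ip (f X) X <= - c * nsq X &
      forall X, X \in W -> c * nsq X <= ip (f X) X].

Lemma inertia_exists (f : V -> V) : selfadj f -> clinear f ->
  (forall X, f X = 0 -> X = 0) -> exists2 k, (k <= 9)%N & inertia k f.
Proof.
move=> fs fl fker; have [d [phi [d0 _ nE fE]]] := spectral_coords fs fl fker.
have [c c0 cd] := uniform_gap d0; pose K := [pred k | d k < 0].
have [U [dU hU]] := coord_space phi K; have [W [dW hW]] := coord_space phi [predC K].
have KC := cardC K; rewrite card_ord in KC.
exists #|K|; first by rewrite -[9%N]KC leq_addr.
exists U, W, c; split => // [|X XU|X XW].
- by apply: leq_trans dW; rewrite -[9%N]KC addKn.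
- rewrite nE fE mulr_sumr; apply: ler_sum => k _.
  have [kK|kK] := boolP (k \in K); last by rewrite (hU X XU k kK) /ipc /= !mulr0 addr0 !mulr0.
  rewrite ler_wpM2r ?ipcc_ge0 // lerNr -[leRHS]ltr0_norm //; exact: cd.
rewrite nE fE mulr_sumr; apply: ler_sum => k _.
have [kK|kK] := boolP (k \in [predC K]); last by rewrite (hW X XW k kK) /ipc /= !mulr0 addr0 !mulr0.
rewrite ler_wpM2r ?ipcc_ge0 // -[leRHS]ger0_norm; first exact: cd.
by move: kK; rewrite !inE -leNgt.
Qed.

(** A subspace on which f is negative meets the W of the inertia only in 0, and W has dimension at
    least 9 - k. *)
Lemma inertia_neg_le k j (f : V -> V) (U : {vspace V}) : inertia k f -> (k <= 9)%N ->
  (j <= \dim U)%N -> (forall X, X \in U -> X != 0 -> ip (f X) X < 0) -> (j <= k)%N.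
Proof.
move=> [_ [W [c [_ dW c0 _ hW]]]] k9 dU hU; rewrite leqNgt; apply/negP => kj.
have [|X [X0 XU XW]] := @cap_nontrivial _ U W.
  by apply: leq_trans (leq_add dU dW); move: kj k9; clear; lia.
have := hU X XU X0; rewrite ltNge => /negP; apply; apply: le_trans (hW X XW).
by rewrite mulr_ge0 ?nsq_ge0 // ltW.
Qed.

Lemma inertia_pos_le k j (f : V -> V) (W : {vspace V}) : inertia k f -> (k <= 9)%N ->
  (9 - j <= \dim W)%N -> (forall X, X \in W -> X != 0 -> 0 < ip (f X) X) -> (k <= j)%N.
Proof.
move=> [U [_ [c [dU _ c0 hU _]]]] k9 dW hW; rewrite leqNgt; apply/negP => jk.
have [|X [X0 XU XW]] := @cap_nontrivial _ U W.
  by apply: leq_trans (leq_add dU dW); move: jk k9; clear; lia.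
have := hW X XW X0; rewrite ltNge => /negP; apply; apply: le_trans (hU X XU) _.
by rewrite mulNr oppr_le0 mulr_ge0 ?nsq_ge0 // ltW.
Qed.

Lemma inertia_uniq j k (f : V -> V) : (j <= 9)%N -> (k <= 9)%N ->
  inertia j f -> inertia k f -> j = k.
Proof.
have le a b : (a <= 9)%N -> (b <= 9)%N -> inertia a f -> inertia b f -> (a <= b)%N.
  move=> a9 b9 [U [_ [c [dU _ c0 hU _]]]] ib; apply: (inertia_neg_le ib b9 dU) => X XU X0.
  apply: le_lt_trans (hU X XU) _.
  by rewrite mulNr oppr_lt0 mulr_gt0 // nsq_gt0.
by move=> j9 k9 ij ik; apply/eqP; rewrite eqn_leq; apply/andP; split; apply: le.
Qed.

Lemma inertia_open k (f : V -> V) :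
  inertia k f -> exists2 e, 0 < e & forall g : V -> V,
  (forall X, `|ip (g X) X - ip (f X) X| <= e * nsq X) -> inertia k g.
Proof.
move=> [U [W [c [dU dW cp hU hW]]]]; exists (c / 2); first by rewrite divr_gt0.
move=> h hh; exists U, W, (c / 2); split => // [|X XU|X XW]; first by rewrite divr_gt0.
  have := hh X; have := hU X XU; rewrite ler_norml => a /andP[_].
  rewrite lerBlDr => /le_trans; apply; rewrite mulNr; move: a; rewrite mulNr.
  by rewrite (_ : c / 2 * nsq X = c * nsq X / 2); [move: (c * _); clear => *; lra|ring].
have := hh X; have := hW X XW; rewrite ler_norml => a /andP[].
rewrite lerBrDr => b _; apply: le_trans b.
by rewrite (_ : c / 2 * nsq X = c * nsq X / 2); [move: a; move: (c * _); clear => *; lra|ring].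
Qed.

(** An eigenvector X for b > a lies outside the space U on which f - a is negative, since f - a is
    positive at X. On U + <X> the form of f - b is nonpositive: f - b kills X, and self-adjointness
    removes the cross terms. So more than k eigenvalues lie below any e > b. *)
Lemma inertia_eigen k (f : V -> V) (a b : R) X : selfadj f -> clinear f ->
  a < b -> X != 0 -> f X = b%:C *: X -> inertia k (fun Y => f Y - a%:C *: Y) ->
  exists U : {vspace V}, (k < \dim U)%N /\
    forall Y e, Y \in U -> Y != 0 -> b < e -> ip (f Y - e%:C *: Y) Y < 0.
Proof.
move=> fs fl ab X0 fX [U [_ [c [dU _ c0 hU _]]]].
have shiftE e Y : ip (f Y - e%:C *: Y) Y = ip (f Y) Y - e * nsq Y.
  by rewrite ipDl ipNl ipRl.
have XU : X \notin U.
  apply/negP => /hU; rewrite shiftE fX ipRl -/(nsq X) -mulrBl ler_pM2r ?nsq_gt0 //.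
  by rewrite leNgt (lt_trans _ (_ : 0 < b - a)) ?subr_gt0 // oppr_lt0.
exists (U + <[X]>)%VS; split.
  rewrite dimv_disjoint_sum ?dim_vline ?X0 ?addn1 //.
  apply/eqP; rewrite -subv0; apply/subvP => Y; rewrite memv_cap => /andP[YU /vlineP[t Yt]].
  rewrite memv0; apply: contraT => Y0; case/negP: XU.
  have t0 : t != 0 by apply: contraNneq Y0 => t0; rewrite Yt t0 scale0r.
  by rewrite -[X](scalerK t0) -Yt memvZ.
move=> Y e /memv_addP[Z ZU [_ /vlineP[t ->] Ye]] Y0 be.
have : ip (f Y) Y <= b * nsq Y.
  rewrite -subr_le0 -shiftE.
  have gY : f Y - b%:C *: Y = f Z - b%:C *: Z.
    by rewrite Ye [Z + _]addrC fl fX scalerDr !scalerA [t * _]mulrC opprD addrACA subrr add0r.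
  rewrite gY Ye ipDr shiftE.
  have -> : ip (f Z - b%:C *: Z) (t *: X) = 0.
    by rewrite ipDl ipNl fs (clinearZ _ _ fl) fX ipRl scalerA mulrC -scalerA ipRr subrr.
  have := hU Z ZU; rewrite shiftE addr0 => h; rewrite subr_le0.
  have n0 := nsq_ge0 Z; have ab' := ltW ab.
  have : a * nsq Z <= b * nsq Z by rewrite ler_wpM2r.
  have : 0 <= c * nsq Z by rewrite mulr_ge0 // ltW.
  by move: h; rewrite mulNr; move: (c * _) (a * _) (b * _) (ip _ _); clear => *; lra.
move=> hb; rewrite shiftE subr_lt0; apply: le_lt_trans hb _.
by rewrite ltr_pM2r ?nsq_gt0.
Qed.

Lemma kernel_lower_bound (f : V -> V) : selfadj f -> clinear f ->
  (forall X, f X = 0 -> X = 0) -> exists2 c, 0 < c & forall X, c * nsq X <= nsq (f X).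
Proof.
move=> fs fl fker; have [d [phi [d0 dE nE _]]] := spectral_coords fs fl fker.
have [c c0 cd] := uniform_gap d0; exists (c ^+ 2); first exact: exprn_gt0.
move=> X; rewrite !nE mulr_sumr; apply: ler_sum => k _.
rewrite dE ipcM ler_wpM2r ?ipcc_ge0 // /ipc /= mulr0 addr0 -expr2 -[leRHS]real_normK ?num_real //.
by rewrite ler_sqr ?nnegrE // ltW.
Qed.

End Spectral.

(** * Trial subspaces at the momenta 0 and pi *)

Section TestSpaces.
Context {R : realType}.
Local Notation C := R[i].
Local Notation V := 'M[C]_3.
Implicit Types (X : V) (r lam s : R).

Definition bloch r lam (nu mu : C) : V -> V := op nu mu (fun i j => lam * pot r i j).

Definition shifted r lam (nu mu : C) s X := bloch r lam nu mu X - s%:C *: X.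

Lemma bloch_form r lam nu mu s X : ip (shifted r lam nu mu s X) X =
  ip (J nu *m X *m J mu) X + lam * ip (had (pot r) X) X - s * nsq X.
Proof. by rewrite /shifted /bloch /op had_scale !ipDl ipNl !ipRl. Qed.

Definition csq X := ipc (csum X 0) (csum X 0) + ipc (csum X 1) (csum X 1) +
  ipc (csum X 2) (csum X 2).
Definition rsq X := ipc (rsum X 0) (rsum X 0) + ipc (rsum X 1) (rsum X 1) +
  ipc (rsum X 2) (rsum X 2).
Definition tsq X := ipc (total X) (total X).

(** For a real twist c, [J c] is (1 - c) + c E with E the all-ones matrix. The momenta 0 and pi are
    c = 1 and c = -1; in the second case this is 2 - E, with eigenvalues -1, 2, 2. *)
Lemma JJ_real (c d : R) X : ip (J c%:C *m X *m J d%:C) X =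
  c * d * tsq X + c * (1 - d) * csq X + (1 - c) * d * rsq X + (1 - c) * (1 - d) * nsq X.
Proof.
have eE : ip (const_mx 1 *m X) X = csq X.
  by rewrite ip_cols sum3 !E_mulE /csq /csum -!ipcDr.
have Ee : ip (X *m const_mx 1) X = rsq X.
  by rewrite ip_rows sum3 !mul_EE /rsq /rsum -!ipcDr.
have EE : ip (const_mx 1 *m X *m const_mx 1) X = tsq X.
  by rewrite ip_cols sum3 !mul_EE !E_mulE /tsq /total /csum -!ipcDr.
rewrite ip_mulJ -!mulmxA !ip_Jmul !mulmxA eE Ee EE -/(nsq X) /= !mul0r !addr0.
by move: (csq X) (rsq X) (tsq X) (nsq X); clear => *; ring.
Qed.

Lemma pot_form_le r X : r_bounds r -> `|ip (had (pot r) X) X| <= 7 * nsq X.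
Proof.
move=> rb; rewrite ip_had_sum /nsq ipE mulr_sumr.
apply: le_trans (ler_norm_sum _ _ _) _; apply: ler_sum => i _; rewrite mulr_sumr.
apply: le_trans (ler_norm_sum _ _ _) _; apply: ler_sum => j _.
rewrite normrM (ger0_norm (ipcc_ge0 _)) ler_wpM2r ?ipcc_ge0 //.
have := @pot_le6 R r 0 i j rb; rewrite normr0 subr0 => /(_ ler01).
by move: (pot r i j) => p; rewrite ler_norml; clear => h; apply/andP; split; nra.
Qed.

Lemma lam_pot r lam X : r_bounds r -> 0 < lam ->
  - (7 * lam * nsq X) <= lam * ip (had (pot r) X) X <= 7 * lam * nsq X.
Proof.
move=> rb l0; have := pot_form_le X rb; rewrite ler_norml -(ler_pM2l l0) => /andP[h1].
by rewrite -(ler_pM2l l0) => h2; apply/andP; split; [apply: le_trans h1|apply: le_trans h2 _];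
  rewrite le_eqVlt; apply/orP; left; apply/eqP; ring.
Qed.

Lemma csq_ge0 X : 0 <= csq X. Proof. exact: ipc3_ge0. Qed.
Lemma rsq_ge0 X : 0 <= rsq X. Proof. exact: ipc3_ge0. Qed.
Lemma tsq_ge0 X : 0 <= tsq X. Proof. exact: ipcc_ge0. Qed.

Lemma total_rsum X : total X = rsum X 0 + rsum X 1 + rsum X 2.
Proof. by rewrite /total /csum /rsum; ring. Qed.

Lemma tsq_csq X : tsq X <= 3 * csq X.
Proof. exact: ipc_sum3. Qed.

Lemma tsq_rsq X : tsq X <= 3 * rsq X.
Proof. by rewrite /tsq total_rsum; exact: ipc_sum3. Qed.

Definition neg_space k (f : V -> V) := exists U : {vspace V},
  (k <= \dim U)%N /\ forall X, X \in U -> X != 0 -> ip (f X) X < 0.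
Definition pos_space k (f : V -> V) := exists U : {vspace V},
  (k <= \dim U)%N /\ forall X, X \in U -> X != 0 -> 0 < ip (f X) X.

Lemma pos9_00 r lam s : r_bounds r -> 0 < lam -> s < - (7 * lam) ->
  pos_space 9 (shifted r lam 1 1 s).
Proof.
move=> rb l0 sl; exists fullv; split=> [|X _ X0]; first by rewrite dim_M3.
rewrite bloch_form (JJ_real 1 1) subrr !mulr0 !mul0r !addr0 !mul1r.
have := lam_pot X rb l0 => /andP[h _]; have := tsq_ge0 X.
rewrite -nsq_gt0 in X0; have : s * nsq X < - (7 * lam) * nsq X by rewrite ltr_pM2r.
by move: h; rewrite mulNr; move: (tsq X) (_ * ip _ _) (s * _) (7 * lam * _); clear => *; lra.
Qed.

Lemma neg8_00 r lam s : r_bounds r -> 0 < lam -> 7 * lam < s ->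
  neg_space 8 (shifted r lam 1 1 s).
Proof.
move=> rb l0 sl; have [W [dW WX]] := lin_space [:: [:: 1; 1; 1; 1; 1; 1; 1; 1; 1]] (R := R).
exists W; split => // X XW X0.
have t0 : tsq X = 0.
  have := WX X XW 0%N isT; rewrite lin9E /= !(rmorph1, mul1r) => h.
  rewrite /tsq (_ : total X = 0) ?/ipc ?/= ?mulr0 ?addr0 //.
  by rewrite -h total_rsum.
rewrite bloch_form (JJ_real 1 1) subrr !mulr0 !mul0r !addr0 !mul1r t0 add0r.
have := lam_pot X rb l0 => /andP[_ h].
rewrite -nsq_gt0 in X0; have : 7 * lam * nsq X < s * nsq X by rewrite ltr_pM2r.
by move: h; move: (_ * ip _ _) (s * _) (7 * lam * _); clear => *; lra.
Qed.

Lemma realN1 : (-1 : C) = (-1 : R)%:C.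
Proof. by rewrite rmorphN1. Qed.

Lemma neg9_pp r lam s : r_bounds r -> 0 < lam -> 4 + 7 * lam < s ->
  neg_space 9 (shifted r lam (-1) (-1) s).
Proof.
move=> rb l0 sl; exists fullv; split=> [|X _ X0]; first by rewrite dim_M3.
rewrite bloch_form realN1 (JJ_real (-1) (-1)).
have := lam_pot X rb l0 => /andP[_ h]; have := tsq_csq X; have := tsq_rsq X.
have := csq_ge0 X; have := rsq_ge0 X.
rewrite -nsq_gt0 in X0; have : (4 + 7 * lam) * nsq X < s * nsq X by rewrite ltr_pM2r.
rewrite mulrDl.
move: h; move: (tsq X) (csq X) (rsq X) (_ * ip _ _) (s * _) (7 * lam * _); move: (nsq X) => *; lra.
Qed.

(** Blocks with equal row sums and equal column sums: the constant blocks, with eigenvalue 1, and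
    the four-dimensional product of sum-zero vectors, with eigenvalue 2 * 2 = 4. *)
Lemma pos5_pp r lam s : r_bounds r -> 0 < lam -> s < 1 - 7 * lam ->
  pos_space 5 (shifted r lam (-1) (-1) s).
Proof.
move=> rb l0 sl; have [W [dW WX]] := lin_space [:: [:: 1; -1; 0; 1; -1; 0; 1; -1; 0];
  [:: 1; 0; -1; 1; 0; -1; 1; 0; -1]; [:: 1; 1; 1; -1; -1; -1; 0; 0; 0];
  [:: 1; 1; 1; 0; 0; 0; -1; -1; -1]] (R := R).
exists W; split => // X XW X0.
have [c1 c2 r1 r2] : [/\ csum X 1 = csum X 0, csum X 2 = csum X 0,
    rsum X 1 = rsum X 0 & rsum X 2 = rsum X 0].
  have h := WX X XW.
  have := h 0%N isT; have := h 1%N isT; have := h 2%N isT; have := h 3%N isT.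
  rewrite !lin9E /= !(rmorphN1, rmorph0, rmorph1, mul0r, mul1r, add0r, addr0, mulN1r).
  move=> h3 h2 h1 h0; rewrite /csum /rsum; split; apply/esym/eqP; rewrite -subr_eq0.
  - by rewrite -h0; apply/eqP; ring.
  - by rewrite -h1; apply/eqP; ring.
  - by rewrite -h2; apply/eqP; ring.
  - by rewrite -h3; apply/eqP; ring.
have ipc3 (a : C) : ipc (a + a + a) (a + a + a) = 9 * ipc a a.
  by case: a => a b; rewrite /ipc /=; ring.
rewrite bloch_form realN1 (JJ_real (-1) (-1)).
have := lam_pot X rb l0 => /andP[h _]; have := csum_le X; have := rsum_le X.
rewrite -nsq_gt0 in X0; have : s * nsq X < (1 - 7 * lam) * nsq X by rewrite ltr_pM2r.
have t1 : tsq X = 3 * csq X.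
  by rewrite /tsq /total c1 c2 ipc3 /csq c1 c2; move: (ipc _ _); clear => *; ring.
have t2 : tsq X = 3 * rsq X.
  by rewrite /tsq total_rsum r1 r2 ipc3 /rsq r1 r2; move: (ipc _ _); clear => *; ring.
move: t1 t2; rewrite mulrBl mul1r -/(csq X) -/(rsq X).
by move: h; move: (tsq X) (csq X) (rsq X) (_ * ip _ _) (s * _) (7 * lam * _); move: (nsq X) => *; lra.
Qed.

(** These are the blocks u_i + v_j with u and v of sum zero, the eigenspace for -1 * 2. The first
    four equations express additivity, the last one that the total vanishes. *)
Lemma neg4_pp r lam s : r_bounds r -> 0 < lam -> - 2 + 7 * lam < s ->
  neg_space 4 (shifted r lam (-1) (-1) s).
Proof.
move=> rb l0 sl; have [W [dW WX]] := lin_space [:: [:: 1; -1; 0; -1; 1; 0; 0; 0; 0];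
  [:: 1; 0; -1; -1; 0; 1; 0; 0; 0]; [:: 1; -1; 0; 0; 0; 0; -1; 1; 0];
  [:: 1; 0; -1; 0; 0; 0; -1; 0; 1]; [:: -1; 1; 1; 1; 0; 0; 1; 0; 0]] (R := R).
exists W; split => // X XW X0.
have form : tsq X - 2 * csq X - 2 * rsq X + 4 * nsq X = - 2 * nsq X.
  have h := WX X XW.
  have := h 0%N isT; have := h 1%N isT; have := h 2%N isT; have := h 3%N isT.
  have := h 4%N isT.
  rewrite !lin9E /= !(rmorphN1, rmorph0, rmorph1, mul0r, mul1r, add0r, addr0, mulN1r).
  move=> h4 h3 h2 h1 h0.
  have x00 : X 0 0 = X 0 1 + X 0 2 + X 1 0 + X 2 0.
    by apply/eqP; rewrite -subr_eq0 -oppr_eq0 -h4; apply/eqP; ring.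
  have x11 : X 1 1 = X 1 0 + X 0 1 - X 0 0 by apply/eqP; rewrite -subr_eq0 -h0; apply/eqP; ring.
  have x12 : X 1 2 = X 1 0 + X 0 2 - X 0 0 by apply/eqP; rewrite -subr_eq0 -h1; apply/eqP; ring.
  have x21 : X 2 1 = X 2 0 + X 0 1 - X 0 0 by apply/eqP; rewrite -subr_eq0 -h2; apply/eqP; ring.
  have x22 : X 2 2 = X 2 0 + X 0 2 - X 0 0 by apply/eqP; rewrite -subr_eq0 -h3; apply/eqP; ring.
  rewrite /tsq /csq /rsq /total /csum /rsum /nsq ip_cols sum3 x11 x12 x21 x22 x00.
  case: (X 0 1) (X 0 2) (X 1 0) (X 2 0) => a b [c d] [e f] [g k]; rewrite /ipc /=.
  by clear; ring.
rewrite bloch_form realN1 (JJ_real (-1) (-1)).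
have := lam_pot X rb l0 => /andP[_ h].
rewrite -nsq_gt0 in X0; have : (- 2 + 7 * lam) * nsq X < s * nsq X by rewrite ltr_pM2r.
rewrite mulrDl; move: form.
by move: h; move: (tsq X) (csq X) (rsq X) (_ * ip _ _) (s * _) (7 * lam * _); move: (nsq X) => *; lra.
Qed.

(** Blocks with equal rows of sum zero form the eigenspace for 3 * 2 = 6. *)
Lemma pos2_0p r lam s : r_bounds r -> 0 < lam -> s < 6 - 7 * lam ->
  pos_space 2 (shifted r lam 1 (-1) s).
Proof.
move=> rb l0 sl; have [W [dW WX]] := lin_space [:: [:: 1; 0; 0; -1; 0; 0; 0; 0; 0];
  [:: 0; 1; 0; 0; -1; 0; 0; 0; 0]; [:: 0; 0; 1; 0; 0; -1; 0; 0; 0];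
  [:: 1; 0; 0; 0; 0; 0; -1; 0; 0]; [:: 0; 1; 0; 0; 0; 0; 0; -1; 0];
  [:: 0; 0; 1; 0; 0; 0; 0; 0; -1]; [:: 1; 1; 1; 0; 0; 0; 0; 0; 0]] (R := R).
exists W; split => // X XW X0.
have form : - tsq X + 2 * csq X = 6 * nsq X.
  have h := WX X XW.
  have := h 0%N isT; have := h 1%N isT; have := h 2%N isT; have := h 3%N isT.
  have := h 4%N isT; have := h 5%N isT; have := h 6%N isT.
  rewrite !lin9E /= !(rmorphN1, rmorph0, rmorph1, mul0r, mul1r, add0r, addr0, mulN1r).
  move=> h6 h5 h4 h3 h2 h1 h0.
  have x02 : X 0 2 = - X 0 0 - X 0 1 by apply/eqP; rewrite -subr_eq0 -h6; apply/eqP; ring.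
  have eqx (a b : C) : a - b = 0 -> b = a by move=> /eqP; rewrite subr_eq0 => /eqP.
  rewrite /tsq /csq /total /csum /nsq ip_cols sum3.
  rewrite (eqx _ _ h0) (eqx _ _ h1) (eqx _ _ h2) (eqx _ _ h3) (eqx _ _ h4) (eqx _ _ h5) x02.
  by case: (X 0 0) (X 0 1) => a b [c d]; rewrite /ipc /=; clear; ring.
rewrite bloch_form realN1 (JJ_real 1 (-1)).
have := lam_pot X rb l0 => /andP[h _].
rewrite -nsq_gt0 in X0; have : s * nsq X < (6 - 7 * lam) * nsq X by rewrite ltr_pM2r.
rewrite mulrBl; move: form.
by move: h; move: (tsq X) (csq X) (rsq X) (_ * ip _ _) (s * _) (7 * lam * _); move: (nsq X) => *; lra.
Qed.

Lemma ipcD_le (k l A B : R) (a b : C) : 0 <= k -> 0 <= l -> 0 <= A -> 0 <= B ->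
  ipc a a <= k * A -> ipc b b <= l * B -> ipc (a + b) (a + b) <= (k + l) * (A + B).
Proof.
case: a b => a1 a2 [b1 b2] k0 l0 A0 B0; rewrite /ipc /= => h1 h2.
have : (a1 * b1 + a2 * b2) * 2 <= k * B + l * A.
  have aux (m y z : R) : 0 <= y -> 0 <= z -> m ^+ 2 <= y * z -> m * 2 <= y + z.
    clear => y0 z0 h; rewrite leNgt; apply/negP => lt.
    have := sqr_ge0 (y - z); have : (y + z) ^+ 2 < (m * 2) ^+ 2.
      by rewrite ltr_sqr ?nnegrE ?addr_ge0 // ltW // (le_lt_trans _ lt) ?addr_ge0.
    by move: h; nra.
  apply: aux; [exact: mulr_ge0|exact: mulr_ge0|].
  have cs : (a1 * b1 + a2 * b2) ^+ 2 <= (a1 * a1 + a2 * a2) * (b1 * b1 + b2 * b2).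
    rewrite -subr_ge0 (_ : _ - _ = (a1 * b2 - a2 * b1) ^+ 2) ?sqr_ge0 //; ring.
  apply: le_trans cs _; rewrite (_ : k * B * (l * A) = k * A * (l * B)); last by ring.
  by apply: ler_pM => //; rewrite -!expr2 addr_ge0 ?sqr_ge0.
rewrite (_ : (k + l) * (A + B) = k * A + l * B + (k * B + l * A)); last by ring.
move: h1 h2; move: (k * A) (l * B) (k * B + l * A); clear => *; lra.
Qed.

Lemma ipcZ_le (p : R) (a : C) : 0 < p -> ipc a a <= p^-1 * (p * ipc a a).
Proof. by move=> p0; rewrite mulKf ?gt_eqF. Qed.

(** Cauchy-Schwarz with weights, built up by adding one term at a time. *)
Lemma ipc_sum_le (p0 p1 p2 p3 p4 : R) (a0 a1 a2 a3 a4 : C) :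
  0 < p0 -> 0 < p1 -> 0 < p2 -> 0 < p3 -> 0 < p4 ->
  ipc (a0 + a1 + a2 + a3 + a4) (a0 + a1 + a2 + a3 + a4) <=
  (p0^-1 + p1^-1 + p2^-1 + p3^-1 + p4^-1) *
  (p0 * ipc a0 a0 + p1 * ipc a1 a1 + p2 * ipc a2 a2 + p3 * ipc a3 a3 + p4 * ipc a4 a4).
Proof.
move=> h0 h1 h2 h3 h4.
have i (p : R) : 0 < p -> 0 <= p^-1 by move=> ?; rewrite invr_ge0 ltW.
have w (p : R) (a : C) : 0 < p -> 0 <= p * ipc a a.
  by move=> ?; rewrite mulr_ge0 ?ipcc_ge0 // ltW.
have ge0 := (i _ h0, i _ h1, i _ h2, i _ h3, i _ h4,
  w _ a0 h0, w _ a1 h1, w _ a2 h2, w _ a3 h3, w _ a4 h4).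
apply: ipcD_le; rewrite ?addr_ge0 ?ge0 //; last exact: ipcZ_le.
apply: ipcD_le; rewrite ?addr_ge0 ?ge0 //; last exact: ipcZ_le.
apply: ipcD_le; rewrite ?addr_ge0 ?ge0 //; last exact: ipcZ_le.
by apply: ipcD_le; rewrite ?addr_ge0 ?ge0 //; exact: ipcZ_le.
Qed.

Lemma had_rows r X : ip (had (pot r) X) X =
  (- r - r^-1 + 2) * ipc (X 0 0) (X 0 0) - r^-1 * ipc (X 0 1) (X 0 1) +
  (r - r^-1 - 2) * ipc (X 0 2) (X 0 2) +
  (- r * ipc (X 1 0) (X 1 0) + r * ipc (X 1 2) (X 1 2)) +
  ((- r + r^-1 - 2) * ipc (X 2 0) (X 2 0) + r^-1 * ipc (X 2 1) (X 2 1) +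
  (r + r^-1 + 2) * ipc (X 2 2) (X 2 2)).
Proof. by rewrite ip_had_sum !sum3 /pot !ggE; clear; ring. Qed.

Lemma nsq_rows X : nsq X =
  ipc (X 0 0) (X 0 0) + ipc (X 0 1) (X 0 1) + ipc (X 0 2) (X 0 2) +
  (ipc (X 1 0) (X 1 0) + ipc (X 1 1) (X 1 1) + ipc (X 1 2) (X 1 2)) +
  (ipc (X 2 0) (X 2 0) + ipc (X 2 1) (X 2 1) + ipc (X 2 2) (X 2 2)).
Proof. by rewrite /nsq ipE !sum3. Qed.

(* At total 0 and with row 2 (q_3, q_6, q_9) deleted, the only positive entry of Q - 1/4 is
   the one of q_8, and it is absorbed by Cauchy-Schwarz; [pos6_00] is the mirror case. *)
Lemma neg5_00 r lam : r_bounds r -> 0 < lam ->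
  neg_space 5 (shifted r lam 1 1 (lam / 4)).
Proof.
move=> [r1 r2 r3 r4 _] l0; have [W [dW WX]] := lin_space [:: [:: 0; 0; 0; 0; 0; 0; 1; 0; 0];
  [:: 0; 0; 0; 0; 0; 0; 0; 1; 0]; [:: 0; 0; 0; 0; 0; 0; 0; 0; 1];
  [:: 1; 1; 1; 1; 1; 1; 0; 0; 0]] (R := R).
exists W; split => // X XW X0.
have [x20 x21 x22 x12] : [/\ X 2 0 = 0, X 2 1 = 0, X 2 2 = 0 &
    X 1 2 = - (X 0 0 + X 0 1 + X 0 2 + X 1 0 + X 1 1)].
  have h := WX X XW.
  have := h 0%N isT; have := h 1%N isT; have := h 2%N isT; have := h 3%N isT.
  rewrite !lin9E /= !(rmorph0, rmorph1, mul0r, mul1r, add0r, addr0).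
  move=> h3 h2 h1 h0; split => //.
  by apply/eqP; rewrite -addr_eq0 -h3; apply/eqP; ring.
have t0 : tsq X = 0.
  rewrite /tsq (_ : total X = 0) ?/ipc ?/= ?mulr0 ?addr0 //.
  by rewrite /total /csum x20 x21 x22 x12; ring.
rewrite bloch_form (JJ_real 1 1) subrr !mulr0 !mul0r !addr0 !mul1r t0 add0r.
rewrite (_ : _ - _ = lam * (ip (had (pot r) X) X - nsq X / 4)); last by field.
rewrite -nsq_gt0 in X0; rewrite pmulr_rlt0 //.
have ipc0 : ipc 0 0 = 0 :> R by rewrite /ipc /= mulr0 addr0.
have p1 : 0 < 4 / 3 :> R by lra.
have p2 : 0 < 3 / 5 :> R by lra.
have p3 : 0 < 1 / 4 :> R by lra.
(* The weights are lower bounds for 1/4 - Q on the five entries. Their inverses sum to 7, and r -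
   1/4 < 11/100, so that 7 * 11/100 < 1 suffices. *)
have := @ipc_sum_le (4 / 3) 3 4 (3 / 5) (1 / 4) (X 0 0) (X 0 1) (X 0 2) (X 1 0) (X 1 1)
  p1 (ltr0n _ 3) (ltr0n _ 4) p2 p3.
have -> : (4 / 3)^-1 + 3^-1 + 4^-1 + (3 / 5)^-1 + (1 / 4)^-1 = 7 :> R by field.
move: X0; rewrite had_rows nsq_rows x20 x21 x22 ipc0 x12.
have -> (a : C) : ipc (- a) (- a) = ipc a a by case: a => a b; rewrite /ipc /= !mulrNN.
move: (ipcc_ge0 (X 0 0)) (ipcc_ge0 (X 0 1)) (ipcc_ge0 (X 0 2)) (ipcc_ge0 (X 1 0)).
move: (ipcc_ge0 (X 1 1)) (ipcc_ge0 (X 0 0 + X 0 1 + X 0 2 + X 1 0 + X 1 1)).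
move: (ipc (_ + _) _) (ipc (X 0 0) _) (ipc (X 0 1) _) (ipc (X 0 2) _) (ipc (X 1 0) _).
move: (ipc (X 1 1) _) => a11 x a00 a01 a02 a10 x0 g11 g10 g02 g01 g00.
move: r^-1 r3 r4 => ri r3 r4 np xle.
have q00 : (- r - ri + 2 - 1 / 4) * a00 <= - (4 / 3) * a00 by apply: ler_wpM2r => //; move: r1 r2 r3 r4; clear; lra.
have q01 : (- ri - 1 / 4) * a01 <= - 3 * a01 by apply: ler_wpM2r => //; move: r1 r2 r3 r4; clear; lra.
have q02 : (r - ri - 2 - 1 / 4) * a02 <= - 4 * a02 by apply: ler_wpM2r => //; move: r1 r2 r3 r4; clear; lra.
have q10 : (- r - 1 / 4) * a10 <= - (3 / 5) * a10 by apply: ler_wpM2r => //; move: r1 r2 r3 r4; clear; lra.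
have q12 : (r - 1 / 4) * x <= 11 / 100 * x by apply: ler_wpM2r => //; move: r1 r2 r3 r4; clear; lra.
rewrite (_ : _ - _ = (- r - ri + 2 - 1 / 4) * a00 + (- ri - 1 / 4) * a01 +
  (r - ri - 2 - 1 / 4) * a02 + (- r - 1 / 4) * a10 - a11 / 4 + (r - 1 / 4) * x); last by field.
move: (_ * a00) (_ * a01) (_ * a02) (_ * a10) (_ * x) q00 q01 q02 q10 q12.
by move: np xle g00 g01 g02 g10 g11 x0; clear => *; lra.
Qed.

Lemma pos6_00 r lam : r_bounds r -> 0 < lam -> 100 * lam <= 1 ->
  pos_space 6 (shifted r lam 1 1 (- (lam / 4))).
Proof.
move=> [r1 r2 r3 r4 _] l0 l1; have [W [dW WX]] := lin_space [:: [:: 1; 0; 0; 0; 0; 0; 0; 0; 0];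
  [:: 0; 1; 0; 0; 0; 0; 0; 0; 0]; [:: 0; 0; 1; 0; 0; 0; 0; 0; 0]] (R := R).
exists W; split => // X XW X0.
have [x00 x01 x02] : [/\ X 0 0 = 0, X 0 1 = 0 & X 0 2 = 0].
  have h := WX X XW.
  have := h 0%N isT; have := h 1%N isT; have := h 2%N isT.
  by rewrite !lin9E /= !(rmorph0, rmorph1, mul0r, mul1r, add0r, addr0).
rewrite bloch_form (JJ_real 1 1) subrr !mulr0 !mul0r !addr0 !mul1r.
rewrite -nsq_gt0 in X0.
have ipc0 : ipc 0 0 = 0 :> R by rewrite /ipc /= mulr0 addr0.
have x10 : X 1 0 = total X - (X 1 1 + X 1 2 + X 2 0 + X 2 1 + X 2 2).
  by rewrite /total /csum x00 x01 x02; ring.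
have p1 : 0 < 3 / 5 :> R by lra.
have p2 : 0 < 1 / 4 :> R by lra.
have p3 : 0 < 2 / 3 :> R by lra.
(* The weights are lower bounds for Q + 1/4, with inverse sum 77/10. The total gets weight 100, paid
   for by the unperturbed form since 100 lam <= 1; altogether (77/10 + 1/100) * 11/100 < 85/100. *)
have h5 := @ipc_sum_le (1 / 4) (3 / 5) (2 / 3) 3 5 (X 1 1) (X 1 2) (X 2 0) (X 2 1) (X 2 2)
  p2 p1 p3 (ltr0n _ 3) (ltr0n _ 5).
have x10le : ipc (X 1 0) (X 1 0) <= (1 / 100 + 77 / 10) * (100 * tsq X +
  (1 / 4 * ipc (X 1 1) (X 1 1) + 3 / 5 * ipc (X 1 2) (X 1 2) + 2 / 3 * ipc (X 2 0) (X 2 0) +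
   3 * ipc (X 2 1) (X 2 1) + 5 * ipc (X 2 2) (X 2 2))).
  have g (p : R) (a : C) : 0 <= p -> 0 <= p * ipc a a.
    by move=> ?; rewrite mulr_ge0 ?ipcc_ge0.
  rewrite x10; apply: ipcD_le.
  - by clear; lra.
  - by clear; lra.
  - by rewrite mulr_ge0 ?tsq_ge0.
  - by apply: addr_ge0; [apply: addr_ge0; [apply: addr_ge0; [apply: addr_ge0|]|]|]; apply: g; clear; lra.
  - by rewrite /tsq; move: (ipc _ _); clear => *; lra.
  have ipcN (a : C) : ipc (- a) (- a) = ipc a a by case: a => a b; rewrite /ipc /= !mulrNN.
  rewrite ipcN; apply: le_trans h5 _; rewrite le_eqVlt; apply/orP; left; apply/eqP.
  by congr (_ * _); field.
move: X0 x10le; rewrite had_rows nsq_rows x00 x01 x02 ipc0.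
move: (tsq_ge0 X) (ipcc_ge0 (X 1 0)) (ipcc_ge0 (X 1 1)) (ipcc_ge0 (X 1 2)) (ipcc_ge0 (X 2 0)).
move: (ipcc_ge0 (X 2 1)) (ipcc_ge0 (X 2 2)).
clear h5 x10.
move: (ipc (X 1 0) _) (ipc (X 1 1) _) (ipc (X 1 2) _) (ipc (X 2 0) _) (ipc (X 2 1) _).
move: (ipc (X 2 2) _) (tsq X) => a22 t x a11 a12 a20 a21 g21 g22 t0 x0 g11 g12 g20 np xle.
move: r^-1 r3 r4 => ri r3 r4.
pose P := 1 / 4 * a11 + 3 / 5 * a12 + 2 / 3 * a20 + 3 * a21 + 5 * a22.
have q : P - 11 / 100 * x <= - (r - 1 / 4) * x + a11 / 4 + (r + 1 / 4) * a12 +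
   (- r + ri - 2 + 1 / 4) * a20 + (ri + 1 / 4) * a21 + (r + ri + 2 + 1 / 4) * a22.
  have q10 : (r - 1 / 4) * x <= 11 / 100 * x by apply: ler_wpM2r => //; move: r1 r2 r3 r4; clear; lra.
  have q12 : 3 / 5 * a12 <= (r + 1 / 4) * a12 by apply: ler_wpM2r => //; move: r1 r2 r3 r4; clear; lra.
  have q20 : 2 / 3 * a20 <= (- r + ri - 2 + 1 / 4) * a20 by apply: ler_wpM2r => //; move: r1 r2 r3 r4; clear; lra.
  have q21 : 3 * a21 <= (ri + 1 / 4) * a21 by apply: ler_wpM2r => //; move: r1 r2 r3 r4; clear; lra.
  have q22 : 5 * a22 <= (r + ri + 2 + 1 / 4) * a22 by apply: ler_wpM2r => //; move: r1 r2 r3 r4; clear; lra.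
  rewrite /P mulNr.
  move: (_ * x) (_ * a12) (_ * a20) (_ * a21) (_ * a22) q10 q12 q20 q21 q22.
  by clear => *; lra.
rewrite (_ : _ - _ = t + lam * (- (r - 1 / 4) * x + a11 / 4 + (r + 1 / 4) * a12 +
   (- r + ri - 2 + 1 / 4) * a20 + (ri + 1 / 4) * a21 + (r + ri + 2 + 1 / 4) * a22)); last by field.
move: (_ + _ * a22) q => F q.
have xle' : x <= (1 / 100 + 77 / 10) * (100 * t + P) by [].
have P0 : a11 + a12 + a20 + a21 + a22 <= 4 * P.
  by rewrite /P; move: g22 g21 g20 g12 g11; clear; lra.
have tP : 0 < 100 * t + P.
  by move: np P0 xle' t0 g11 g12 g20 g21 g22; clear; clearbody P; lra.
have q' : 15 / 100 * (100 * t + P) - 100 * t <= F.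
  by move: q xle' t0 tP; clear; clearbody P; lra.
rewrite -(ler_pM2l l0) in q'; rewrite -(pmulr_rgt0 _ l0) in tP.
have lt : 100 * lam * t <= 1 * t by apply: ler_wpM2r.
move: q' tP lt; rewrite mulrBr (mulrCA lam (15 / 100)) (_ : lam * (100 * t) = 100 * lam * t);
  last by ring.
by move: (lam * (_ + _)) (lam * F) (100 * lam * t) t0; clear => *; lra.
Qed.

End TestSpaces.

(** * Gauge equivalence and continuity in the momenta *)

Section GaugeContinuity.
Context {R : realType}.
Local Notation C := R[i].
Local Notation V := 'M[C]_3.
Implicit Types (X : V) (r lam s : R) (nu mu : C).

Definition gauge (w : C) : V := \matrix_(i, j) (if j == i then w ^+ i else 0).

Lemma gauge_mulE w n (X : 'M[C]_(3, n)) i j : (gauge w *m X) i j = w ^+ i * X i j.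
Proof.
rewrite mxE (bigD1 i) //= big1 ?addr0 => [|k ki]; first by rewrite mxE eqxx.
by rewrite mxE (negPf ki) mul0r.
Qed.

Lemma gauge_tr w : (gauge w)^T = gauge w.
Proof. by apply/matrixP => i j; rewrite !mxE eq_sym; case: eqP => // ->. Qed.

Lemma mul_gaugeE w n (X : 'M[C]_(n, 3)) i j : (X *m gauge w) i j = w ^+ j * X i j.
Proof.
rewrite -[X *m _]trmxK trmx_mul gauge_tr mxE gauge_mulE mxE //.
Qed.

Lemma unitc_conj (z : C) : unitc z -> z * conjc z = 1.
Proof.
case: z => a b /eqP; rewrite /ipc /= => h.
by apply/eqP; rewrite eq_complex /= mulrN opprK h; apply/andP; split=> //; apply/eqP; ring.
Qed.

(** Conjugation by diag(1, w, w^2) multiplies the twist by w; the wrap-around entries agree because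
    w^3 = 1. *)
Lemma J_gauge w nu : w ^+ 3 = 1 -> unitc w -> J nu *m gauge w = gauge w *m J (nu * w).
Proof.
move=> w3 /unitc_conj ww; have wc : conjc w = w ^+ 2.
  by rewrite -[LHS]mul1r -w3 exprSr -mulrA ww mulr1.
have cM : conjc (nu * w) = conjc nu * w ^+ 2 by rewrite -wc rmorphM.
apply/matrixP => i j; rewrite mul_gaugeE gauge_mulE !mxE cM; move: (conjc nu) => nu'.
elim/ord3P: i; elim/ord3P: j => /=; rewrite ?expr0 ?expr1 ?mul1r ?mulr1 //; try ring.
all: try (rewrite -[LHS]mul1r -w3; ring).
all: rewrite -[RHS]mul1r -w3; ring.
Qed.

Lemma gauge_J w mu : w ^+ 3 = 1 -> unitc w ->
  gauge w *m J mu = J (mu * conjc w) *m gauge w.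
Proof.
move=> w3 uw; apply: trmx_inj; rewrite !trmx_mul gauge_tr !J_tr J_gauge //.
by congr (_ *m J _); rewrite rmorphM /= conjcK.
Qed.

Lemma unitc_conjc (z : C) : unitc z -> unitc (conjc z).
Proof. by case: z => a b; rewrite /unitc /ipc /= mulrNN. Qed.

Lemma unitcM (z w : C) : unitc z -> unitc w -> unitc (z * w).
Proof. by move=> /eqP h1 /eqP h2; rewrite /unitc ipcM h1 h2 mulr1. Qed.

Lemma gaugeM (w z : C) X : gauge w *m (gauge z *m X) = gauge (w * z) *m X.
Proof. by apply/matrixP => i j; rewrite !gauge_mulE mulrA exprMn. Qed.

Lemma gauge1 X : gauge 1 *m X = X.
Proof. by apply/matrixP => i j; rewrite gauge_mulE expr1n mul1r. Qed.

Lemma gaugeMr (w z : C) X : X *m (gauge w *m gauge z) = X *m gauge (w * z).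
Proof. by rewrite mulmxA; apply/matrixP => i j; rewrite !mul_gaugeE mulrA exprMn [z ^+ _ * _]mulrC. Qed.

Lemma gauge1r X : X *m gauge 1 = X.
Proof. by apply/matrixP => i j; rewrite mul_gaugeE expr1n mul1r. Qed.

(* The blocks at nu and nu w are unitarily equivalent for w^3 = 1, so that only
   quasi-momenta with real parts at least 1/2 matter. *)
Lemma op_gauge nu mu w z W X : w ^+ 3 = 1 -> unitc w -> z ^+ 3 = 1 -> unitc z ->
  op nu mu W (gauge w *m X *m gauge z) =
  gauge w *m op (nu * w) (mu * conjc z) W X *m gauge z.
Proof.
move=> w3 uw z3 uz; rewrite /op mulmxDr mulmxDl; congr (_ + _).
  by rewrite !mulmxA J_gauge // -!mulmxA gauge_J.
by apply/matrixP => i j; rewrite mxE !mul_gaugeE !gauge_mulE mxE; ring.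
Qed.

(** Of the three rotations of z by multiples of 120 degrees one has argument between -60 and 60.
    When Re z < 1/2 the rotation goes against the sign of Im z, which is the choice of [e]. *)
Lemma cube_root_choice z : unitc z ->
  exists w : C, [/\ w ^+ 3 = 1, unitc w & 1 / 2 <= Re (z * w)].
Proof.
case: z => c s /eqP; rewrite /ipc /= -!expr2 => cs.
pose q : R := Num.sqrt 3; have q2 : q ^+ 2 = 3 by rewrite sqr_sqrtr.
have q0 : 0 <= q by exact: sqrtr_ge0.
have root (e : R) : e ^+ 2 = 1 ->
    ((- (1 / 2)) +i* (e * q / 2)) ^+ 3 = 1 /\ unitc ((- (1 / 2)) +i* (e * q / 2)).
  move=> e2; have eq2 : (e * q / 2) ^+ 2 = 3 / 4.
    by rewrite !exprMn e2 q2; field.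
  move: (e * q / 2) eq2 => d d2; split; last first.
    by rewrite /unitc /ipc /= -!expr2 d2; apply/eqP; field.
  apply/eqP; rewrite eq_complex !exprS expr0 /=; apply/andP; split; apply/eqP.
    by transitivity (- (1 / 8) + 3 / 2 * d ^+ 2); [field | rewrite d2; field].
  by transitivity (d * (3 / 4 - d ^+ 2)); [field | rewrite d2; field].
case: (lerP (1 / 2) c) => c1.
  by exists 1; rewrite expr1n mulr1; split=> //; rewrite /unitc /ipc /= mulr0 addr0 mulr1.
pose e : R := if 0 <= s then -1 else 1.
have e2 : e ^+ 2 = 1 by rewrite /e; case: ifP; rewrite ?sqrrN expr1n.
have [w3 uw] := root e e2; exists ((- (1 / 2)) +i* (e * q / 2)); split => //=.
have es : e * s = - `|s|.
  by rewrite /e; case: (lerP 0 s) => h; [rewrite ger0_norm // mulN1r | rewrite ltr0_norm // mul1r opprK].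
have -> : c * - (1 / 2) - s * (e * q / 2) = (- c + q * `|s|) / 2.
  by rewrite (_ : s * (e * q / 2) = (e * s) * q / 2); [rewrite es; field | field].
rewrite ler_pM2r ?invr_gt0 //.
suff : 1 + c <= q * `|s| by lra.
have c0 : 0 <= 1 + c.
  by have := sqr_ge0 s; move: cs c1; clear => h1 h2 h3; nra.
rewrite -ler_sqr ?nnegrE ?mulr_ge0 // exprMn q2 real_normK ?num_real //.
by move: cs c1 c0; clear => h1 h2 h3; nra.
Qed.

Lemma kernel_gauge W :
  (forall nu mu X, unitc nu -> 1 / 2 <= Re nu -> unitc mu -> 1 / 2 <= Re mu ->
     op nu mu W X = 0 -> X = 0) ->
  forall nu mu X, unitc nu -> unitc mu -> op nu mu W X = 0 -> X = 0.
Proof.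
move=> h nu mu X unu umu.
have [w [w3 uw rw]] := cube_root_choice unu.
have [z [z3 uz rz]] := cube_root_choice umu.
have z3' : conjc z ^+ 3 = 1 by rewrite -rmorphXn z3 rmorph1.
have uz' := unitc_conjc uz.
have XE : X = gauge w *m (gauge (conjc w) *m X *m gauge z) *m gauge (conjc z).
  by rewrite -!mulmxA gaugeM unitc_conj // gauge1 gaugeMr unitc_conj // gauge1r.
move: (_ *m X *m _) XE => Y ->; rewrite op_gauge // conjcK => h0.
have Y0 : op (nu * w) (mu * z) W Y = 0.
  have := congr1 (fun Z => gauge (conjc w) *m Z *m gauge z) h0.
  rewrite -!mulmxA gaugeM gaugeMr [conjc w * _]mulrC [conjc z * _]mulrC.
  by rewrite !unitc_conj // gauge1 gauge1r mul0mx mulmx0.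
by rewrite (h _ _ _ _ _ _ _ Y0) ?unitcM // mulmx0 mul0mx.
Qed.

Lemma nsq_JB_le nu nu' n (A : 'M[C]_(3, n)) :
  nsq ((J nu - J nu') *m A) <= 4 * ipc (nu - nu') (nu - nu') * nsq A.
Proof.
rewrite /nsq !ip_cols mulr_sumr; apply: ler_sum => j _.
have e i : ((J nu - J nu') *m A) i j =
    (nu - nu') * A (i + 1) j + conjc (nu - nu') * A (i - 1) j.
  by rewrite mulmxBl mxE J_mulE mxE J_mulE rmorphB; ring.
rewrite !e; have [[-> -> ->] [-> -> ->]] := ord3_add 0; move: (nu - nu') => d.
have ipc2 (a b : C) : ipc (a + b) (a + b) <= 2 * (ipc a a + ipc b b).
  case: a b => a1 a2 [b1 b2]; rewrite /ipc /= -subr_ge0.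
  rewrite (_ : _ - _ = (a1 - b1) ^+ 2 + (a2 - b2) ^+ 2); last by ring.
  by rewrite addr_ge0 ?sqr_ge0.
have dc : ipc (conjc d) (conjc d) = ipc d d by case: (d) => a b; rewrite /ipc /= mulrNN.
have h := ipc2 (d * A 1 j) (conjc d * A 2 j); have h' := ipc2 (d * A 2 j) (conjc d * A 0 j).
have h'' := ipc2 (d * A 0 j) (conjc d * A 1 j).
move: h h' h''; rewrite !(ipcM, dc).
move: (ipc d d) (ipc (A 0 j) _) (ipc (A 1 j) _) (ipc (A 2 j) _) => D a0 a1 a2.
move: (ipc _ _) (ipc _ _) (ipc _ _) => x y z.
rewrite (_ : 4 * D * _ = 4 * (D * a0) + 4 * (D * a1) + 4 * (D * a2)); last by ring.
by move: (D * a0) (D * a1) (D * a2); clear => *; lra.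
Qed.

Lemma nsq_JrB_le mu mu' n (A : 'M[C]_(n, 3)) :
  nsq (A *m (J mu - J mu')) <= 4 * ipc (mu - mu') (mu - mu') * nsq A.
Proof.
rewrite -nsq_tr -[nsq A]nsq_tr trmx_mul linearB /= !J_tr.
apply: le_trans (nsq_JB_le _ _ _) _; rewrite -rmorphB.
by case: (mu - mu') => a b; rewrite /ipc /= mulrNN.
Qed.

Lemma nsq_Jr_le mu n (A : 'M[C]_(n, 3)) : unitc mu -> nsq (A *m J mu) <= 9 * nsq A.
Proof.
by move=> u; rewrite -nsq_tr -[nsq A]nsq_tr trmx_mul !J_tr nsq_J_le // unitc_conjc.
Qed.

(** 144 = 2 * (36 + 36): each of the two telescoped terms carries 9 from a factor [J] and 4 from a
    difference of two such factors. *)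
Lemma op_diff_le nu nu' mu mu' W X d : unitc nu' -> unitc mu ->
  ipc (nu - nu') (nu - nu') <= d -> ipc (mu - mu') (mu - mu') <= d ->
  nsq (op nu mu W X - op nu' mu' W X) <= 144 * d * nsq X.
Proof.
move=> unu umu hn hm; have X0 := nsq_ge0 X.
have -> : op nu mu W X - op nu' mu' W X =
    (J nu - J nu') *m X *m J mu + J nu' *m X *m (J mu - J mu').
  by rewrite /op opprD addrACA subrr addr0 mulmxBl mulmxBl mulmxBr addrA subrK.
apply: le_trans (nsqD_le _ _) _.
have h1 : nsq ((J nu - J nu') *m X *m J mu) <= 36 * (d * nsq X).
  apply: le_trans (nsq_Jr_le _ umu) _.
  have := nsq_JB_le nu nu' X; have := ler_wpM2r X0 hn; rewrite -mulrA.
  by move: (ipc _ _ * nsq X) (d * nsq X) (nsq (_ *m _)); clear => *; lra.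
have h2 : nsq (J nu' *m X *m (J mu - J mu')) <= 36 * (d * nsq X).
  rewrite -mulmxA; apply: le_trans (nsq_J_le _ unu) _.
  have := nsq_JrB_le mu mu' X; have := ler_wpM2r X0 hm; rewrite -mulrA.
  by move: (ipc _ _ * nsq X) (d * nsq X) (nsq (_ *m _)); clear => *; lra.
rewrite -mulrA !mulr2n; move: h1 h2; move: (d * nsq X) (nsq _) (nsq _); clear => *; lra.
Qed.

Lemma op_form_diff nu nu' mu mu' W X d e : unitc nu' -> unitc mu -> 0 < e ->
  144 * d <= e ^+ 2 ->
  ipc (nu - nu') (nu - nu') <= d -> ipc (mu - mu') (mu - mu') <= d ->
  `|ip (op nu mu W X) X - ip (op nu' mu' W X) X| <= e * nsq X.
Proof.
move=> unu umu e0 de hn hm; rewrite -ipNl -ipDl.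
have := ip_young (op nu mu W X - op nu' mu' W X) X (_ : 0 < e^-1).
rewrite invr_gt0 invrK => /(_ e0); have := op_diff_le W X unu umu hn hm.
move=> h y; suff : e^-1 * nsq (op nu mu W X - op nu' mu' W X) <= e * nsq X.
  by move: y; move: (`|_|) => m; rewrite mulr2n; lra.
rewrite ler_pdivrMl // mulrA -expr2; apply: le_trans h _.
by rewrite ler_wpM2r ?nsq_ge0.
Qed.

End GaugeContinuity.

(** * Band structure *)

From mathcomp Require Import all_classical all_reals all_analysis.
Import numFieldNormedType.Exports.
Local Open Scope classical_set_scope.
Local Open Scope ring_scope.
Local Open Scope complex_scope.

Section Bands.
Context {R : realType}.
Local Notation C := R[i].
Local Notation V := 'M[C]_3.
Implicit Types (X : V) (r lam s : R) (nu mu : C).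

Definition cis (a : R) : C := cos a +i* sin a.

Lemma unitc_cis a : unitc (cis a).
Proof. by rewrite /unitc /ipc /= -!expr2 cos2Dsin2. Qed.

Lemma cis0 : cis 0 = 1.
Proof. by rewrite /cis cos0 sin0. Qed.

Lemma cis_surj z : unitc z -> exists2 a, - pi <= a <= pi & z = cis a.
Proof.
case: z => c s /eqP; rewrite /ipc /= -!expr2 => cs.
have c1 : -1 <= c <= 1.
  by rewrite -ler_norml -(@ler_sqr _ `|c|) ?nnegrE // real_normK ?num_real // expr1n -cs lerDl sqr_ge0.
have [/andP[a0 api] ac] := acos_def c1; have sa := sin_acos c1.
have s2 : 1 - c ^+ 2 = s ^+ 2 by rewrite -cs addrC addKr.
rewrite s2 sqrtr_sqr in sa.
case: (lerP 0 s) => s0.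
  exists (acos c); first by rewrite api (le_trans _ a0) // oppr_le0 pi_ge0.
  by rewrite /cis ac sa ger0_norm.
exists (- acos c); first by rewrite lerN2 api (le_trans _ (pi_ge0 _)) // oppr_le0.
by rewrite /cis cosN sinN ac sa ltr0_norm // opprK.
Qed.

Lemma cis_near (a d : R) : 0 < d -> \forall b \near a, ipc (cis b - cis a) (cis b - cis a) <= d.
Proof.
move=> d0.
have : (fun b => ipc (cis b - cis a) (cis b - cis a)) @ a --> (0 : R).
  rewrite (_ : 0 = ipc (cis a - cis a) (cis a - cis a)); last first.
    by rewrite subrr /ipc /= mulr0 addr0.
  rewrite /ipc /=; apply: cvgD; apply: cvgM; apply: cvgB; try exact: cvg_cst;
    by [exact: continuous_cos | exact: continuous_sin].
by move/cvgr_lt => /(_ d d0); apply: filterS => b /ltW.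
Qed.

(** Here s is an energy of H + 1 and corresponds to s - 1 for H. *)
Definition regular r lam s := forall nu mu X, unitc nu -> unitc mu ->
  bloch r lam nu mu X = s%:C *: X -> X = 0.

Lemma shifted_op r lam nu mu s :
  shifted r lam nu mu s = op nu mu (fun i j => lam * pot r i j - s).
Proof.
apply/funext => X; rewrite /shifted /bloch /op -addrA; congr (_ + _).
by apply/matrixP => i j; rewrite !mxE rmorphB mulrBl.
Qed.

Lemma shifted_eq0 r lam nu mu s X :
  shifted r lam nu mu s X = 0 <-> bloch r lam nu mu X = s%:C *: X.
Proof. by rewrite /shifted; split=> [/eqP|->]; rewrite ?subrr ?subr_eq0 // => /eqP. Qed.

Lemma regular_inertia r lam s nu mu : regular r lam s -> unitc nu -> unitc mu ->
  exists2 k, (k <= 9)%N & inertia k (shifted r lam nu mu s).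
Proof.
move=> reg unu umu; apply: inertia_exists.
- by rewrite shifted_op; exact: op_selfadj.
- by rewrite shifted_op; exact: op_linear.
- by move=> X /shifted_eq0; exact: reg.
Qed.

Lemma inertia_near r lam s k (a b t : R) :
  inertia k (shifted r lam (cis (t * a)) (cis (t * b)) s) ->
  \forall u \near t, inertia k (shifted r lam (cis (u * a)) (cis (u * b)) s).
Proof.
move=> /inertia_open[e e0 h].
have d0 : 0 < e ^+ 2 / 144 by rewrite divr_gt0 ?exprn_gt0.
have near c : \forall u \near t,
    ipc (cis (u * c) - cis (t * c)) (cis (u * c) - cis (t * c)) <= e ^+ 2 / 144.
  have : (fun u => u * c) @ t --> t * c by apply: cvgMl.
  by move=> ct; exact: (ct _ (cis_near _ d0)).
near=> u; apply: h => X; rewrite !shifted_op.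
apply: (@op_form_diff _ _ _ _ _ _ _ (e ^+ 2 / 144)) => //; try exact: unitc_cis.
- by rewrite mulrC divfK.
- by near: u; exact: near.
- by near: u; exact: near.
Unshelve. all: by end_near. Qed.

(** Along the path u |-> (cis (u a), cis (u b)) from (1, 1) to (nu, mu) the set of u with inertia k
    is open, and so is its complement, because every block has an inertia and only one. Being
    nonempty, this set is the whole line. *)
Lemma inertia_const r lam s k : regular r lam s -> (k <= 9)%N ->
  inertia k (shifted r lam 1 1 s) -> forall nu mu, unitc nu -> unitc mu ->
  inertia k (shifted r lam nu mu s).
Proof.
move=> reg k9 i1 nu mu /cis_surj[a _ ->] /cis_surj[b _ ->].
pose f (u : R) := shifted r lam (cis (u * a)) (cis (u * b)) s.
have : [set u | inertia k (f u)] = [set: R].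
  have /connected_intervalP : is_interval [set: R] by [].
  apply.
  - by exists 0; rewrite /= /f !mul0r cis0.
  - exists [set u | inertia k (f u)]; last by rewrite setTI.
    by rewrite openE => u; exact: inertia_near.
  exists [set u | inertia k (f u)]; last by rewrite setTI.
  rewrite -[X in closed X]setCK; apply: open_closedC; rewrite openE => u /= nu'.
  have [j j9 ij] := regular_inertia reg (unitc_cis (u * a)) (unitc_cis (u * b)).
  apply: filterS (inertia_near ij) => v iv ik; apply: nu'.
  have jk := inertia_uniq j9 k9 iv ik; rewrite jk in ij; exact: ij.
by move/seteqP => [_ /(_ 1 I)]; rewrite /= /f !mul1r.
Qed.

Lemma regular_count r lam s : regular r lam s -> exists2 k, (k <= 9)%N &
  forall nu mu, unitc nu -> unitc mu -> inertia k (shifted r lam nu mu s).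
Proof.
have u1 : unitc (1 : C) by rewrite -cis0 unitc_cis.
move=> reg; have [k k9 ik] := regular_inertia reg u1 u1.
exists k; first exact: k9.
exact: (inertia_const reg k9 ik).
Qed.

Lemma irregular_eigen r lam b : ~ regular r lam b -> exists nu mu X,
  [/\ unitc nu, unitc mu, X != 0 & bloch r lam nu mu X = b%:C *: X].
Proof.
move=> nreg; apply: contrapT => no; apply: nreg => nu mu X unu umu eX.
by apply/eqP; apply: contrapT => /negP X0; apply: no; exists nu, mu, X; split.
Qed.

Lemma eigen_line r lam nu mu s b X : X != 0 -> bloch r lam nu mu X = b%:C *: X ->
  (b < s -> neg_space 1 (shifted r lam nu mu s)) /\
  (s < b -> pos_space 1 (shifted r lam nu mu s)).
Proof.
move=> X0 eX; have d1 : \dim <[X]> = 1%N by rewrite dim_vline X0.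
have form Y : Y \in <[X]>%VS -> ip (shifted r lam nu mu s Y) Y = (b - s) * nsq Y.
  move=> /vlineP[t ->]; rewrite /shifted /bloch (clinearZ _ _ (@op_linear _ _ _ _)).
  rewrite -/(bloch r lam nu mu X) eX scalerA mulrC -scalerA -scalerBl -rmorphB.
  by rewrite ipRl.
split=> bs; exists <[X]>%VS; rewrite d1; split=> [//|Y YX Y0]; rewrite form //.
  by rewrite pmulr_llt0 ?nsq_gt0 // subr_lt0.
by rewrite pmulr_lgt0 ?nsq_gt0 // subr_gt0.
Qed.

Definition counted r lam s k := (k <= 9)%N /\
  forall nu mu, unitc nu -> unitc mu -> inertia k (shifted r lam nu mu s).

Lemma counted_neg r lam s k j nu mu : counted r lam s k -> unitc nu -> unitc mu ->
  neg_space j (shifted r lam nu mu s) -> (j <= k)%N.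
Proof.
move=> [k9 ik] unu umu [U [dU hU]]; exact: inertia_neg_le (ik _ _ unu umu) k9 dU hU.
Qed.

Lemma counted_pos r lam s k j nu mu : counted r lam s k -> (j <= 9)%N -> unitc nu ->
  unitc mu -> pos_space j (shifted r lam nu mu s) -> (k <= 9 - j)%N.
Proof.
move=> [k9 ik] j9 unu umu [U [dU hU]].
by apply: inertia_pos_le (ik _ _ unu umu) k9 _ hU; rewrite subKn.
Qed.

(** At the momenta where b is an eigenvalue the count grows strictly from s1 to s2, and neither
    count depends on the momenta. *)
Lemma counted_jump r lam s1 s2 b k1 k2 : counted r lam s1 k1 -> counted r lam s2 k2 ->
  s1 < b -> b < s2 -> ~ regular r lam b -> (k1 < k2)%N.
Proof.
move=> [k19 i1] c2 s1b bs2 /irregular_eigen[nu [mu [X [unu umu X0 eX]]]].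
have [U [dU hU]] := inertia_eigen (@op_selfadj _ _ _ _) (@op_linear _ _ _ _) s1b X0 eX
  (i1 nu mu unu umu).
apply: (counted_neg c2 unu umu); exists U; split; first exact: dU.
by move=> Y YU Y0; exact: (hU Y s2 YU Y0 bs2).
Qed.

Lemma counted_bottom r lam s k a : counted r lam s k -> a < s -> ~ regular r lam a ->
  (0 < k)%N.
Proof.
move=> ck as_ /irregular_eigen[nu [mu [X [unu umu X0 eX]]]].
by apply: (counted_neg ck unu umu); apply: (eigen_line s X0 eX).1.
Qed.

Lemma counted_top r lam s k b : counted r lam s k -> s < b -> ~ regular r lam b ->
  (k < 9)%N.
Proof.
move=> ck sb /irregular_eigen[nu [mu [X [unu umu X0 eX]]]].
have := counted_pos ck (isT : (1 <= 9)%N) unu umu ((eigen_line s X0 eX).2 sb).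
by rewrite subn1.
Qed.

Lemma unitc1 : unitc (1 : C). Proof. by rewrite -cis0 unitc_cis. Qed.
Lemma unitcN1 : unitc (-1 : C). Proof. by rewrite /unitc /ipc /= mulrNN oppr0 mulr0 addr0 mulr1. Qed.

(** If - lam / 4 were regular, its count would be at most 3 by momentum (0, 0) and at least 4 by
    (pi, pi); for lam / 4 it would be at least 5 and at most 4. *)
Lemma band_edges r lam : r_bounds r -> 0 < lam -> 100 * lam <= 1 ->
  ~ regular r lam (- (lam / 4)) /\ ~ regular r lam (lam / 4).
Proof.
move=> rb l0 l1; split=> /regular_count[k k9 ik]; have ck := conj k9 ik : counted r lam _ k.
  have h1 := counted_pos ck (isT : (6 <= 9)%N) unitc1 unitc1 (pos6_00 rb l0 l1).
  have h2 : (4 <= k)%N by apply: (counted_neg ck unitcN1 unitcN1 (neg4_pp rb l0 _)); lra.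
  by have := leq_trans h2 h1.
have h1 := counted_neg ck unitc1 unitc1 (neg5_00 rb l0).
have h2 : (k <= 4)%N.
  by apply: (counted_pos ck (isT : (5 <= 9)%N) unitcN1 unitcN1 (pos5_pp rb l0 _)); lra.
by have := leq_trans h1 h2.
Qed.

(* If s < - 7 lam then the count at momentum (0, 0) is 0, which excludes the eigenvalue a;
   otherwise it is already 4 at momentum (pi, pi), as it is at energy 0, which excludes b. *)
Lemma lower_band r lam s a b : r_bounds r -> 0 < lam -> 100 * lam <= 1 ->
  regular r lam 0 -> regular r lam s -> a < s -> s < b -> b < 0 ->
  ~ regular r lam a -> ~ regular r lam b -> False.
Proof.
move=> rb l0 l1 /regular_count[k0 k09 i0] /regular_count[k k9 ik] as_ sb b0 na nb.
have c0 := conj k09 i0 : counted r lam 0 k0; have ck := conj k9 ik : counted r lam s k.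
case: (ltrP s (- (7 * lam))) => sl.
  have h1 := counted_bottom ck as_ na.
  by have := counted_pos ck (isT : (9 <= 9)%N) unitc1 unitc1 (pos9_00 rb l0 sl); rewrite leqNgt h1.
have h := counted_jump ck c0 sb b0 nb.
have h1 : (4 <= k)%N by apply: (counted_neg ck unitcN1 unitcN1 (neg4_pp rb l0 _)); lra.
have h2 : (k0 <= 4)%N.
  by apply: (counted_pos c0 (isT : (5 <= 9)%N) unitcN1 unitcN1 (pos5_pp rb l0 _)); lra.
by move: h h1 h2; clear; lia.
Qed.

(** Below 1 - 7 lam the count at (pi, pi) is at most 4, already reached at energy 0, so a cannot be
    an eigenvalue in between. From there to 6 - 7 lam the momenta (0, 0) and (0, pi) demand at least
    8 and at most 7. Above, the count is 9 and leaves no room for b. *)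
Lemma upper_band r lam s a b : r_bounds r -> 0 < lam -> 100 * lam <= 1 ->
  regular r lam 0 -> regular r lam s -> 0 < a -> a < s -> s < b ->
  ~ regular r lam a -> ~ regular r lam b -> False.
Proof.
move=> rb l0 l1 /regular_count[k0 k09 i0] /regular_count[k k9 ik] a0 as_ sb na nb.
have c0 := conj k09 i0 : counted r lam 0 k0; have ck := conj k9 ik : counted r lam s k.
case: (ltrP s (1 - 7 * lam)) => sl.
  have h := counted_jump c0 ck a0 as_ na.
  have h1 : (4 <= k0)%N by apply: (counted_neg c0 unitcN1 unitcN1 (neg4_pp rb l0 _)); lra.
  have h2 : (k <= 4)%N.
    exact: (counted_pos ck (isT : (5 <= 9)%N) unitcN1 unitcN1 (pos5_pp rb l0 sl)).
  by move: h h1 h2; clear; lia.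
case: (ltrP s (6 - 7 * lam)) => sl2.
  have h1 : (8 <= k)%N by apply: (counted_neg ck unitc1 unitc1 (neg8_00 rb l0 _)); lra.
  have h2 := counted_pos ck (isT : (2 <= 9)%N) unitc1 unitcN1 (pos2_0p rb l0 sl2).
  by have := leq_trans h1 h2.
have h1 : (9 <= k)%N by apply: (counted_neg ck unitcN1 unitcN1 (neg9_pp rb l0 _)); lra.
by have := counted_top ck sb nb; rewrite ltnNge h1.
Qed.

Lemma middle_gap : exists2 lam0 : R, 0 < lam0 & forall r t lam, r_bounds r ->
  `|t| <= 1 / 10 -> 0 < lam -> lam <= lam0 -> regular r lam (lam * t).
Proof.
have [lam0 lam00 h] := @gap_kernel R; exists lam0 => // r t lam rb t1 l0 l1 nu mu X unu umu.
move=> /shifted_eq0; rewrite shifted_op.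
rewrite (_ : (fun i j => _) = (fun i j => lam * (pot r i j - t))); last first.
  by apply/funext => i; apply/funext => j; rewrite mulrBr.
by apply: kernel_gauge unu umu => nu' mu' Y *; apply: (h r t lam nu' mu' Y).
Qed.

End Bands.

Section Uniform.
Context {R : realType}.
Local Notation C := R[i].
Local Notation V := 'M[C]_3.
Implicit Types (X : V) (r lam s : R) (nu mu : C).

Lemma regular_bound r lam s nu mu : regular r lam s -> unitc nu -> unitc mu ->
  exists2 c, 0 < c & forall X, c * nsq X <= nsq (shifted r lam nu mu s X).
Proof.
move=> reg unu umu; apply: kernel_lower_bound.
- by rewrite shifted_op; exact: op_selfadj.
- by rewrite shifted_op; exact: op_linear.
- by move=> X /shifted_eq0; exact: reg.
Qed.

(** Each momentum has a constant c0 of its own; by continuity anything below c0 / 4 serves a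
    neighbourhood, and compactness of the square [-pi, pi]^2 leaves one constant. The radius c0 /
    576 makes the error 144 * c0 / 576 = c0 / 4. *)
Lemma regular_uniform r lam s : regular r lam s -> exists2 c, 0 < c &
  forall nu mu X, unitc nu -> unitc mu -> c * nsq X <= nsq (shifted r lam nu mu s X).
Proof.
move=> reg; pose K := `[- pi, pi]%classic `*` `[- pi, pi]%classic : set (R * R).
pose P (c : R) (p : R * R) := forall X,
  c * nsq X <= nsq (shifted r lam (cis p.1) (cis p.2) s X).
have cK : compact K by apply: compact_setX; exact: segment_compact.
have near_P : \forall c \near 0^'+, K `<=` P c.
  apply: ((compact_near_coveringP K).1 cK _ 0^'+ P _) => -[a b] _.
  have [c0 c00 hc] := regular_bound reg (unitc_cis a) (unitc_cis b).
  have d0 : 0 < c0 / 576 by apply: divr_gt0 c00 _; rewrite ltr0n.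
  have hc4 : \forall c \near 0^'+, c < c0 / 4 by apply: nbhs_right_lt; rewrite divr_gt0.
  exists ([set q : R * R | ipc (cis q.1 - cis a) (cis q.1 - cis a) <= c0 / 576 /\
    ipc (cis q.2 - cis b) (cis q.2 - cis b) <= c0 / 576], [set c | c < c0 / 4]).
    split => //=; exists ([set u | ipc (cis u - cis a) (cis u - cis a) <= c0 / 576],
      [set v | ipc (cis v - cis b) (cis v - cis b) <= c0 / 576]); last by [].
    by split; exact: cis_near.
  move=> [[u v] c] /= [[hu hv] hcc] X /=.
  have X0 := nsq_ge0 X.
  have hX := hc X; rewrite !shifted_op in hX *.
  have := op_diff_le (fun i j => lam * pot r i j - s) X (unitc_cis a) (unitc_cis v) hu hv.
  move: hX; set y := op (cis a) _ _ X; set x := op (cis u) _ _ X => hX hd.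
  have := nsqD_le x (y - x); rewrite addrC subrK -[nsq (y - x)](_ : nsq (x - y) = _); last first.
    by rewrite -opprB /nsq ipNl ipNr opprK.
  have : c * nsq X <= c0 / 4 * nsq X by rewrite ler_wpM2r // ltW.
  move: hX hd X0; rewrite !mulr2n.
  rewrite (_ : 144 * (c0 / 576) * nsq X = c0 / 4 * nsq X); last by field.
  rewrite (_ : c0 * nsq X = 4 * (c0 / 4 * nsq X)); last by field.
  move: (c0 / 4 * nsq X) => p; move: (c * nsq X) => q; move: (nsq y) (nsq x) (nsq (x - y)).
  by clear => *; lra.
have [e e0 eP] : exists2 e, 0 < e & K `<=` P e.
  near (0 : R)^'+ => e; exists e => //; near: e.
  exact: near_P.
exists e => // nu mu X /cis_surj[a ha ->] /cis_surj[b hb ->].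
by apply: (eP (a, b)); split; rewrite /= in_itv.
Unshelve. all: by end_near.
Qed.

End Uniform.

(** * From blocks to l2 *)

Section Windows.
Context {R : realType}.
Local Notation C := R[i].
Implicit Types (psi : Z2 -> C) (w N : nat).

(* Windows start at multiples of 3 so that residues mod 3 are those of the index. *)
Definition pt w k : int := k%:Z - (3 * w)%:Z.
Definition window w N : seq Z2 := [seq (pt w k, pt w l) | k <- iota 0 N, l <- iota 0 N].

Definition wsum w N psi : R := \sum_(k < N) \sum_(l < N)
  ipc (psi (pt w k, pt w l)) (psi (pt w k, pt w l)).

(** Bounds on all window sums stand in for the squared l2 norm: they involve finite sums only and
    pass to pointwise limits. *)
Definition le2 psi (M : R) := forall w N, wsum w N psi <= M.

Lemma wsumE w N psi : wsum w N psi = \sum_(n <- window w N) ipc (psi n) (psi n).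
Proof.
rewrite /wsum /window big_allpairs_dep /= -[N in iota 0 N]subn0 -/(index_iota 0 N) big_mkord.
by apply: eq_bigr => k _; rewrite big_mkord.
Qed.

Lemma window_uniq w N : uniq (window w N).
Proof.
apply: allpairs_uniq; rewrite ?iota_uniq // => -[a b] [c d] _ _ /= [/addIr[-> /addIr[->]]].
by [].
Qed.

Lemma window_finite w N : finite_set [set` window w N].
Proof. by apply/finite_seqP; exists (window w N). Qed.

Lemma window_sub (s : seq Z2) : exists w N, {subset s <= window w N}.
Proof.
elim: s => [|[a b] s [w [N sub]]]; first by exists 0%N, 0%N.
exists (w + absz a + absz b)%N, (N + 6 * (w + absz a + absz b) + 1)%N => x.
have mem (v M : nat) (c d : int) : 0 <= c + (3 * v)%:Z < M%:Z -> 0 <= d + (3 * v)%:Z < M%:Z ->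
    (c, d) \in window v M.
  move=> hc hd; apply/allpairsP; exists (absz (c + (3 * v)%:Z), absz (d + (3 * v)%:Z)).
  by rewrite /= !mem_iota /pt; split; [lia|lia|congr (_, _); lia].
rewrite inE => /orP[/eqP ->|/sub/allpairsP[[k l] /= [hk hl ->]]].
  by apply: mem; lia.
by move: hk hl; rewrite !mem_iota /pt => hk hl; apply: mem; lia.
Qed.

Lemma normc2E (z : C) : nrm z ^+ 2 = ipc z z.
Proof. exact: normc_sqr. Qed.

Lemma le2_sqnorm psi (M : R) : le2 psi M <-> (ell2_sqnorm psi <= M%:E)%E.
Proof.
split=> [h|h w N].
  apply: ge_ereal_sup => _ [A [Afin _] <-].
  have [s As] := (finite_seqP A).1 Afin; have [w [N sub]] := window_sub s.
  apply: le_trans (_ : (\sum_(n \in [set` window w N]) (nrm (psi n) ^+ 2)%:E <= _)%E).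
    apply: lee_fsum_nneg_subset => //.
    - exact: window_finite.
    - by move=> n; rewrite As !inE /=; exact: sub.
    - by move=> n _; rewrite lee_fin sqr_ge0.
  rewrite -fsbig_seq ?window_uniq // sumEFin lee_fin.
  rewrite (eq_bigr (fun n => ipc (psi n) (psi n))) => [|n _]; last exact: normc2E.
  by rewrite -wsumE.
rewrite -lee_fin; apply: le_trans h; apply: esum_ge; exists [set` window w N].
  by split=> //; exact: window_finite.
rewrite -fsbig_seq ?window_uniq // sumEFin lee_fin wsumE le_eqVlt; apply/orP; left; apply/eqP.
by apply: eq_bigr => n _; rewrite normc2E.
Qed.

Lemma wsum_ge0 w N psi : 0 <= wsum w N psi.
Proof. by apply: sumr_ge0 => k _; apply: sumr_ge0 => l _; exact: ipcc_ge0. Qed.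

Lemma le2_ge0 psi M : le2 psi M -> 0 <= M.
Proof. by move=> /(_ 0%N 0%N); apply: le_trans; exact: wsum_ge0. Qed.

Lemma sqnorm_ge0 psi : (0 <= ell2_sqnorm psi)%E.
Proof. by apply: esum_ge0 => n _; rewrite lee_fin sqr_ge0. Qed.

Lemma ell2P psi : ell2 psi <-> exists M, le2 psi M.
Proof.
split=> [h|[M /le2_sqnorm h]]; last by apply: le_lt_trans h _; rewrite ltry.
exists (fine (ell2_sqnorm psi)); apply/le2_sqnorm; rewrite fineK //.
by rewrite ge0_fin_numE ?sqnorm_ge0.
Qed.

Lemma le2_norm psi : ell2 psi -> le2 psi (ell2_norm psi ^+ 2).
Proof.
move=> h; apply/le2_sqnorm; rewrite sqr_sqrtr ?fine_ge0 ?sqnorm_ge0 // fineK //.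
by rewrite ge0_fin_numE ?sqnorm_ge0.
Qed.

Lemma norm_le2 psi M : le2 psi M -> ell2_norm psi <= Num.sqrt M.
Proof.
move=> h; rewrite ler_sqrt ?(le2_ge0 h) // -lee_fin fineK; first exact/le2_sqnorm.
have : ell2 psi by apply/ell2P; exists M.
by rewrite ge0_fin_numE ?sqnorm_ge0.
Qed.

Lemma bounded_le2 (B : (Z2 -> C) -> Z2 -> C) K : 0 <= K ->
  (forall psi M, le2 psi M -> le2 (B psi) (K * M)) ->
  (forall psi, ell2 psi -> ell2 (B psi)) /\
  exists M : R, forall psi, ell2 psi -> ell2_norm (B psi) <= M * ell2_norm psi.
Proof.
move=> K0 hB; split.
  by move=> psi /ell2P[M h]; apply/ell2P; exists (K * M); exact: hB.
exists (Num.sqrt K) => psi /le2_norm/hB/norm_le2; rewrite sqrtrM // sqrtr_sqr.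
by rewrite ger0_norm // sqrtr_ge0.
Qed.

End Windows.

(** * The Bloch transform of finitely supported sequences *)

Section Fourier.
Context {R : realType}.
Local Notation C := R[i].
Local Notation V := 'M[C]_3.
Implicit Types (psi : Z2 -> C) (w N : nat).

Definition row3 (f : int -> C) (n : int) : C := f (n - 1) + f n + f (n + 1).
Definition box psi : Z2 -> C :=
  fun n => row3 (fun n1 => row3 (fun n2 => psi (n1, n2)) n.2) n.1.

(** Adding the centre completes the eight neighbours to a full 3 x 3 square, a product of two
    one-dimensional sums. This is why -1 is the distinguished energy and the blocks describe H +
    1. *)
Lemma laplacianE psi : laplacian_sqn psi = fun n => box psi n - psi n.
Proof.
apply/funext => -[n m]; rewrite /laplacian_sqn.
pose s : seq Z2 := [:: (n - 1, m - 1); (n - 1, m); (n - 1, m + 1); (n, m - 1); (n, m + 1);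
  (n + 1, m - 1); (n + 1, m); (n + 1, m + 1)].
have us : uniq s by rewrite /s /= !inE !xpair_eqE; lia.
rewrite (_ : [set _ | _] = [set` s]); last first.
  apply/seteqP; split=> -[a b] /=; rewrite /sqn_adj /s /= !inE !xpair_eqE; lia.
rewrite -fsbig_seq // /s /= !big_cons big_nil /box /row3 /=.
by ring.
Qed.

(** The exponent is the position k in the window, not the site; the two powers differ by the fixed
    factor z^(3 w). *)
Definition tr1 (z : C) w N (f : int -> C) (i : 'I_3) : C :=
  \sum_(k < N) (if (k %% 3 == i)%N then z ^+ k * f (pt w k) else 0).

Lemma modS (k : nat) (i : 'I_3) : ((k.+1 %% 3)%N == nat_of_ord (i + 1)) = ((k %% 3)%N == i).
Proof.
have [[e01 e12 e20] _] := ord3_add 0.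
by elim/ord3P: i; rewrite ?(e01, e12, e20) /=; apply/eqP/eqP; lia.
Qed.

Lemma modB (i : 'I_3) k : ((k.+1 %% 3)%N == i) = ((k %% 3)%N == nat_of_ord (i - 1)).
Proof. by rewrite -[X in nat_of_ord X](subrK 1 i) modS. Qed.

Lemma tr1_left z w N f (i j : 'I_3) : (forall k, ((k.+1 %% 3)%N == i) = ((k %% 3)%N == j)) ->
  f (pt w 0 - 1) = 0 -> f (pt w N) = 0 ->
  tr1 z w N.+1 (fun n => f (n - 1)) i = z * tr1 z w N.+1 f j.
Proof.
move=> ij f0 fN; rewrite /tr1 big_ord_recl /= f0 mulr0 if_same add0r.
rewrite big_ord_recr /= fN mulr0 if_same addr0 mulr_sumr; apply: eq_bigr => k _.
rewrite /bump /= add1n ij; case: ifP => _; last by rewrite mulr0.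
by rewrite exprS -mulrA; congr (_ * (_ * f _)); rewrite /pt; lia.
Qed.

Lemma tr1_right z w N f (i j : 'I_3) : (forall k, ((k.+1 %% 3)%N == j) = ((k %% 3)%N == i)) ->
  unitc z -> f (pt w 0) = 0 -> f (pt w N + 1) = 0 ->
  tr1 z w N.+1 (fun n => f (n + 1)) i = conjc z * tr1 z w N.+1 f j.
Proof.
move=> ij uz f0 fN; rewrite /tr1 big_ord_recr /= fN mulr0 if_same addr0.
rewrite [in RHS]big_ord_recl /= f0 mulr0 if_same add0r mulr_sumr; apply: eq_bigr => k _.
rewrite /bump /= add1n ij; case: ifP => _; last by rewrite mulr0.
rewrite exprS !mulrA [conjc z * z]mulrC unitc_conj // mul1r; congr (_ * f _).
by rewrite /pt; lia.
Qed.

Lemma tr1_add z w N f g i : tr1 z w N (fun n => f n + g n) i = tr1 z w N f i + tr1 z w N g i.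
Proof.
rewrite /tr1 -big_split; apply: eq_bigr => k _ /=.
by case: ifP => _; rewrite ?mulrDr ?addr0.
Qed.

(** A shift of the argument multiplies by z or its conjugate and moves to the neighbouring residue
    class; the four boundary conditions remove the terms that a shift pushes across the ends of the
    window. *)
Lemma tr1_row3 z w N f i : unitc z -> f (pt w 0 - 1) = 0 -> f (pt w 0) = 0 ->
  f (pt w N) = 0 -> f (pt w N + 1) = 0 ->
  tr1 z w N.+1 (row3 f) i = tr1 z w N.+1 f i + z * tr1 z w N.+1 f (i - 1) +
    conjc z * tr1 z w N.+1 f (i + 1).
Proof.
move=> uz h1 h2 h3 h4; rewrite -(tr1_left z (modB i) h1 h3) -(tr1_right (modS ^~ i) uz h2 h4) -!tr1_add; congr (tr1 _ _ _ _ _).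
by apply/funext => n; rewrite /row3; ring.
Qed.

(* The Bloch wave nu^n mu^(-m) X(n mod 3, m mod 3) is dual to this transform. *)
Definition transform (nu mu : C) w N psi : V :=
  \matrix_(i, j) tr1 (conjc nu) w N (fun n => tr1 mu w N (fun m => psi (n, m)) j) i.

Definition inside (a : nat) w N psi := forall n m : int,
  ~~ [&& a%:Z <= n + (3 * w)%:Z, n + (3 * w)%:Z < N%:Z - a%:Z,
   a%:Z <= m + (3 * w)%:Z & m + (3 * w)%:Z < N%:Z - a%:Z] -> psi (n, m) = 0.

Lemma tr1_0 z w N i : tr1 z w N (fun=> 0) i = 0.
Proof. by rewrite /tr1 big1 // => k _; rewrite mulr0 if_same. Qed.

Lemma eq_tr1 z w N f g i : f =1 g -> tr1 z w N f i = tr1 z w N g i.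
Proof. by move=> fg; congr (tr1 _ _ _ _ _); apply/funext. Qed.

Lemma transform_box nu mu w N psi : unitc nu -> unitc mu -> inside 1 w N.+1 psi ->
  transform nu mu w N.+1 (box psi) = J nu *m transform nu mu w N.+1 psi *m J mu.
Proof.
move=> unu umu ins; apply/matrixP => i j.
have mJ (A : V) : (A *m J mu) i j = A i j + mu * A i (j - 1) + conjc mu * A i (j + 1).
  rewrite -[A *m _]trmxK trmx_mul J_tr mxE J_mulE !mxE addrAC; congr (_ + _ * _ + _).
  exact: conjcK.
rewrite mJ !J_mulE !mxE.
pose g j' n := tr1 mu w N.+1 (fun m => psi (n, m)) j'.
pose G n := g j n + mu * g (j - 1) n + conjc mu * g (j + 1) n.
have line n : tr1 mu w N.+1 (row3 (fun m => psi (n, m))) j = G n.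
  by rewrite tr1_row3 //; apply: ins; rewrite /pt; lia.
have inner n : tr1 mu w N.+1 (fun m => box psi (n, m)) j = row3 G n.
  by rewrite [RHS]/row3 -!line -!tr1_add.
rewrite (eq_tr1 _ _ _ _ inner).
have G0 n : ~~ (1%:Z <= n + (3 * w)%:Z < N.+1%:Z - 1) -> G n = 0.
  move=> hn; have g0 j' : g j' n = 0.
    rewrite /g -(tr1_0 mu w N.+1 j'); apply: eq_tr1 => m; apply: ins; lia.
  by rewrite /G !g0 !mulr0 !addr0.
have tG i' : tr1 (conjc nu) w N.+1 G i' = tr1 (conjc nu) w N.+1 (g j) i' +
    mu * tr1 (conjc nu) w N.+1 (g (j - 1)) i' + conjc mu * tr1 (conjc nu) w N.+1 (g (j + 1)) i'.
  rewrite /G !tr1_add; congr (_ + _ + _); rewrite /tr1 mulr_sumr; apply: eq_bigr => k _;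
    by case: ifP => _; rewrite ?mulr0 // mulrCA.
have [e1 e2 e3 e4] : [/\ G (pt w 0 - 1) = 0, G (pt w 0) = 0, G (pt w N) = 0 & G (pt w N + 1) = 0].
  by split; apply: G0; rewrite /pt; lia.
rewrite (tr1_row3 i (unitc_conjc unu) e1 e2 e3 e4) conjcK.
by rewrite !tG; ring.
Qed.

Lemma tr1Z z w N (a : C) f i : tr1 z w N (fun n => a * f n) i = a * tr1 z w N f i.
Proof.
by rewrite /tr1 mulr_sumr; apply: eq_bigr => k _; case: ifP => _; rewrite ?mulr0 // mulrCA.
Qed.

Lemma transformD nu mu w N psi phi : transform nu mu w N (fun n => psi n + phi n) =
  transform nu mu w N psi + transform nu mu w N phi.
Proof.
apply/matrixP => i j; rewrite !mxE -tr1_add; apply: eq_tr1 => n; exact: tr1_add.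
Qed.

Lemma transformZ nu mu w N (a : C) psi : transform nu mu w N (fun n => a * psi n) =
  a *: transform nu mu w N psi.
Proof.
apply/matrixP => i j; rewrite !mxE -tr1Z; apply: eq_tr1 => n; exact: tr1Z.
Qed.

Definition cellwise (V : Z2 -> R) (W : 'I_3 -> 'I_3 -> R) := forall w k l (i j : 'I_3),
  (k %% 3)%N = i -> (l %% 3)%N = j -> V (pt w k, pt w l) = W i j.

Lemma transform_mul nu mu w N (V : Z2 -> R) W psi : cellwise V W ->
  transform nu mu w N (fun n => (V n)%:C * psi n) = had W (transform nu mu w N psi).
Proof.
move=> VW; apply/matrixP => i j; rewrite !mxE -tr1Z /tr1; apply: eq_bigr => k _.
case: ifP => // /eqP ki; congr (_ * _); rewrite mulr_sumr; apply: eq_bigr => l _.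
by case: ifP => [/eqP lj|_]; rewrite ?mulr0 // (VW _ _ _ _ _ ki lj) mulrCA.
Qed.

Definition Hop (V : Z2 -> R) (s : R) psi : Z2 -> C :=
  fun n => box psi n + (V n)%:C * psi n + (- s)%:C * psi n.

Lemma transform_Hop nu mu w N V W s psi : unitc nu -> unitc mu -> inside 1 w N.+1 psi ->
  cellwise V W -> transform nu mu w N.+1 (Hop V s psi) =
  op nu mu (fun i j => W i j - s) (transform nu mu w N.+1 psi).
Proof.
move=> unu umu ins VW; rewrite /Hop 2!transformD transformZ (transform_mul _ _ _ _ _ VW).
rewrite transform_box // /op -addrA; congr (_ + _).
by apply/matrixP => i j; rewrite !mxE rmorphB rmorphN mulrBl mulNr.
Qed.

Lemma inside_Hop a w N V s psi : inside a.+1 w N psi -> inside a w N (Hop V s psi).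
Proof.
move=> ins n m h; rewrite /Hop /box /row3 /=.
by rewrite !(ins _ _ _) ?mulr0 ?addr0 //; lia.
Qed.

Lemma insideW a w N psi : inside a.+1 w N psi -> inside a w N psi.
Proof. by move=> ins n m h; apply: ins; lia. Qed.

End Fourier.

(** * Parseval's identity on dyadic windows *)

Section Parseval.
Context {R : realType}.
Local Notation C := R[i].
Local Notation V := 'M[C]_3.
Implicit Types (psi : Z2 -> C) (w N : nat).

Lemma root_unitc (z : C) n : (0 < n)%N -> z ^+ n = 1 -> unitc z.
Proof.
move=> n0 zn; have ipcX k : ipc (z ^+ k) (z ^+ k) = ipc z z ^+ k.
  elim: k => [|k IH]; first by rewrite !expr0 /ipc /= mulr0 addr0 mulr1.
  by rewrite !exprS ipcM IH.
have := ipcX n; rewrite zn /ipc /= mulr0 addr0 mulr1 -/(ipc z z) => /esym /eqP.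
by rewrite pexpr_eq1 ?ipcc_ge0.
Qed.

(** Repeated square roots of -1. The order of z divides 2^(k+1), and a smaller power of two would
    give z^(2^k) = 1 instead of -1. *)
Lemma two_power_root k : exists z : C, (2 ^ k.+1).-primitive_root z.
Proof.
have [z zk] : exists z : C, z ^+ (2 ^ k) = -1.
  elim: k => [|k [z zk]]; first by exists (-1); rewrite expn0 expr1.
  by exists (sqrtC z); rewrite expnS exprM sqrtCK.
have z1 : z ^+ (2 ^ k.+1) = 1 by rewrite expnS mulnC exprM zk sqrrN expr1n.
have [m pm /dvdn_pfactor] := prim_order_exists (expn_gt0 2 k.+1) z1.
case=> // j jk mE; exists z; rewrite mE in pm.
move: jk; rewrite leq_eqVlt => /orP[/eqP <- //|]; rewrite ltnS => jk.
have : z ^+ (2 ^ k) = 1.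
  by apply/eqP; rewrite -(prim_order_dvd pm) dvdn_exp2l.
rewrite zk => /eqP; rewrite eq_sym -subr_eq0 opprK -mulr2n -mulr_natl mulr1.
by rewrite pnatr_eq0.
Qed.

Lemma ipc_conj (z : C) : (ipc z z)%:C = z * conjc z.
Proof. by case: z => a b; apply/eqP; rewrite eq_complex /ipc /=; apply/andP; split; apply/eqP; ring. Qed.

Lemma parseval (z : C) N (c : 'I_N -> C) : N.-primitive_root z ->
  \sum_(p < N) ipc (\sum_(k < N) (z ^+ p) ^+ k * c k) (\sum_(k < N) (z ^+ p) ^+ k * c k) =
  N%:R * \sum_k ipc (c k) (c k).
Proof.
move=> pz; have N0 := prim_order_gt0 pz; have z1 := prim_expr_order pz.
have zz : z * conjc z = 1 by apply: unitc_conj; exact: root_unitc N0 z1.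
have geo (k l : 'I_N) : \sum_(p < N) (z ^+ k * conjc z ^+ l) ^+ p = (N%:R * (k == l)%:R : C).
  have [<-|kl] := eqVneq k l.
    rewrite mulr1 -exprMn zz expr1n (eq_bigr (fun=> 1)) => [|p _]; last by rewrite expr1n.
    by rewrite sumr_const card_ord.
  rewrite mulr0; set y := _ * _; have y1 : y != 1.
    apply: contra_neq kl => y1; apply/val_inj/eqP => /=.
    suff : z ^+ k == z ^+ l by rewrite (eq_prim_root_expr pz) !modn_small.
    by rewrite -[z ^+ l]mul1r -y1 /y -mulrA [_ * z ^+ l]mulrC -exprMn zz expr1n mulr1.
  have : (y - 1) * \sum_(p < N) y ^+ p = 0.
    have zc1 : conjc z ^+ N = 1 by rewrite -rmorphXn z1 rmorph1.
    by rewrite -subrX1 exprMn exprAC z1 [X in _ * X - 1]exprAC zc1 !expr1n mulr1 subrr.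
  by move/eqP; rewrite mulf_eq0 subr_eq0 (negPf y1) => /eqP.
apply: (@complexI R); rewrite rmorphM rmorph_nat !rmorph_sum /=.
transitivity (\sum_(p < N) \sum_(k < N) \sum_(l < N) (c k * conjc (c l)) * (z ^+ k * conjc z ^+ l) ^+ p).
  apply: eq_bigr => p _; rewrite ipc_conj rmorph_sum /= mulr_suml; apply: eq_bigr => k _.
  rewrite mulr_sumr; apply: eq_bigr => l _; rewrite rmorphM /= !rmorphXn /=.
  by rewrite exprMn -!exprM [(k * p)%N]mulnC [(l * p)%N]mulnC; ring.
rewrite exchange_big mulr_sumr; apply: eq_bigr => k _ /=; rewrite exchange_big /=.
rewrite (bigD1 k) //= [X in _ + X]big1 => [|l lk]; last first.
  by rewrite -mulr_sumr geo eq_sym (negPf lk) !mulr0.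
by rewrite -mulr_sumr geo eqxx mulr1 addr0 ipc_conj mulrC.
Qed.

Lemma sum_residue N (f : 'I_N -> R) : \sum_(i < 3) \sum_(k < N | (k %% 3 == i)%N) f k =
  \sum_k f k.
Proof.
rewrite (exchange_big_dep xpredT) //=; apply: eq_bigr => k _.
rewrite (bigD1 (Ordinal (ltn_pmod k (isT : (0 < 3)%N)))) //= big1 ?addr0 // => i.
by move=> /andP[/eqP ki]; rewrite -val_eqE /= ki eqxx.
Qed.

(** The identity is applied to f cut down to one residue class mod 3, so N requires no relation to 3
    and may be a power of two. *)
Lemma tr1_parseval (z : C) w N f i : N.-primitive_root z ->
  \sum_(p < N) ipc (tr1 (z ^+ p) w N f i) (tr1 (z ^+ p) w N f i) =
  N%:R * \sum_(k < N | (k %% 3 == i)%N) ipc (f (pt w k)) (f (pt w k)).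
Proof.
move=> pz; pose c (k : 'I_N) := if (k %% 3 == i)%N then f (pt w k) else 0.
have tE p : tr1 (z ^+ p) w N f i = \sum_(k < N) (z ^+ p) ^+ k * c k.
  by rewrite /tr1 /c; apply: eq_bigr => k _; case: ifP; rewrite ?mulr0.
under eq_bigr do rewrite tE.
rewrite (parseval _ pz) [in RHS]big_mkcond; congr (_ * _); apply: eq_bigr => k _.
by rewrite /c; case: ifP => // _; rewrite /ipc /= mulr0 addr0.
Qed.

Lemma transform_parseval (z : C) w N psi : N.-primitive_root z ->
  \sum_(p < N) \sum_(q < N) nsq (transform (z ^+ p) (z ^+ q) w N psi) =
  N%:R ^+ 2 * wsum w N psi.
Proof.
move=> pz; have pz' : N.-primitive_root (conjc z).
  by rewrite fmorph_primitive_root.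
have step i j : \sum_(p < N) \sum_(q < N) ipc (transform (z ^+ p) (z ^+ q) w N psi i j)
   (transform (z ^+ p) (z ^+ q) w N psi i j) =
   N%:R ^+ 2 * \sum_(k < N | (k %% 3 == i)%N) \sum_(l < N | (l %% 3 == j)%N)
     ipc (psi (pt w k, pt w l)) (psi (pt w k, pt w l)).
  rewrite exchange_big /=.
  transitivity (\sum_(q < N) N%:R * \sum_(k < N | (k %% 3 == i)%N)
    ipc (tr1 (z ^+ q) w N (fun m => psi (pt w k, m)) j) (tr1 (z ^+ q) w N (fun m => psi (pt w k, m)) j)).
    apply: eq_bigr => q _; rewrite -(tr1_parseval w (fun n => tr1 (z ^+ q) w N (fun m => psi (n, m)) j) i pz').
    apply: eq_bigr => p _.
    by rewrite !mxE !rmorphXn.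
  rewrite -mulr_sumr expr2 -mulrA; congr (_ * _); rewrite exchange_big /= mulr_sumr.
  by apply: eq_bigr => k _; rewrite tr1_parseval.
have -> : wsum w N psi = \sum_(i < 3) \sum_(j < 3) \sum_(k < N | (k %% 3 == i)%N)
    \sum_(l < N | (l %% 3 == j)%N) ipc (psi (pt w k, pt w l)) (psi (pt w k, pt w l)).
  rewrite /wsum -(sum_residue (fun k => \sum_l _)); apply: eq_bigr => i _.
  by rewrite [RHS]exchange_big; apply: eq_bigr => k _; rewrite sum_residue.
rewrite mulr_sumr; transitivity (\sum_(i < 3) \sum_(j < 3) \sum_(p < N) \sum_(q < N)
  ipc (transform (z ^+ p) (z ^+ q) w N psi i j) (transform (z ^+ p) (z ^+ q) w N psi i j)).
  rewrite /nsq; under eq_bigr do under eq_bigr do rewrite ipE.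
  under eq_bigr do rewrite exchange_big /=.
  rewrite exchange_big /=; apply: eq_bigr => i _.
  under eq_bigr do rewrite exchange_big /=.
  by rewrite exchange_big.
by apply: eq_bigr => i _; rewrite mulr_sumr; apply: eq_bigr => j _; exact: step.
Qed.

End Parseval.

(** * From blockwise bounds to bounds on square-summable sequences *)

Section Contraction.
Context {R : realType}.
Local Notation C := R[i].
Local Notation V := 'M[C]_3.
Implicit Types (psi : Z2 -> C) (w N : nat).

(** For S = f^2 + y^2 one has S^2 <= K S, hence |X - S X / K|^2 <= |X|^2 - <S X, X> / K, and S >= c
    + y^2. *)
Lemma symbol_contraction (f : V -> V) (a c y K : R) X : selfadj f ->
  (forall X, c * nsq X <= nsq (f X)) -> (forall X, nsq (f X) <= a * nsq X) ->
  K = a + 2 * y ^+ 2 -> 0 <= a -> 0 < K ->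
  nsq (X + (- K^-1)%:C *: (f (f X) + (y ^+ 2)%:C *: X)) <= (1 - (c + y ^+ 2) / K) * nsq X.
Proof.
move=> fs fc fa KE a0 K0; pose S := f (f X) + (y ^+ 2)%:C *: X.
have SX : ip X S = nsq (f X) + y ^+ 2 * nsq X by rewrite ipDr -fs ipRr.
have SS : nsq S <= K * (nsq (f X) + y ^+ 2 * nsq X).
  rewrite nsqD ipRr fs -/(nsq (f X)) nsqR mulr2n.
  have := fa (f X); have := fa X; have y0 := sqr_ge0 y.
  have : 0 <= a * (y ^+ 2 * nsq X) by exact: mulr_ge0 a0 (mulr_ge0 y0 (nsq_ge0 _)).
  have : 0 <= (y ^+ 2) ^+ 2 * nsq X by exact: mulr_ge0 (sqr_ge0 _) (nsq_ge0 _).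
  rewrite KE; move: (nsq (f (f X))) (nsq (f X)) (nsq X) (y ^+ 2) => p q r z; clear.
  rewrite (_ : (a + 2 * z) * (q + z * r) = a * q + a * (z * r) + 2 * (z * q) + 2 * (z ^+ 2 * r)); last by ring.
  by move: (a * q) (a * (z * r)) (z * q) (z ^+ 2 * r) (a * r) => *; lra.
rewrite -/S nsqD ipRr nsqR SX sqrrN mulr2n.
have h1 : K^-1 ^+ 2 * nsq S <= K^-1 * (nsq (f X) + y ^+ 2 * nsq X).
  rewrite expr2 -mulrA ler_pM2l ?invr_gt0 // ler_pdivrMl //.
have h2 : K^-1 * ((c + y ^+ 2) * nsq X) <= K^-1 * (nsq (f X) + y ^+ 2 * nsq X).
  by rewrite ler_pM2l ?invr_gt0 // mulrDl lerD2r.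
rewrite (_ : (1 - (c + y ^+ 2) / K) * nsq X = nsq X - K^-1 * ((c + y ^+ 2) * nsq X)); last by ring.
rewrite mulNr; move: h1 h2; move: (K^-1 ^+ 2 * nsq S); move: (K^-1 * (nsq (f X) + y ^+ 2 * nsq X)).
move: (K^-1 * ((c + y ^+ 2) * nsq X)); move: (nsq X).
by clear => *; lra.
Qed.

Definition near2 (d : int) (n m : Z2) := (`|n.1 - m.1| <= d) && (`|n.2 - m.2| <= d).
Definition local (d : int) (F : (Z2 -> C) -> Z2 -> C) := forall psi phi n,
  (forall m, near2 d n m -> psi m = phi m) -> F psi n = F phi n.

Lemma local_Hop Q s : local 1 (Hop Q s).
Proof.
move=> psi phi [n m] h; rewrite /Hop /box /row3 /=.
by rewrite !h //; rewrite /near2 /=; lia.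
Qed.

Lemma local_comp d e F G : local d F -> local e G -> local (d + e) (fun psi => F (G psi)).
Proof.
move=> hF hG psi phi n h; apply: hF => m nm; apply: hG => k mk; apply: h.
by move: nm mk; rewrite /near2; lia.
Qed.

Lemma sum_subset (I : eqType) (s t : seq I) (F : I -> R) : uniq s -> uniq t ->
  {subset s <= t} -> (forall i, 0 <= F i) -> \sum_(i <- s) F i <= \sum_(i <- t) F i.
Proof.
move=> us ut st F0; rewrite [leRHS](bigID (mem s)) /= -[X in _ <= X + _]big_filter.
have ps : perm_eq [seq i <- t | i \in s] s.
  apply: uniq_perm; rewrite ?filter_uniq // => i; rewrite mem_filter.
  by case: (boolP (i \in s)) => // /st.
by rewrite (perm_big _ ps) lerDl sumr_ge0.
Qed.

Definition trunc w N psi : Z2 -> C := fun n =>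
  if [&& 2%:Z <= n.1 + (3 * w)%:Z, n.1 + (3 * w)%:Z < N%:Z - 2%:Z,
   2%:Z <= n.2 + (3 * w)%:Z & n.2 + (3 * w)%:Z < N%:Z - 2%:Z] then psi n else 0.

Lemma inside_trunc w N psi : inside 2 w N (trunc w N psi).
Proof. by move=> n m; rewrite /trunc /= => /negPf ->. Qed.

Lemma wsum_trunc w N psi : wsum w N (trunc w N psi) <= wsum w N psi.
Proof.
apply: ler_sum => k _; apply: ler_sum => l _; rewrite /trunc; case: ifP => // _.
by rewrite {1}/ipc /= mulr0 addr0 ipcc_ge0.
Qed.

Lemma window_mem w N (n : Z2) : (n \in window w N) =
  [&& 0 <= n.1 + (3 * w)%:Z, n.1 + (3 * w)%:Z < N%:Z,
   0 <= n.2 + (3 * w)%:Z & n.2 + (3 * w)%:Z < N%:Z].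
Proof.
apply/allpairsP/idP => [[[k l] /= []]|].
  by rewrite !mem_iota => hk hl -> /=; rewrite /pt; lia.
case: n => n m /= h; exists (absz (n + (3 * w)%:Z), absz (m + (3 * w)%:Z)).
by rewrite /= !mem_iota /pt; split; [lia|lia|congr (_, _); lia].
Qed.

(* Finite range reduces the bound to finitely supported sequences on windows of dyadic
   size, where roots of unity give an exact Parseval identity. *)
Lemma le2_local (F : (Z2 -> C) -> Z2 -> C) (p : R) : local 2 F -> 0 <= p ->
  (forall w k psi, inside 2 w (2 ^ k.+1) psi ->
    wsum w (2 ^ k.+1) (F psi) <= p * wsum w (2 ^ k.+1) psi) ->
  forall psi M, le2 psi M -> le2 (F psi) (p * M).
Proof.
(* The larger window exceeds the small one by 6 sites on one side and at least 11 on the other; 4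
   suffice, 2 for the range of F and 2 for the margin cut off by [trunc]. *)
move=> Floc p0 Fw psi M hM w N; set N' := (2 ^ (N + 16).+1)%N.
have NN' : (N + 16 < N')%N by rewrite (leq_trans _ (ltn_expl _ (isT : (1 < 2)%N))).
have sub : {subset window w N <= window (w + 2) N'}.
  by move=> n; rewrite !window_mem; lia.
have eqF n : n \in window w N -> F psi n = F (trunc (w + 2) N' psi) n.
  move=> nw; apply: Floc => m; rewrite /near2 /trunc; move: nw; rewrite window_mem.
  by move=> nw nm; case: ifP => //; lia.
apply: le_trans (_ : wsum (w + 2) N' (F (trunc (w + 2) N' psi)) <= _); last first.
  apply: le_trans (Fw _ _ _ _) _; first exact: inside_trunc.
  by rewrite ler_wpM2l // (le_trans (wsum_trunc _ _ _)).
rewrite !wsumE big_seq (eq_bigr (fun n => ipc (F (trunc (w + 2) N' psi) n)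
  (F (trunc (w + 2) N' psi) n))) => [|n nw]; last by rewrite eqF.
rewrite -big_seq; apply: sum_subset; rewrite ?window_uniq // => n; exact: ipcc_ge0.
Qed.

Lemma wsum_symbol (F : (Z2 -> C) -> Z2 -> C) (G : C -> C -> V -> V) (p : R) w k psi :
  (forall nu mu, unitc nu -> unitc mu ->
    transform nu mu w (2 ^ k.+1) (F psi) = G nu mu (transform nu mu w (2 ^ k.+1) psi)) ->
  (forall nu mu X, unitc nu -> unitc mu -> nsq (G nu mu X) <= p * nsq X) ->
  wsum w (2 ^ k.+1) (F psi) <= p * wsum w (2 ^ k.+1) psi.
Proof.
move=> FG Gp; have [z pz] := @two_power_root R k.
have N0 := prim_order_gt0 pz; have uz := root_unitc N0 (prim_expr_order pz).
have uX j : unitc (z ^+ j).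
  elim: j => [|j IH]; first by rewrite expr0 unitc1.
  by rewrite exprS unitcM.
have N2 : 0 < ((2 ^ k.+1)%N%:R : R) ^+ 2 by rewrite exprn_gt0 // ltr0n.
rewrite -(ler_pM2l N2) -(transform_parseval _ _ pz) mulrCA -(transform_parseval _ _ pz).
rewrite mulr_sumr; apply: ler_sum => i _; rewrite mulr_sumr; apply: ler_sum => j _.
by rewrite FG // Gp.
Qed.

End Contraction.

(** * Neumann series with pointwise limits *)

Section Neumann.
Context {R : realType}.
Local Notation C := R[i].
Implicit Types (psi phi : Z2 -> C) (w N : nat).

Definition linop (F : (Z2 -> C) -> Z2 -> C) := forall (a : C) psi phi,
  F (fun n => a * psi n + phi n) = (fun n => a * F psi n + F phi n).

(** Finite-range operators are continuous for pointwise convergence and [le2] bounds survive it,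
    which is all that the series requires. *)
Definition ptcvg (u : nat -> Z2 -> C) psi := forall n,
  (Re (u k n) @[k --> \oo] --> Re (psi n)) /\ (Im (u k n) @[k --> \oo] --> Im (psi n)).

Lemma le2_pt psi M n : le2 psi M -> ipc (psi n) (psi n) <= M.
Proof.
move=> h; have [w [N sub]] := window_sub [:: n].
apply: le_trans (h w N); rewrite wsumE.
have := @sum_subset R _ [:: n] _ (fun n => ipc (psi n) (psi n)) isT (window_uniq w N) sub.
by rewrite big_seq1; apply => k; exact: ipcc_ge0.
Qed.

Lemma ptcvgD u v psi phi : ptcvg u psi -> ptcvg v phi ->
  ptcvg (fun k n => u k n + v k n) (fun n => psi n + phi n).
Proof.
move=> hu hv n; have [ur ui] := hu n; have [vr vi] := hv n.
have reD (a b : C) : Re (a + b) = Re a + Re b by case: a b => ? ? [].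
have imD (a b : C) : Im (a + b) = Im a + Im b by case: a b => ? ? [].
by split; [rewrite reD; under eq_fun do rewrite reD | rewrite imD; under eq_fun do rewrite imD];
  exact: cvgD.
Qed.

Lemma ptcvgZ (a : Z2 -> C) u psi : ptcvg u psi ->
  ptcvg (fun k n => a n * u k n) (fun n => a n * psi n).
Proof.
move=> hu n; have [ur ui] := hu n; case: (a n) => x y.
have reM (b : C) : Re ((x +i* y) * b) = x * Re b - y * Im b by case: b.
have imM (b : C) : Im ((x +i* y) * b) = x * Im b + y * Re b by case: b.
by split; [rewrite reM; under eq_fun do rewrite reM | rewrite imM; under eq_fun do rewrite imM];
  [apply: cvgB | apply: cvgD]; apply: cvgM => //; exact: cvg_cst.
Qed.

Lemma ptcvg_unique u psi phi : ptcvg u psi -> ptcvg u phi -> psi = phi.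
Proof.
move=> h1 h2; apply/funext => n; have [r1 i1] := h1 n; have [r2 i2] := h2 n.
apply/eqP; rewrite eq_complex; apply/andP; split; apply/eqP.
  exact: (cvg_unique _ r1 r2).
exact: (cvg_unique _ i1 i2).
Qed.

Lemma ptcvg_wsum u psi w N : ptcvg u psi -> wsum w N (u k) @[k --> \oo] --> wsum w N psi.
Proof.
move=> h; rewrite /wsum; apply: cvg_big; first exact: add_continuous.
move=> k _; apply: cvg_big; first exact: add_continuous.
move=> l _; have [r i] := h (pt w k, pt w l).
by rewrite /ipc; apply: cvgD; apply: cvgM.
Qed.

Lemma ptcvg_le2 u psi M : ptcvg u psi -> (forall k, le2 (u k) M) -> le2 psi M.
Proof.
move=> h hM w N; have c := @ptcvg_wsum _ _ w N h; rewrite -(cvg_lim _ c) //.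
by apply: limr_le; [exact: cvgP c | apply: nearW => k; exact: hM].
Qed.

Lemma le2_add psi phi A B e : 0 < e -> le2 psi A -> le2 phi B ->
  le2 (fun n => psi n + phi n) ((1 + e) * (A + B / e)).
Proof.
move=> e0 hA hB w N; apply: (@le_trans _ _ ((1 + e) * (wsum w N psi + wsum w N phi / e))).
  rewrite /wsum mulr_suml -big_split mulr_sumr; apply: ler_sum => k _.
  rewrite mulr_suml -big_split mulr_sumr; apply: ler_sum => l _ /=.
  apply: ipcD_le => //; [exact: ltW | exact: ipcc_ge0 | | by rewrite mul1r | ].
    by rewrite divr_ge0 ?ipcc_ge0 // ltW.
  by rewrite mulrC divfK // gt_eqF.
rewrite ler_pM2l ?addr_gt0 //; apply: lerD => //.
by rewrite ler_pM2r ?invr_gt0.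
Qed.

Lemma le2Z a psi M : le2 psi M -> le2 (fun n => a * psi n) (ipc a a * M).
Proof.
move=> h w N; apply: le_trans (ler_wpM2l (ipcc_ge0 a) (h w N)).
rewrite /wsum mulr_sumr; apply: ler_sum => k _; rewrite mulr_sumr.
by apply: ler_sum => l _; rewrite ipcM.
Qed.

Section Inverse.
Context (T : (Z2 -> C) -> Z2 -> C) (p : R).
Context (Tlin : linop T) (p0 : 0 <= p) (p1 : p < 1).
Context (Tle2 : forall psi M, le2 psi M -> le2 (T psi) (p * M)).
Context (Tcvg : forall u psi, ptcvg u psi -> ptcvg (fun k => T (u k)) (T psi)).

Definition partial k psi : Z2 -> C := fun n => \sum_(j < k) iter j T psi n.

Definition neumann psi : Z2 -> C := fun n =>
  limn (fun k => Re (partial k psi n)) +i* limn (fun k => Im (partial k psi n)).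

Lemma linop0 : T (fun=> 0) = (fun=> 0).
Proof.
have := Tlin (-1) (fun=> 0) (fun=> 0); rewrite mulr0 addr0 => h.
by apply/funext => n; have := congr1 (@^~ n) h => /=; rewrite mulN1r addNr.
Qed.

Lemma linopD psi phi : T (fun n => psi n + phi n) = (fun n => T psi n + T phi n).
Proof.
have := Tlin 1 psi phi; under eq_fun do rewrite mul1r.
by move=> ->; apply/funext => n; rewrite mul1r.
Qed.

Lemma T_partial k psi : T (partial k psi) = (fun n => \sum_(j < k) iter j.+1 T psi n).
Proof.
elim: k => [|k IH].
  rewrite /partial; under eq_fun do rewrite big_ord0.
  by rewrite linop0; apply/funext => n; rewrite big_ord0.
have -> : partial k.+1 psi = (fun n => partial k psi n + iter k T psi n).
  by apply/funext => n; rewrite /partial big_ord_recr.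
by rewrite linopD IH; apply/funext => n; rewrite big_ord_recr.
Qed.

Lemma partialS k psi : partial k.+1 psi = (fun n => psi n + T (partial k psi) n).
Proof. by apply/funext => n; rewrite T_partial /partial big_ord_recl. Qed.

Lemma partial_linear k : linop (partial k).
Proof.
elim: k => [|k IH] a psi phi.
  by apply/funext => n; rewrite /partial !big_ord0 mulr0 addr0.
by rewrite !partialS IH Tlin; apply/funext => n; ring.
Qed.

Lemma iter_le2 k psi M : le2 psi M -> le2 (iter k T psi) (p ^+ k * M).
Proof.
by elim: k psi M => [|k IH] psi M h; rewrite ?expr0 ?mul1r // exprS -mulrA; apply: Tle2; exact: IH.
Qed.

(** With these values (1 + e) p <= 1 - e, and kappa solves (1 - e) kappa + (1 + e) / e = kappa, the
    fixed point of the recursion for the squared norms of the partial sums. *)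
Let e := (1 - p) / 2.
Let kappa := (1 + e) / e ^+ 2.

Let e0 : 0 < e. Proof. by rewrite /e; move: p1; lra. Qed.

Lemma kappa_ge0 : 0 <= kappa.
Proof. by rewrite /kappa divr_ge0 ?sqr_ge0 // addr_ge0 // ltW. Qed.

Lemma partial_le2 k psi M : le2 psi M -> le2 (partial k psi) (kappa * M).
Proof.
move=> h; have M0 := le2_ge0 h; elim: k => [|k IH].
  move=> w N; have -> : wsum w N (partial 0 psi) = 0.
    rewrite /wsum big1 // => i _.
    by rewrite big1 // => j _; rewrite /partial big_ord0 /ipc /= mulr0 addr0.
  exact: mulr_ge0 kappa_ge0 M0.
rewrite partialS => w N.
have -> : (fun n => psi n + T (partial k psi) n) = (fun n => T (partial k psi) n + psi n).
  by apply/funext => n; rewrite addrC.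
apply: le_trans (le2_add e0 (Tle2 IH) h w N) _.
rewrite (_ : (1 + e) * _ = ((1 + e) * p) * (kappa * M) + (1 + e) / e * M); last by ring.
have kM : 0 <= kappa * M by rewrite mulr_ge0 ?kappa_ge0.
have h1 : (1 + e) * p <= 1 - e.
  rewrite -subr_ge0 (_ : 1 - e - _ = (1 - p) ^+ 2 / 2); last by rewrite /e; field.
  by rewrite divr_ge0 ?sqr_ge0.
have h2 := ler_wpM2r kM h1; apply: le_trans (lerD h2 (lexx _)) _.
rewrite le_eqVlt; apply/orP; left; apply/eqP; rewrite /kappa.
by field; rewrite gt_eqF.
Qed.

Lemma Re_sum k (F : nat -> C) : Re (\sum_(j < k) F j) = \sum_(j < k) Re (F j).
Proof. by apply: (big_morph (@complex.Re R)) => // -[a b] [c d]. Qed.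

Lemma Im_sum k (F : nat -> C) : Im (\sum_(j < k) F j) = \sum_(j < k) Im (F j).
Proof. by apply: (big_morph (@complex.Im R)) => // -[a b] [c d]. Qed.

(** [p] governs squares, so the terms themselves decay with ratio sqrt p. *)
Lemma geometric_cvg (f : nat -> R) M : 0 <= M -> (forall k, f k ^+ 2 <= p ^+ k * M) ->
  cvgn (series f).
Proof.
move=> M0 fM; pose q := Num.sqrt p; have q0 : 0 <= q by exact: sqrtr_ge0.
have q2 : q ^+ 2 = p by rewrite sqr_sqrtr.
have q1 : `|q| < 1.
  by rewrite ger0_norm // -(@ltr_sqr _ q 1) ?nnegrE // q2 expr1n.
apply: normed_cvg; apply: (@series_le_cvg _ _ (geometric (Num.sqrt M) q)).
- by move=> k; exact: normr_ge0.
- by move=> k; rewrite /geometric /= mulr_ge0 ?sqrtr_ge0 ?exprn_ge0.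
- move=> k; rewrite /geometric /= -(@ler_sqr _ `|f k|) ?nnegrE ?mulr_ge0 ?sqrtr_ge0 ?exprn_ge0 //.
  by rewrite real_normK ?num_real // exprMn sqr_sqrtr // -exprM mulnC exprM q2 mulrC.
exact: is_cvg_geometric_series.
Qed.

Lemma iter_pt k psi M n : le2 psi M -> Re (iter k T psi n) ^+ 2 <= p ^+ k * M /\
  Im (iter k T psi n) ^+ 2 <= p ^+ k * M.
Proof.
move=> /(iter_le2 k)/le2_pt - /(_ n); rewrite /ipc -!expr2 => h; split; apply: le_trans h.
  by rewrite lerDl sqr_ge0.
by rewrite lerDr sqr_ge0.
Qed.

Lemma neumann_cvg psi : ell2 psi -> ptcvg (partial ^~ psi) (neumann psi).
Proof.
move=> /ell2P[M h] n; have M0 := le2_ge0 h; rewrite /neumann /=; split.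
  have -> : (fun k => Re (partial k psi n)) = series (fun j => Re (iter j T psi n)).
    by apply/funext => k; rewrite /partial (Re_sum k (fun j => iter j T psi n)) /series /= big_mkord.
  by apply: (geometric_cvg M0) => k; exact: (iter_pt k n h).1.
have -> : (fun k => Im (partial k psi n)) = series (fun j => Im (iter j T psi n)).
  by apply/funext => k; rewrite /partial (Im_sum k (fun j => iter j T psi n)) /series /= big_mkord.
by apply: (geometric_cvg M0) => k; exact: (iter_pt k n h).2.
Qed.

Lemma neumann_le2 psi M : le2 psi M -> le2 (neumann psi) (kappa * M).
Proof.
move=> h; have hp : ell2 psi by apply/ell2P; exists M.
by apply: ptcvg_le2 (neumann_cvg hp) _ => k; exact: partial_le2.
Qed.

Lemma ptcvg_shift u psi : ptcvg u psi -> ptcvg (fun k => u k.+1) psi.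
Proof.
move=> h n; have [r i] := h n; split.
  by rewrite (cvg_shiftS (fun k => Re (u k n))).
by rewrite (cvg_shiftS (fun k => Im (u k n))).
Qed.

Lemma neumann_right psi : ell2 psi ->
  neumann psi = (fun n => psi n + T (neumann psi) n).
Proof.
move=> h; have hc := neumann_cvg h; apply: ptcvg_unique (ptcvg_shift hc) _.
have -> : (fun k => partial k.+1 psi) = (fun k n => psi n + T (partial k psi) n).
  by apply/funext => k; exact: partialS.
by apply: ptcvgD (Tcvg hc) => n; split; exact: cvg_cst.
Qed.

Lemma iter_cvg0 psi : ell2 psi -> ptcvg (fun k => iter k T psi) (fun=> 0).
Proof.
move=> /ell2P[M h] n; have M0 := le2_ge0 h; split; apply: cvg_series_cvg_0.
  by apply: (geometric_cvg M0) => k; exact: (iter_pt k n h).1.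
by apply: (geometric_cvg M0) => k; exact: (iter_pt k n h).2.
Qed.

Lemma neumann_left psi : ell2 psi -> neumann (fun n => -1 * T psi n + psi n) = psi.
Proof.
move=> h; have h' : ell2 (fun n => -1 * T psi n + psi n).
  have /ell2P[M hM] := h; apply/ell2P; exists ((1 + 1) * (ipc (-1) (-1) * (p * M) + M / 1)).
  by apply: le2_add => //; apply: le2Z; exact: Tle2.
apply: ptcvg_unique (neumann_cvg h') _.
(* Telescoping: the partial sums of (1 - T) psi are psi - T^k psi. *)
have -> : (fun k => partial k (fun n => -1 * T psi n + psi n)) =
    (fun k n => psi n + -1 * iter k T psi n).
  apply/funext => k; rewrite partial_linear; apply/funext => n.
  have -> : partial k (T psi) n = \sum_(j < k) iter j.+1 T psi n.
    by apply: eq_bigr => j _; rewrite -iterSr.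
  rewrite /partial; elim: k => [|k IH]; first by rewrite !big_ord0 /=; ring.
  by rewrite !big_ord_recr /= mulrDr addrACA IH /=; ring.
have cst : ptcvg (fun _ => psi) psi by move=> n; split; exact: cvg_cst.
have := ptcvgD cst (ptcvgZ (fun=> -1) (iter_cvg0 h)).
rewrite (_ : (fun n => psi n + _) = psi) //.
by apply/funext => n; rewrite mulr0 addr0.
Qed.

Lemma neumann_linear (a : C) psi phi : ell2 psi -> ell2 phi ->
  ell2 (fun n => a * psi n + phi n) ->
  neumann (fun n => a * psi n + phi n) = (fun n => a * neumann psi n + neumann phi n).
Proof.
move=> h1 h2 h; apply: ptcvg_unique (neumann_cvg h) _.
have -> : (fun k => partial k (fun n => a * psi n + phi n)) =
    (fun k n => a * partial k psi n + partial k phi n).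
  by apply/funext => k; exact: partial_linear.
by apply: ptcvgD (neumann_cvg h2); exact: (ptcvgZ (fun=> a) (neumann_cvg h1)).
Qed.

End Inverse.

End Neumann.

(** * Construction of the resolvent *)

Section Resolvent.
Context {R : realType}.
Local Notation C := R[i].
Local Notation V := 'M[C]_3.
Implicit Types (psi phi : Z2 -> C) (w N : nat).

Lemma op_bound (W : 'I_3 -> 'I_3 -> R) : exists2 a : R, 0 <= a &
  forall nu mu X, unitc nu -> unitc mu -> nsq (op nu mu W X) <= a * nsq X.
Proof.
pose b := \sum_i \sum_j W i j ^+ 2.
have b0 : 0 <= b by apply: sumr_ge0 => i _; apply: sumr_ge0 => j _; exact: sqr_ge0.
have Wb i j : W i j ^+ 2 <= b.
  rewrite /b (bigD1 i) //= (bigD1 j) //= -addrA lerDl addr_ge0 //.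
    by apply: sumr_ge0 => k _; exact: sqr_ge0.
  by apply: sumr_ge0 => k _; apply: sumr_ge0 => l _; exact: sqr_ge0.
exists (2 * (9 * 9 + b)); first by rewrite mulr_ge0 // addr_ge0.
move=> nu mu X unu umu; apply: le_trans (nsqD_le _ _) _.
have h1 := le_trans (nsq_Jr_le (J nu *m X) umu) (ler_wpM2l (ler0n _ 9) (nsq_J_le X unu)).
have h2 := nsq_had X Wb.
rewrite !mulr2n (_ : 2 * (9 * 9 + b) * nsq X = 2 * (9 * (9 * nsq X)) + 2 * (b * nsq X)); last by ring.
by move: h1 h2; move: (b * nsq X); move: (nsq (_ *m _)) (nsq (had _ _)) (nsq X); clear => *; lra.
Qed.

Lemma local_le (d e : int) (F : (Z2 -> C) -> Z2 -> C) : d <= e -> local d F -> local e F.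
Proof.
by move=> de h psi phi n hn; apply: h => m nm; apply: hn; move: nm; rewrite /near2; lia.
Qed.

Lemma Hop_linear Q s : linop (@Hop R Q s).
Proof. by move=> a psi phi; apply/funext => n; rewrite /Hop /box /row3; ring. Qed.

Lemma ptcvg_Hop Q s u psi : ptcvg u psi -> ptcvg (fun k => @Hop R Q s (u k)) (Hop Q s psi).
Proof.
move=> h; rewrite /Hop; apply: ptcvgD; last exact: (ptcvgZ (fun=> (- s)%:C) h).
apply: ptcvgD; last exact: (ptcvgZ (fun n => (Q n)%:C) h).
have sh (g : Z2 -> Z2) : ptcvg (fun k n => u k (g n)) (fun n => psi (g n)) by move=> n; exact: h.
by rewrite /box /row3; do 2![apply: ptcvgD]; do ?[apply: ptcvgD]; exact: (sh (fun n => (_, _))).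
Qed.

Lemma transform_Hop2 nu mu w k (Q : Z2 -> R) W s psi : unitc nu -> unitc mu ->
  inside 1 w (2 ^ k.+1) psi -> cellwise Q W ->
  transform nu mu w (2 ^ k.+1) (Hop Q s psi) =
  op nu mu (fun i j => W i j - s) (transform nu mu w (2 ^ k.+1) psi).
Proof.
move=> unu umu; have [N ->] : exists N, (2 ^ k.+1 = N.+1)%N.
  by exists (2 ^ k.+1).-1; rewrite prednK // expn_gt0.
exact: transform_Hop.
Qed.

Lemma Hop_le2 (Q : Z2 -> R) W s : cellwise Q W -> exists2 a : R, 0 <= a &
  forall psi M, le2 psi M -> le2 (Hop Q s psi) (a * M).
Proof.
move=> QW; have [a a0 ha] := op_bound (fun i j => W i j - s); exists a => //.
apply: le2_local => //; first by apply: local_le (@local_Hop R Q s).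
move=> w k psi ins; apply: (@wsum_symbol _ _ (fun nu mu => op nu mu (fun i j => W i j - s))) => //.
by move=> nu mu unu umu; apply: transform_Hop2 => //; exact: insideW.
Qed.

(* 1 - K^-1 ((H + 1 - s)^2 + y^2), a contraction whose Neumann series inverts
   (H - z) (H - conj z). *)
Definition Top Q s (y K : R) psi : Z2 -> C := fun n =>
  psi n + (- K^-1)%:C * (Hop Q s (Hop Q s psi) n + (y ^+ 2)%:C * psi n).

Lemma Top_linear Q s y K : linop (Top Q s y K).
Proof.
move=> a psi phi; apply/funext => n; rewrite /Top !Hop_linear; ring.
Qed.

Lemma ptcvg_Top Q s y K u psi : ptcvg u psi ->
  ptcvg (fun k => Top Q s y K (u k)) (Top Q s y K psi).
Proof.
move=> h; apply: ptcvgD => //; apply: (ptcvgZ (fun=> (- K^-1)%:C)); apply: ptcvgD.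
  by do 2!apply: ptcvg_Hop.
exact: (ptcvgZ (fun=> (y ^+ 2)%:C) h).
Qed.

Lemma local_Top Q s y K : local 2 (Top Q s y K).
Proof.
move=> psi phi n h; have l := local_comp (@local_Hop R Q s) (@local_Hop R Q s).
by rewrite /Top (l psi phi n h) h // /near2 !subrr normr0.
Qed.

Lemma Top_le2 (Q : Z2 -> R) W s (a c y K : R) : cellwise Q W ->
  (forall nu mu X, unitc nu -> unitc mu ->
    c * nsq X <= nsq (op nu mu (fun i j => W i j - s) X)) ->
  (forall nu mu X, unitc nu -> unitc mu ->
    nsq (op nu mu (fun i j => W i j - s) X) <= a * nsq X) ->
  K = a + 2 * y ^+ 2 -> 0 <= a -> 0 < K -> 0 <= 1 - (c + y ^+ 2) / K ->
  forall psi M, le2 psi M -> le2 (Top Q s y K psi) ((1 - (c + y ^+ 2) / K) * M).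
Proof.
move=> QW hc ha KE a0 K0 p0; apply: le2_local => //; first exact: local_Top.
move=> w k psi ins; pose A nu mu := op nu mu (fun i j => W i j - s).
apply: (@wsum_symbol _ _ (fun nu mu X => X + (- K^-1)%:C *: (A nu mu (A nu mu X) + (y ^+ 2)%:C *: X))).
  move=> nu mu unu umu; rewrite /Top transformD transformZ transformD transformZ.
  rewrite !(transform_Hop2 _ unu umu _ QW) //; first exact: insideW.
  exact: inside_Hop.
move=> nu mu X unu umu; apply: (symbol_contraction (a := a)) => //.
- exact: op_selfadj.
- by move=> Y; exact: hc.
- by move=> Y; exact: ha.
Qed.

Definition shiftP Q s (z : C) psi : Z2 -> C := fun n => z * psi n + Hop Q s psi n.

Lemma shiftP_comp Q s (z z' : C) psi : shiftP Q s z (shiftP Q s z' psi) =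
  (fun n => z * z' * psi n + (z + z') * Hop Q s psi n + Hop Q s (Hop Q s psi) n).
Proof. by rewrite /shiftP Hop_linear; apply/funext => n; ring. Qed.

Lemma shiftPZ Q s z a psi : shiftP Q s z (fun n => a * psi n) = (fun n => a * shiftP Q s z psi n).
Proof.
have h := @Hop_linear Q s a psi (fun=> 0); apply/funext => n; rewrite /shiftP.
have -> : (fun n => a * psi n) = (fun n => a * psi n + 0) by apply/funext => m; rewrite addr0.
have h0 : Hop Q s (fun=> 0) = (fun=> 0).
  by apply/funext => m; rewrite /Hop /box /row3 !mulr0 !addr0.
by rewrite h h0; ring.
Qed.

Lemma shift_operatorE Q (x y : R) psi :
  shift_operator (schrodinger_sqn Q) (x +i* y) psi = shiftP Q (1 + x) (- (0 +i* y)) psi.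
Proof.
apply/funext => n; rewrite /shift_operator /schrodinger_sqn laplacianE /shiftP /Hop.
have -> : x +i* y = x%:C + (0 +i* y) by apply/eqP; rewrite eq_complex /= add0r addr0 !eqxx.
rewrite rmorphN rmorphD rmorph1; ring.
Qed.

(** This serves two cases at once: off the real axis y^2 > 0 allows c = 0, and on it the uniform
    lower bound of the blocks provides c > 0. *)
Lemma resolvent_of_bound (Q : Z2 -> R) W (x y c : R) : cellwise Q W -> 0 <= c -> 0 < c + y ^+ 2 ->
  (forall nu mu X, unitc nu -> unitc mu ->
    c * nsq X <= nsq (op nu mu (fun i j => W i j - (1 + x)) X)) ->
  resolvent_set (schrodinger_sqn Q) (x +i* y).
Proof.
move=> QW c0 cy hc; set s := 1 + x in hc *.
have [a a0 ha] := op_bound (fun i j => W i j - s).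
have ca : c <= a.
  have n1 : 0 < nsq (const_mx 1 : V).
    rewrite nsq_gt0; apply/eqP => /matrixP /(_ 0 0); rewrite !mxE => /eqP.
    by rewrite oner_eq0.
  rewrite -(ler_pM2r n1).
  exact: le_trans (hc 1 1 _ unitc1 unitc1) (ha 1 1 _ unitc1 unitc1).
pose K := a + 2 * y ^+ 2; pose p := 1 - (c + y ^+ 2) / K.
have y0 := sqr_ge0 y.
have cK : c + y ^+ 2 <= K by apply: lerD => //; rewrite mulr_natl mulr2n lerDl.
have K0 : 0 < K by exact: lt_le_trans cy cK.
have p0 : 0 <= p.
  by rewrite /p subr_ge0 ler_pdivrMr // mul1r.
have p1 : p < 1 by rewrite /p ltrBlDr ltrDl divr_gt0.
pose T := Top Q s y K.
have Tlin : linop T := @Top_linear Q s y K.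
have Tle : forall psi M, le2 psi M -> le2 (T psi) (p * M).
  exact: (Top_le2 QW hc ha (erefl K) a0 K0 p0).
have Tcvg : forall u psi, ptcvg u psi -> ptcvg (fun k => T (u k)) (T psi).
  by move=> u psi; exact: ptcvg_Top.
pose N := neumann T; pose iy : C := 0 +i* y.
have [b b0 hb] := Hop_le2 s QW.
pose k0 : C := (K^-1)%:C.
pose P z := shiftP Q s z.
pose m := ipc iy iy.
have P_le2 z psi M : le2 psi M -> le2 (P z psi) ((1 + 1) * (ipc z z + b) * M).
  move=> h; have := le2_add ltr01 (le2Z z h) (hb _ _ h).
  by rewrite divr1 -mulrDl mulrA.
have P_ell2 z psi : ell2 psi -> ell2 (P z psi).
  by move=> /ell2P[M h]; apply/ell2P; eexists; exact: P_le2 h.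
have Z_ell2 z psi : ell2 psi -> ell2 (fun n => z * psi n).
  by move=> /ell2P[M h]; apply/ell2P; eexists; exact: le2Z h.
have N_ell2 psi : ell2 psi -> ell2 (N psi).
  by move=> /ell2P[M h]; apply/ell2P; eexists; exact: (neumann_le2 Tlin p0 p1 Tle h).
(* k0 (H + 1 - s + z) (H + 1 - s - z) = 1 - T, because z^2 = - y^2 for both signs of z. *)
have PP z psi : z = iy \/ z = - iy -> (fun n => k0 * P z (P (- z) psi) n) = (fun n => -1 * T psi n + psi n).
  move=> zE; have z2 : z * - z = (y ^+ 2)%:C.
    have -> : z * - z = iy * - iy by case: zE => ->; rewrite ?opprK // mulrC.
    by apply/eqP; rewrite eq_complex /= /iy; apply/andP; split; apply/eqP; ring.
  apply/funext => n; rewrite /P shiftP_comp z2 subrr /T /Top /k0 rmorphN; ring.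
pose B psi := N (fun n => k0 * P iy psi n).
have BA psi : ell2 psi -> B (P (- iy) psi) = psi.
  move=> h; rewrite /B PP; last by left.
  exact: (neumann_left Tlin p0 p1 Tle h).
have AR psi : ell2 psi -> P (- iy) (fun n => P iy (fun n => k0 * N psi n) n) = psi.
  move=> h; have h2 := PP (- iy) (N psi) (or_intror erefl); rewrite /P opprK in h2.
  rewrite /P !shiftPZ h2; apply/funext => n.
  have e : N psi n = psi n + T (N psi) n.
    exact: (congr1 (@^~ n) (neumann_right Tlin p0 p1 Tle Tcvg h)).
  by rewrite [X in _ + X]e; ring.
exists B; split.
  have [B1 B2] : (forall psi, ell2 psi -> ell2 (B psi)) /\
      exists M : R, forall psi, ell2 psi -> ell2_norm (B psi) <= M * ell2_norm psi.
    apply: (bounded_le2 (K := (1 + (1 - p) / 2) / ((1 - p) / 2) ^+ 2 *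
      (ipc k0 k0 * ((1 + 1) * (ipc iy iy + b))))).
      apply: mulr_ge0 (kappa_ge0 p1) (mulr_ge0 (ipcc_ge0 _) (mulr_ge0 _ _)) => //.
      exact: addr_ge0 (ipcc_ge0 _) b0.
    move=> psi M h; have := neumann_le2 Tlin p0 p1 Tle (le2Z k0 (P_le2 iy _ _ h)).
    move: (_ / _ ^+ 2) => q; rewrite -/N -/(B psi) => hB w n; apply: le_trans (hB w n) _.
    by rewrite le_eqVlt; apply/orP; left; apply/eqP; ring.
  split => // al psi phi hpsi hphi; rewrite /B.
  have -> : (fun n => k0 * P iy (fun n => al * psi n + phi n) n) =
      (fun n => al * (k0 * P iy psi n) + k0 * P iy phi n).
    by apply/funext => n; rewrite /P /shiftP Hop_linear; ring.
  have e1 := Z_ell2 k0 _ (P_ell2 iy _ hpsi); have e2 := Z_ell2 k0 _ (P_ell2 iy _ hphi).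
  apply: (neumann_linear Tlin p0 p1 Tle) => //.
  have /ell2P[M1 h1] := Z_ell2 al _ e1; have /ell2P[M2 h2] := e2.
  by apply/ell2P; eexists; exact: le2_add ltr01 h1 h2.
move=> psi h; rewrite !shift_operatorE -/s -/iy -/(P (- iy) _) -/(P (- iy) _); split; first exact: BA.
have hR : ell2 (P iy (fun n => k0 * N psi n)) by apply: P_ell2; apply: Z_ell2; exact: N_ell2.
(* [AR] exhibits a right inverse written differently from the left inverse [B]; substituting it for
   psi under B shows that the two agree. *)
by rewrite -{1}(AR psi h) BA // AR.
Qed.

End Resolvent.

(** * Truncated Bloch waves as Weyl sequences *)

Section Weyl.
Context {R : realType}.
Local Notation C := R[i].
Local Notation V := 'M[C]_3.
Implicit Types (psi phi : Z2 -> C) (w N : nat).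

Definition res3 (k : nat) : 'I_3 := Ordinal (ltn_pmod k (isT : (0 < 3)%N)).

Lemma res3S k : res3 k.+1 = res3 k + 1.
Proof. by apply: val_inj => /=; lia. Qed.

Definition bloch_wave (nu mu : C) (X : V) k l : C :=
  nu ^+ k * conjc mu ^+ l * X (res3 k) (res3 l).

Lemma ipcX (z : C) k : unitc z -> ipc (z ^+ k) (z ^+ k) = 1.
Proof.
move=> /eqP u; elim: k => [|k IH]; first by rewrite expr0 /ipc /= mulr0 addr0 mulr1.
by rewrite exprS ipcM u IH mulr1.
Qed.

Lemma bloch_wave_ipc nu mu X k l : unitc nu -> unitc mu ->
  ipc (bloch_wave nu mu X k l) (bloch_wave nu mu X k l) =
  ipc (X (res3 k) (res3 l)) (X (res3 k) (res3 l)).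
Proof.
by move=> unu umu; rewrite /bloch_wave !ipcM !ipcX ?unitc_conjc // !mul1r.
Qed.

Lemma bloch_wave_eq nu mu W X s k l : unitc nu -> unitc mu -> op nu mu W X = s%:C *: X ->
  \sum_(a < 3) \sum_(b < 3) bloch_wave nu mu X (k + a) (l + b) +
  (W (res3 k.+1) (res3 l.+1))%:C * bloch_wave nu mu X k.+1 l.+1 =
  s%:C * bloch_wave nu mu X k.+1 l.+1.
Proof.
move=> unu umu; pose i := res3 k.+1; pose j := res3 l.+1; move/matrixP/(_ i j) => h0.
have mJ (A : V) : (A *m J mu) i j = A i j + mu * A i (j - 1) + conjc mu * A i (j + 1).
  rewrite -[A *m _]trmxK trmx_mul J_tr mxE J_mulE !mxE addrAC; congr (_ + _ * _ + _).
  exact: conjcK.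
have : (J nu *m X *m J mu) i j + (W i j)%:C * X i j = s%:C * X i j by move: h0; rewrite !mxE.
rewrite mJ !J_mulE => h.
have i1 : res3 k = i - 1 by rewrite /i res3S addrK.
have i2 : res3 k.+2 = i + 1 by rewrite res3S.
have j1 : res3 l = j - 1 by rewrite /j res3S addrK.
have j2 : res3 l.+2 = j + 1 by rewrite res3S.
have n1 := unitc_conj unu; have m1 := unitc_conj umu.
have nk : nu ^+ k = nu ^+ k.+1 * conjc nu by rewrite exprSr -mulrA n1 mulr1.
have ml : conjc mu ^+ l = conjc mu ^+ l.+1 * mu by rewrite exprSr -mulrA [_ * mu]mulrC m1 mulr1.
have nk2 : nu ^+ k.+2 = nu ^+ k.+1 * nu by rewrite exprSr.
have ml2 : conjc mu ^+ l.+2 = conjc mu ^+ l.+1 * conjc mu by rewrite exprSr.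
rewrite !sum3 /= !addn0 !addn1 !addn2 /bloch_wave i1 i2 j1 j2 -/i -/j nk ml nk2 ml2.
rewrite [RHS]mulrCA -h; ring.
Qed.

Definition truncated_wave nu mu X N : Z2 -> C := fun n =>
  if [&& 0 <= n.1, n.1 < N%:Z, 0 <= n.2 & n.2 < N%:Z]
  then bloch_wave nu mu X (absz n.1) (absz n.2) else 0.

Definition edge N : pred Z2 := fun n =>
  ~~ [&& 2%:Z <= n.1, n.1 < N%:Z - 2%:Z, 2%:Z <= n.2 & n.2 < N%:Z - 2%:Z].

Lemma pt0 k : pt 0 k = k%:Z.
Proof. by rewrite /pt muln0 subr0. Qed.

(** Strictly inside the square the wave solves the eigenvalue equation exactly; elsewhere [Hop] only
    sees sites of [edge], the complement of the square shrunk by two. *)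
Lemma Hop_truncated nu mu X N (Q : Z2 -> R) W s n : cellwise Q W -> unitc nu -> unitc mu ->
  op nu mu W X = s%:C *: X -> let psi := truncated_wave nu mu X N in
  Hop Q s psi n = 0 \/ Hop Q s psi n = Hop Q s (fun m => if edge N m then psi m else 0) n.
Proof.
move=> QW unu umu eX psi; case: n => n m.
have [inn|out] := boolP [&& 1%:Z <= n, n < N%:Z - 1, 1%:Z <= m & m < N%:Z - 1].
  left; have [l lE] : exists l, m = l.+1%:Z by exists (absz m).-1; lia.
  have [k hk] : exists k, n = k.+1%:Z by exists (absz n).-1; lia.
  rewrite lE in inn *; rewrite hk in inn *.
  have vE a b : (a < 3)%N -> (b < 3)%N -> psi ((k + a)%N%:Z, (l + b)%N%:Z) =
      bloch_wave nu mu X (k + a) (l + b).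
    move=> ha hb; rewrite /psi /truncated_wave /=; case: ifP => //; lia.
  have := bloch_wave_eq k l unu umu eX; rewrite !sum3 /= -!vE //.
  rewrite /Hop /box /row3 /=.
  have -> : k.+1%:Z - 1 = (k + 0)%N%:Z by lia.
  have -> : l.+1%:Z - 1 = (l + 0)%N%:Z by lia.
  have -> : k.+1%:Z + 1 = (k + 2)%N%:Z by lia.
  have -> : l.+1%:Z + 1 = (l + 2)%N%:Z by lia.
  have -> : k.+1 = (k + 1)%N by rewrite addn1.
  have -> : l.+1 = (l + 1)%N by rewrite addn1.
  rewrite -(vE 1%N 1%N) //.
  have -> : Q ((k + 1)%N%:Z, (l + 1)%N%:Z) = W (res3 (k + 1)) (res3 (l + 1)).
    by rewrite -!pt0; apply: QW.
  by move=> ->; rewrite rmorphN mulNr subrr.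
right; apply: local_Hop => p np; rewrite /edge; case: ifP => // /negbT; rewrite negbK => h.
by move: out np h; rewrite /near2 /=; lia.
Qed.

Lemma wsum_outside w0 N0 w N psi : (forall n, n \notin window w0 N0 -> psi n = 0) ->
  wsum w N psi <= wsum w0 N0 psi.
Proof.
move=> out; rewrite !wsumE (bigID (mem (window w0 N0))) /= addrC big1 ?add0r.
  rewrite -big_filter; apply: sum_subset.
  - by rewrite filter_uniq // window_uniq.
  - exact: window_uniq.
  - by move=> n; rewrite mem_filter => /andP[].
  - by move=> n; exact: ipcc_ge0.
by move=> n /out ->; rewrite /ipc /= mulr0 addr0.
Qed.

Lemma sum_edge N : \sum_(k < N) (~~ ((2 <= k)%N && (k + 2 < N)%N))%:R <= (4 : R).
Proof.
have one (c : nat) : \sum_(k < N) (k == c :> nat)%:R <= (1 : R).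
  have [cN|cN] := ltnP c N.
    by rewrite (bigD1 (Ordinal cN)) //= eqxx big1 ?addr0 // => k; rewrite -val_eqE /= => /negPf ->.
  by rewrite big1 // => k _; rewrite (_ : (_ == _) = false) //; apply/eqP; have := ltn_ord k; lia.
pose F (k : 'I_N) (c : nat) : R := (k == c :> nat)%:R.
apply: (@le_trans _ _ (\sum_(k < N) (F k 0%N + F k 1%N + F k (N - 1)%N + F k (N - 2)%N))).
  apply: ler_sum => k _; rewrite /F -!natrD ler_nat; have := ltn_ord k.
  by do ![case: eqP => ?]; case: (boolP ((2 <= k)%N && (k + 2 < N)%N)) => ?; lia.
rewrite !big_split /= /F; have := one 0%N; have := one 1%N; have := one (N - 1)%N; have := one (N - 2)%N.
by move: (\sum_(k < N) _) (\sum_(k < N) _) (\sum_(k < N) _) (\sum_(k < N) _) => *; lra.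
Qed.

Lemma sum_period (q : nat) (f : 'I_3 -> R) :
  \sum_(k < 3 * q) f (res3 k) = q%:R * \sum_(i < 3) f i.
Proof.
elim: q => [|q IH]; first by rewrite muln0 big_ord0 mul0r.
rewrite mulnS addnC -natr1 mulrDl mul1r -IH.
rewrite big_split_ord /=; congr (_ + _); apply: eq_bigr => i _; congr (f _).
by apply: val_inj => /=; have := ltn_ord i; lia.
Qed.

Lemma wsum_truncated nu mu X q : unitc nu -> unitc mu ->
  wsum 0 (3 * q) (truncated_wave nu mu X (3 * q)) = q%:R ^+ 2 * nsq X.
Proof.
move=> unu umu; rewrite /wsum.
transitivity (\sum_(k < 3 * q) \sum_(l < 3 * q)
    ipc (X (res3 k) (res3 l)) (X (res3 k) (res3 l))).
  apply: eq_bigr => k _; apply: eq_bigr => l _; rewrite !pt0 /truncated_wave /=.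
  by rewrite !ltz_nat !ltn_ord /= bloch_wave_ipc.
under eq_bigr => k _ do rewrite (sum_period q (fun j => ipc (X (res3 k) j) (X (res3 k) j))).
rewrite (sum_period q (fun i => q%:R * \sum_j ipc (X i j) (X i j))) -mulr_sumr mulrA -expr2.
by rewrite /nsq ipE.
Qed.

Lemma truncated_out nu mu X N n : n \notin window 0 N -> truncated_wave nu mu X N n = 0.
Proof.
by rewrite window_mem muln0 !addr0 /truncated_wave => /negPf ->.
Qed.

(** At most four indices in each direction belong to the edge, hence at most 8 N sites of the
    window. *)
Lemma wsum_edge nu mu X N : unitc nu -> unitc mu ->
  wsum 0 N (fun m => if edge N m then truncated_wave nu mu X N m else 0) <=
  8 * N%:R * nsq X.
Proof.
move=> unu umu; pose ed (k : nat) : R := (~~ ((2 <= k)%N && (k + 2 < N)%N))%:R.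
have xle i j : ipc (X i j) (X i j) <= nsq X.
  rewrite /nsq ipE (bigD1 i) //= (bigD1 j) //= -addrA lerDl addr_ge0 //.
    by apply: sumr_ge0 => k _; exact: ipcc_ge0.
  by apply: sumr_ge0 => k _; apply: sumr_ge0 => l _; exact: ipcc_ge0.
apply: (@le_trans _ _ (\sum_(k < N) \sum_(l < N) (ed k + ed l) * nsq X)).
  apply: ler_sum => k _; apply: ler_sum => l _; rewrite !pt0.
  case: ifP => [ekl|_]; last first.
    rewrite {1}/ipc /= mulr0 addr0; apply: mulr_ge0 (nsq_ge0 _).
    by rewrite /ed -natrD ler0n.
  rewrite /truncated_wave /= !ltz_nat !ltn_ord /= bloch_wave_ipc //.
  apply: le_trans (xle _ _) _; rewrite -[leLHS]mul1r ler_wpM2r ?nsq_ge0 //.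
  rewrite /ed -natrD ler1n; move: ekl; rewrite /edge /=; have := ltn_ord k; have := ltn_ord l.
  by case: (boolP ((2 <= k)%N && (k + 2 < N)%N)); case: (boolP ((2 <= l)%N && (l + 2 < N)%N)); lia.
under eq_bigr => k _ do rewrite -mulr_suml big_split /= sumr_const card_ord -[_ *+ N]mulr_natl.
rewrite -mulr_suml big_split /= -mulr_sumr sumr_const card_ord -[X in _ + X]mulr_natl.
apply: ler_wpM2r; first exact: nsq_ge0.
have : \sum_(k < N) ed k <= 4 := sum_edge N; move: (\sum_(k < N) _) => x x4.
rewrite -mulrDr [8 * _]mulrC; apply: ler_wpM2l => //; move: x4; clear; lra.
Qed.

(** Area against perimeter: on a square of side 3 q the truncated wave has squared norm q^2 |X|^2,
    while that of its image is O(q). A bounded inverse would therefore bound q. *)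
Lemma eigen_spectrum (Q : Z2 -> R) W nu mu X s : cellwise Q W -> unitc nu -> unitc mu -> X != 0 ->
  op nu mu W X = s%:C *: X -> spectrum (schrodinger_sqn Q) ((s - 1) +i* 0).
Proof.
move=> QW unu umu X0 eX [B [[_ _ [Mb hMb]] hB]].
have [a a0 ha] := Hop_le2 s QW; rewrite -nsq_gt0 in X0.
have key (q : nat) : q%:R ^+ 2 * nsq X <= Mb ^+ 2 * (a * (8 * (3 * q)%N%:R * nsq X)).
  pose psi := truncated_wave nu mu X (3 * q).
  pose phi m := if edge (3 * q) m then psi m else 0.
  have psi_le2 : le2 psi (wsum 0 (3 * q) psi).
    by move=> w N; apply: wsum_outside => n; exact: truncated_out.
  have phi_le2 : le2 phi (8 * (3 * q)%N%:R * nsq X).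
    move=> w N; apply: le_trans (wsum_edge _ _ unu umu); apply: wsum_outside => n hn.
    by rewrite /phi; case: ifP => // _; exact: truncated_out.
  have Hpsi_le2 : le2 (Hop Q s psi) (a * (8 * (3 * q)%N%:R * nsq X)).
    move=> w N; apply: le_trans (ha _ _ phi_le2 w N).
    apply: ler_sum => k _; apply: ler_sum => l _.
    have [->|->] := Hop_truncated (3 * q) (pt w k, pt w l) QW unu umu eX => //.
    by rewrite {1}/ipc /= mulr0 addr0 ipcc_ge0.
  have ell_psi : ell2 psi by apply/ell2P; eexists; exact: psi_le2.
  have ell_H : ell2 (Hop Q s psi) by apply/ell2P; eexists; exact: Hpsi_le2.
  have BH : B (Hop Q s psi) = psi.
    have [+ _] := hB psi ell_psi; rewrite shift_operatorE (_ : shiftP _ _ _ _ = Hop Q s psi) //.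
    have -> : 1 + (s - 1) = s by rewrite addrCA subrr addr0.
    have -> : - (0 +i* 0) = 0 :> C by rewrite (_ : 0 +i* 0 = 0) ?oppr0.
    by apply/funext => n; rewrite /shiftP mul0r add0r.
  have hn := hMb _ ell_H; rewrite BH in hn.
  rewrite -(wsum_truncated X q unu umu) -/psi; apply: le_trans (le2_norm ell_psi 0%N (3 * q)%N) _.
  have n0 : 0 <= ell2_norm psi by exact: sqrtr_ge0.
  have n0' : 0 <= ell2_norm (Hop Q s psi) by exact: sqrtr_ge0.
  apply: (@le_trans _ _ ((Mb * ell2_norm (Hop Q s psi)) ^+ 2)).
    by rewrite ler_sqr ?nnegrE // (le_trans n0).
  rewrite exprMn ler_wpM2l ?sqr_ge0 //.
  have h1 := norm_le2 Hpsi_le2; have M0 := le2_ge0 Hpsi_le2.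
  by rewrite -[leRHS](sqr_sqrtr M0) ler_sqr ?nnegrE ?sqrtr_ge0.
pose D := Mb ^+ 2 * (a * 24).
have D0 : 0 <= D by rewrite /D mulr_ge0 ?sqr_ge0 // mulr_ge0.
have lin q : (0 < q)%N -> q%:R <= D.
  move=> q0; have qR : 0 < (q%:R : R) by rewrite ltr0n.
  have := key q; rewrite natrM => h; rewrite -(ler_pM2l qR) -(ler_pM2r X0).
  by rewrite -expr2; apply: le_trans h _; rewrite le_eqVlt; apply/orP; left; apply/eqP; rewrite /D; ring.
have := lin (Num.bound D).+1 isT; apply/negP; rewrite -ltNge.
by apply: lt_le_trans (archi_boundP D0) _; rewrite ler_nat.
Qed.

End Weyl.

(** * The spectrum of the model *)

Section Potential.
Context {R : realType}.
Local Notation C := R[i].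
Local Notation V := 'M[C]_3.

Definition ehm_r : R := Num.sqrt (4 - Num.sqrt 15).

Lemma lt_of_sqr (a b : R) : 0 <= b -> a ^+ 2 < b ^+ 2 -> a < b.
Proof.
move=> b0 h; rewrite ltNge; apply/negP => ba.
by have := ler_pM b0 b0 ba ba; rewrite -!expr2 leNgt h.
Qed.

Lemma ehm_r_bounds : r_bounds ehm_r.
Proof.
pose t : R := Num.sqrt 15; have t2 : t ^+ 2 = 15 by rewrite sqr_sqrtr.
have t0 : 0 <= t by exact: sqrtr_ge0.
(* 31/8 and 1677/433 are convergents of sqrt 15. The sharp one serves the last bound of [r_bounds]:
   15 * 561/200 - 26 * 713/2000 = 32.806, just above 32.8. *)
have tl : 1677 / 433 < t by apply: lt_of_sqr => //; rewrite t2; lra.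
have tu : t < 31 / 8 by apply: lt_of_sqr; rewrite ?t2; lra.
have r2 : ehm_r ^+ 2 = 4 - t by rewrite sqr_sqrtr // -/t; move: tu; clear; lra.
have r0 : 0 < ehm_r by rewrite sqrtr_gt0 -/t; move: tu; clear; lra.
have ri0 : 0 < ehm_r^-1 by rewrite invr_gt0.
have ri2 : ehm_r^-1 ^+ 2 = 4 + t.
  rewrite exprVn r2; apply: (@mulfI _ (4 - t)); first by rewrite gt_eqF //; move: tu; clear; lra.
  rewrite divff; first by move: t2; clear; nra.
  by rewrite gt_eqF //; move: tu; clear; lra.
rewrite /r_bounds; move: ehm_r ehm_r^-1 r2 r0 ri0 ri2 tl tu; clear => r s r2 r0 s0 s2 tl tu.
have ru : r < 713 / 2000 by apply: lt_of_sqr; rewrite ?r2; move: tl; clear; lra.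
have sl : 561 / 200 < s by apply: lt_of_sqr; rewrite ?s2 ?(ltW s0) //; move: tl; clear; lra.
have rl : 35 / 100 < r by apply: lt_of_sqr; rewrite ?r2 ?(ltW r0) //; move: tu; clear; lra.
have su : s < 282 / 100 by apply: lt_of_sqr; rewrite ?s2; move: tu; clear; lra.
by split; move: ru sl rl su; clear; lra.
Qed.

Lemma periodic_shift (Q : Z2 -> R) : periodic33 Q ->
  forall (i j : int) n m, Q (n + 3 * i, m + 3 * j) = Q (n, m).
Proof.
move=> Qp; have s1 (i : nat) n m : Q (n + 3 * i%:Z, m) = Q (n, m).
  elim: i => [|i IH]; first by rewrite mulr0 addr0.
  by rewrite -IH -(Qp (n + 3 * i%:Z) m).1; congr (Q (_, _)); lia.
have s2 (i : nat) n m : Q (n, m + 3 * i%:Z) = Q (n, m).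
  elim: i => [|i IH]; first by rewrite mulr0 addr0.
  by rewrite -IH -(Qp n (m + 3 * i%:Z)).2; congr (Q (_, _)); lia.
have t1 (i : int) n m : Q (n + 3 * i, m) = Q (n, m).
  case: i => i; first exact: s1.
  by rewrite -(s1 i.+1 (n + 3 * Negz i)); congr (Q (_, _)); lia.
have t2 (i : int) n m : Q (n, m + 3 * i) = Q (n, m).
  case: i => i; first exact: s2.
  by rewrite -(s2 i.+1 n (m + 3 * Negz i)); congr (Q (_, _)); lia.
by move=> i j n m; rewrite t1 t2.
Qed.

Lemma ehm_cellwise (Q : Z2 -> R) (lam : R) : periodic33 Q ->
  (forall n m : 'I_3, Q (n%:Z, m%:Z) = (ehm_q R)`_(n + 3 * m)) ->
  cellwise (fun n => lam * Q n) (fun i j => lam * pot ehm_r i j).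
Proof.
move=> Qp Qv w k l i j ki lj; congr (_ * _).
have -> : pt w k = i%:Z + 3 * ((k %/ 3)%N%:Z - w%:Z) by rewrite /pt; lia.
have -> : pt w l = j%:Z + 3 * ((l %/ 3)%N%:Z - w%:Z) by rewrite /pt; lia.
rewrite periodic_shift // Qv /ehm_q -/ehm_r /pot.
by elim/ord3P: i {ki}; elim/ord3P: j {lj}; rewrite !ggE /=; ring.
Qed.

(** Reality of the spectrum comes from the case y != 0, where y^2 alone bounds (H - x)^2 + y^2
    below. *)
Lemma spectrumP (Q : Z2 -> R) (lam : R) (z : C) : periodic33 Q ->
  (forall n m : 'I_3, Q (n%:Z, m%:Z) = (ehm_q R)`_(n + 3 * m)) ->
  spectrum (schrodinger_sqn (fun n => lam * Q n)) z <->
  exists2 E : R, ~ regular ehm_r lam (1 + E) & z = E%:C.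
Proof.
move=> Qp Qv; have QW := ehm_cellwise lam Qp Qv; split; last first.
  move=> [E /irregular_eigen[nu [mu [X [unu umu X0 eX]]]] ->].
  have -> : E%:C = (1 + E - 1) +i* 0 by congr (_ +i* _); ring.
  exact: eigen_spectrum QW unu umu X0 eX.
case: z => x y h; have [y0|y0] := eqVneq y 0; last first.
  exfalso; apply: h; apply: (resolvent_of_bound QW (lexx 0)).
    by rewrite add0r exprn_even_gt0.
  by move=> nu mu X _ _; rewrite mul0r nsq_ge0.
exists x; last by rewrite y0.
move=> reg; apply: h; have [c c0 hc] := regular_uniform reg.
apply: (resolvent_of_bound QW (ltW c0)); first by rewrite y0 expr0n addr0.
by move=> nu mu X unu umu; have := hc nu mu X unu umu; rewrite shifted_op.
Qed.

Lemma real_resolventP (Q : Z2 -> R) (lam : R) (E : R) : periodic33 Q ->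
  (forall n m : 'I_3, Q (n%:Z, m%:Z) = (ehm_q R)`_(n + 3 * m)) ->
  real_resolvent_set (schrodinger_sqn (fun n => lam * Q n)) E <-> regular ehm_r lam (1 + E).
Proof.
move=> Qp Qv; rewrite /real_resolvent_set /=; split.
  by move=> h; apply: contrapT => nr; apply: h; apply/(spectrumP _ _ Qp Qv); exists E.
by move=> reg /(spectrumP _ _ Qp Qv)[E' + /complexI EE]; rewrite -EE.
Qed.

End Potential.

(** * Connected components of the spectrum and of the gap *)

Section Components.
Context {R : realType}.
Local Notation C := R[i].

Definition embed (E : R) : R[i]^o := E%:C.

Lemma embed_continuous : continuous embed.
Proof.
move=> E; apply/(@cvgrPdist_lt _ R[i]^o) => e e0.
have er : 0 < Re e by move: e0; rewrite ltcE => /andP[].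
have eE : e = (Re e)%:C by move: e0; case: e {er} => a b; rewrite ltcE /= => /andP[/eqP -> _].
exists (Re e) => // F /= h.
by rewrite eE /embed -rmorphB normc_def /= expr0n addr0 sqrtr_sqr ltcR.
Qed.

Lemma Re_continuous : continuous (fun z : R[i]^o => Re z : R).
Proof.
move=> z A /nbhs_ballP[e /= e0 eA]; exists e%:C => /=; first by rewrite ltcR.
move=> w /= h; apply: eA; move: h; rewrite normc_def ltcR /ball /=; apply: le_lt_trans.
case: z w => a b [c d] /=; rewrite -sqrtr_sqr; apply: ler_wsqrtr.
by rewrite lerDl sqr_ge0.
Qed.

Lemma interval_of_between (S : set R) : (forall a s b, a < s -> s < b -> S a -> S b -> S s) ->
  is_interval S.
Proof.
move=> h a b Sa Sb c; rewrite !le_eqVlt => /andP[/orP[/eqP <- //|ac] /orP[/eqP -> //|cb]].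
exact: h ac cb Sa Sb.
Qed.

(** [embed] carries intervals to connected sets and the real part carries connected sets back to
    intervals, so components in the plane are images of components on the line. *)
Lemma embed_component (S : set R) (A : set R) x : A `<=` S -> is_interval A -> A x ->
  (forall I : set R, I `<=` S -> is_interval I -> I x -> I `<=` A) ->
  connected_component (embed @` S) (embed x) = embed @` A.
Proof.
move=> AS Ai Ax Amax; apply/seteqP; split; last first.
  apply: connected_component_max.
  - by exists x.
  - by move=> _ [y Ay <-]; exists y => //; exact: AS.
  - apply: connected_continuous_connected; first exact/connected_intervalP.
    exact: continuous_subspaceT embed_continuous.
move=> z [I [Ix IS Ic] Iz].
have [y Sy yz] := IS z Iz; exists y => //.
apply: (Amax ((fun z : R[i]^o => Re z) @` I)).
- by move=> _ [w /IS[v Sv <-] <-].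
- apply/connected_intervalP; apply: connected_continuous_connected => //.
  exact: continuous_subspaceT Re_continuous.
- by exists (embed x).
- by exists z => //; rewrite -yz.
Qed.

(** No interval inside S crosses p, so the two parts of S are its components; [lo] and [hi] make
    both inhabited, hence distinct. *)
Lemma two_components (S : set R) (p lo hi : R) : ~ S p -> lo < p -> p < hi -> S lo -> S hi ->
  is_interval (S `&` [set x | x < p]) -> is_interval (S `&` [set x | p < x]) ->
  (connected_components (embed @` S) #= `I_2)%card.
Proof.
move=> Sp lop phi Slo Shi iA iB; set A := S `&` _ in iA; set B := S `&` _ in iB.
have between (I : set R) x y : I `<=` S -> is_interval I -> I x -> I y -> x < p -> p < y -> False.
  by move=> IS Ii Ix Iy xp py; apply: Sp; apply: IS; apply: (Ii x y Ix Iy); rewrite !ltW.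
have neq x : S x -> x < p \/ p < x.
  by move=> Sx; case: (ltgtP x p) => [|| e]; [left|right|rewrite e in Sx].
have cA x : A x -> connected_component (embed @` S) (embed x) = embed @` A.
  move=> [Sx xp]; apply: embed_component => //; first by move=> y [].
  move=> I IS Ii Ix y Iy; split; first exact: IS.
  by case: (neq y (IS y Iy)) => // py; case: (between I x y IS Ii Ix Iy xp py).
have cB x : B x -> connected_component (embed @` S) (embed x) = embed @` B.
  move=> [Sx xp]; apply: embed_component => //; first by move=> y [].
  move=> I IS Ii Ix y Iy; split; first exact: IS.
  by case: (neq y (IS y Iy)) => // py; case: (between I y x IS Ii Iy Ix py xp).
have Alo : A lo by split. have Bhi : B hi by split.
have AB : embed @` A <> embed @` B.
  move=> e; have : (embed @` A) (embed lo) by exists lo.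
  by rewrite e => -[y [_ /= py] /complexI yl]; move: lop; rewrite -yl ltNge (ltW py).
have -> : connected_components (embed @` S) =
    (fun k : nat => if k == 0%N then embed @` A else embed @` B) @` `I_2.
  apply/seteqP; split.
    move=> _ [_ [x Sx <-] <-]; case: (neq x Sx) => hx.
      by exists 0%N => //=; rewrite cA.
    by exists 1%N => //=; rewrite cB.
  move=> _ [[|[|//]] _ <-] /=.
    by exists (embed lo); [exists lo | rewrite cA].
  by exists (embed hi); [exists hi | rewrite cB].
apply: inj_card_eq => -[|[|k]] [|[|l]]; rewrite !inE //= => _ _ //.
by move=> e; case: AB; rewrite e.
Qed.

Lemma gap_inclusion (S : set R) (p d e : R) : 0 < d -> 0 < e ->
  (forall E, p - d < E -> E < p + d -> S E) -> ~ S (p - e) -> ~ S (p + e) ->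
  `]p - d, p + d[ `<=` connected_component S p /\
  connected_component S p `<=` `]p - e, p + e[.
Proof.
move=> d0 e0 hd hl hr.
have ci : is_interval (connected_component S p).
  by apply/connected_intervalP; exact: component_connected.
have cS := @connected_component_sub R S p.
have Sp : S p by apply: hd; rewrite ?ltrBlDr ltrDl.
have cp := connected_component_refl Sp.
split.
  apply: connected_component_max.
  - by rewrite /= in_itv /= ltrBlDr !ltrDl d0.
  - by move=> E; rewrite /= in_itv /= => /andP[]; exact: hd.
  - by apply/connected_intervalP; exact: interval_is_interval.
move=> E cE; rewrite /= in_itv /= !ltNge; apply/andP; split; apply/negP => h.
  by apply: hl; apply: cS; apply: (ci E p cE cp); rewrite h /= lerBlDr lerDl ltW.
by apply: hr; apply: cS; apply: (ci p E cp cE); rewrite h andbT lerDl ltW.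
Qed.

Lemma gap_measure (S : set R) (p d e : R) : 0 < d -> 0 < e ->
  `]p - d, p + d[ `<=` connected_component S p ->
  connected_component S p `<=` `]p - e, p + e[ ->
  ((2 * d)%:E <= lebesgue_measure (connected_component S p) <= (2 * e)%:E)%E.
Proof.
move=> d0 e0 h1 h2.
have cm : measurable (connected_component S p : set R).
  by apply: measurable_realfun.is_interval_measurable; apply/connected_intervalP; exact: component_connected.
have len (x : R) : 0 < x -> lebesgue_measure (`]p - x, p + x[ : set R) = (2 * x)%:E.
  move=> x0; rewrite lebesgue_measure_itv /= lte_fin ltrBlDr -addrA ltrDl addr_gt0 // -EFinD.
  by congr EFin; ring.
by rewrite -(len d) // -(len e) //; apply/andP; split; apply: le_measure => //;
  rewrite inE //; exact: measurable_itv.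
Qed.

End Components.

Section Main.
Context {R : realType}.

Lemma small_coupling : exists2 lam0 : R, 0 < lam0 & forall lam, 0 < lam -> lam < lam0 ->
  [/\ forall t, `|t| <= 1 / 10 -> regular ehm_r lam (lam * t),
      ~ regular ehm_r lam (- (lam / 4)), ~ regular ehm_r lam (lam / 4) & 100 * lam <= 1].
Proof.
have [lam0 lam00 h] := @middle_gap R; have rb := @ehm_r_bounds R.
exists (Num.min lam0 (1 / 100)); first by rewrite lt_min lam00 divr_gt0.
move=> lam l0; rewrite lt_min => /andP[l1 l2].
have l3 : 100 * lam <= 1 by move: l2; lra.
have [e1 e2] := band_edges rb l0 l3.
by split => // t t1; apply: h => //; exact: ltW.
Qed.

End Main.

Close Scope complex_scope.

Theorem theorem5p6 (R : realType) (Q : Z2 -> R)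
    (Qper : periodic33 Q)
    (Qval : forall n m : 'I_3, Q (n%:Z, m%:Z) = (ehm_q R)`_(n + 3 * m)) :
  let H (lambda : R) := schrodinger_sqn (fun n => lambda * Q n) in
  let gap (lambda : R) :=
    connected_component (real_resolvent_set (H lambda)) (- 1) in
  [/\ \forall lambda \near 0^'+,
        (connected_components (spectrum (H lambda)) #= `I_2)%card,
      \forall lambda \near 0^'+,
        `]- 1 - lambda / 10, - 1 + lambda / 10[ `<=` gap lambda /\
        gap lambda `<=` `]- 1 - lambda / 4, - 1 + lambda / 4[ &
      exists c C : R, [/\ 0 < c, 0 < C & \forall lambda \near 0^'+,
        ((c * lambda)%:E <= lebesgue_measure (gap lambda) <=
           (C * lambda)%:E)%E]].
Proof.
move=> H gap; have [lam0 lam00 small] := @small_coupling R.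
have near0 (P : R -> Prop) : (forall lam, 0 < lam -> lam < lam0 -> P lam) ->
    \forall lam \near 0^'+, P lam.
  move=> hP; near=> lam; apply: hP; first by near: lam; exact: nbhs_right_gt.
  by near: lam; exact: nbhs_right_lt.
have rsE lam : real_resolvent_set (H lam) = [set E | regular ehm_r lam (1 + E)].
  by apply/seteqP; split=> E /(real_resolventP lam E Qper Qval).
have gapP lam : 0 < lam -> lam < lam0 ->
    `]- 1 - lam / 10, - 1 + lam / 10[ `<=` gap lam /\
    gap lam `<=` `]- 1 - lam / 4, - 1 + lam / 4[.
  move=> l0 l1; have [mid lo hi _] := small lam l0 l1; rewrite /gap rsE.
  apply: gap_inclusion; rewrite ?divr_gt0 //=.
  - move=> E h1 h2; have -> : 1 + E = lam * ((1 + E) / lam).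
      by rewrite mulrC divfK // gt_eqF.
    apply: mid; rewrite normrM (gtr0_norm (_ : 0 < lam^-1)) ?invr_gt0 // ler_pdivrMr // ler_norml.
    by apply/andP; split; lra.
  - by rewrite (_ : 1 + (-1 - lam / 4) = - (lam / 4)) //; ring.
  - by rewrite (_ : 1 + (-1 + lam / 4) = lam / 4) //; ring.
split.
- apply: near0 => lam l0 l1; have [mid lo hi l3] := small lam l0 l1.
  have rb := @ehm_r_bounds R.
  have r0 : regular ehm_r lam 0 by rewrite -(mulr0 lam); apply: mid; rewrite normr0 divr_ge0.
  pose S : set R := [set E | ~ regular ehm_r lam (1 + E)].
  have -> : spectrum (H lam) = embed @` S.
    apply/seteqP; split=> [z /(spectrumP lam z Qper Qval)[E nE ->]|z [E nE <-]]; first by exists E.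
    by apply/(spectrumP lam _ Qper Qval); exists E.
  (* The energies -1 - lam / 4 and -1 + lam / 4, which are excluded from the gap, lie in the
     spectrum and serve as witnesses on its two sides. *)
  apply: (@two_components R S (-1) (-1 - lam / 4) (-1 + lam / 4)).
  + by rewrite /S /= subrr; exact.
  + by rewrite ltrBlDr ltrDl divr_gt0.
  + by rewrite ltrDl divr_gt0.
  + by rewrite /S /= (_ : 1 + (-1 - lam / 4) = - (lam / 4)) //; ring.
  + by rewrite /S /= (_ : 1 + (-1 + lam / 4) = lam / 4) //; ring.
  + apply: interval_of_between => a s b as_ sb [/= na _] [/= nb b1]; split => /=; last by exact: lt_trans b1.
    by move=> reg; apply: (lower_band rb l0 l3 r0 reg _ _ _ na nb); lra.
  + apply: interval_of_between => a s b as_ sb [/= na a1] [/= nb _]; split => /=; last by exact: lt_trans as_.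
    by move=> reg; apply: (upper_band rb l0 l3 r0 reg _ _ _ na nb); lra.
- exact: near0.
(* Twice the half-widths lam / 10 and lam / 4, divided by lam. *)
exists (1 / 5), (1 / 2); split; rewrite ?divr_gt0 //; apply: near0 => lam l0 l1.
have [h1 h2] := gapP lam l0 l1.
have d0 : 0 < lam / 10 by rewrite divr_gt0.
have e0 : 0 < lam / 4 by rewrite divr_gt0.
have := gap_measure d0 e0 h1 h2.
have -> : 2 * (lam / 10) = 1 / 5 * lam by field.
by have -> : 2 * (lam / 4) = 1 / 2 * lam by field.
Unshelve. all: by end_near.
Qed.
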